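(* Let $n\ge 1$ and let $C\subset\mathbb{R}^{n+1}$ be an unbounded convex body with non-degenerate asymptotic cone $C_\infty$. Then $$\frac{I_C(v)}{I_{C_\infty}(v)}\ge 1\qquad\text{for all } v>0.$$ Moreover, $$\lim_{v\to\infty}\frac{I_C(v)}{I_{C_\infty}(v)}=1.$$
   Context: An unbounded convex body $C\subset\mathbb{R}^{n+1}$ is a closed unbounded convex set with non-empty interior. Its asymptotic cone is $C_\infty=\bigcap_{\lambda>0}\lambda(C-p)$, where $p\in C$ is any point (the set does not depend on $p$); if $0\in C$ this is $\bigcap_{\lambda>0}\lambda C$. It is called non-degenerate if $\dim C_\infty=n+1$, i.e. if it has non-empty interior. The volume $|E|$ of a set $E$ is its $(n+1)$-dimensional Lebesgue (Hausdorff) measure. For a closed convex set $C$ with non-empty interior and measurable $E\subset C$, the relative perimeter of $E$ in $\operatorname{int}(C)$ is $P_C(E)=\sup\{\int_E \operatorname{div}\xi\,dx\}$, the supremum being over smooth vector fields $\xi$ with compact support in $\operatorname{int}(C)$ and $|\xi|\le 1$. The isoperimetric profile of $C$ is $I_C(v)=\inf\{P_C(E): E\subset C,\ |E|=v\}$, and $I_{C_\infty}$ is defined in the same way for $C_\infty$. *)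

(* Defs.v *)
From HB Require Import structures.
From mathcomp Require Import all_boot all_order all_algebra.
From mathcomp Require Import all_classical all_reals all_analysis.

Set Implicit Arguments.
Unset Strict Implicit.
Unset Printing Implicit Defensive.

Import Order.TTheory GRing.Theory Num.Theory.
Import numFieldNormedType.Exports.

Local Open Scope classical_set_scope.
Local Open Scope ring_scope.

(* R^n is 'rV[R]_n. The library has Lebesgue measure on R only, so it is
   built here on 'rV[R]_n as the n-fold product of the one-dimensional one,
   followed by completion. *)
Section LebesgueMeasure.
Variable R : realType.

(* Generators of the product sigma-algebra: the sets {x | x_i \in B}, with B
   a Borel subset of R. *)
Definition cylinders (n : nat) : set (set 'rV[R]_n) :=
  [set A | exists (i : 'I_n) (B : set (measurableTypeR R)),
     measurable B /\ A = [set x : 'rV[R]_n | B (x ord0 i)]].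

Definition borel_rV (n : nat) := g_sigma_algebraType (@cylinders n).

Definition rV_cons (n : nat) (tx : measurableTypeR R * borel_rV n) :
    borel_rV n.+1 :=
  (row_mx (tx.1 : R)%:M (tx.2 : 'rV[R]_n) : 'rV[R]_(1 + n)).

Definition rV_uncons (n : nat) (x : borel_rV n.+1) :
    measurableTypeR R * borel_rV n :=
  ((x : 'rV[R]_n.+1) ord0 ord0,
   (\row_i (x : 'rV[R]_n.+1) ord0 (lift ord0 i)) : 'rV[R]_n).

Lemma measurable_coord (n : nat) (i : 'I_n) :
  measurable_fun [set: borel_rV n]
    (fun x : borel_rV n => (x : 'rV[R]_n) ord0 i : measurableTypeR R).
Proof.
move=> _ B mB; rewrite setTI; apply: sub_sigma_algebra.
by exists i, B.
Qed.

Lemma measurable_to_rV d (T : measurableType d) (n : nat)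
    (f : T -> borel_rV n) :
  (forall i, measurable_fun [set: T]
    (fun t => (f t : 'rV[R]_n) ord0 i : measurableTypeR R)) ->
  measurable_fun [set: T] f.
Proof.
move=> mf; apply: (@measurability _ _ T (borel_rV n) setT f (@cylinders n)) => //.
by move=> _ [_ [i [B [mB ->]]] <-]; exact: mf.
Qed.

Lemma rV_cons0 (n : nat) (tx : measurableTypeR R * borel_rV n) :
  (rV_cons tx : 'rV[R]_n.+1) ord0 ord0 = tx.1.
Proof.
have := row_mxEl ((tx.1 : R)%:M : 'M[R]_1) (tx.2 : 'rV[R]_n) ord0 ord0.
rewrite (_ : lshift n ord0 = ord0 :> 'I_(1 + n)); last exact/val_inj.
by move=> ->; rewrite mxE eqxx mulr1n.
Qed.

Lemma rV_consS (n : nat) (tx : measurableTypeR R * borel_rV n) (i : 'I_n) :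
  (rV_cons tx : 'rV[R]_n.+1) ord0 (lift ord0 i) = (tx.2 : 'rV[R]_n) ord0 i.
Proof.
have := row_mxEr ((tx.1 : R)%:M : 'M[R]_1) (tx.2 : 'rV[R]_n) ord0 i.
by rewrite (_ : rshift 1 i = lift ord0 i :> 'I_(1 + n)); last exact/val_inj.
Qed.

Lemma rV_consK (n : nat) : cancel (@rV_cons n) (@rV_uncons n).
Proof.
move=> [t x]; rewrite /rV_uncons rV_cons0; congr pair.
by apply/rowP => i; rewrite mxE rV_consS.
Qed.

Lemma measurable_rV_cons (n : nat) :
  measurable_fun [set: measurableTypeR R * borel_rV n] (@rV_cons n).
Proof.
apply: measurable_to_rV => i; case: (unliftP ord0 i) => [j|] ->.
- under eq_fun do rewrite rV_consS.
  exact: (measurableT_comp (measurable_coord j) measurable_snd).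
- under eq_fun do rewrite rV_cons0.
  exact: measurable_fst.
Qed.

Lemma measurable_rV_uncons (n : nat) :
  measurable_fun [set: borel_rV n.+1] (@rV_uncons n).
Proof.
apply: measurable_fun_pair; first exact: measurable_coord.
apply: measurable_to_rV => i.
under eq_fun do rewrite mxE.
exact: measurable_coord.
Qed.

Section product_step.
Variables (n : nat) (m : {sigma_finite_measure set (borel_rV n) -> \bar R}).

Definition product_rV : set (borel_rV n.+1) -> \bar R :=
  pushforward (@lebesgue_measure R \x m)%E (@rV_cons n).

Let product_rV0 : product_rV set0 = 0%E.
Proof. by rewrite /product_rV /pushforward preimage_set0 measure0. Qed.

Let product_rV_ge0 A : (0 <= product_rV A)%E.
Proof. by rewrite /product_rV /pushforward measure_ge0. Qed.

Let product_rV_semi_sigma_additive : semi_sigma_additive product_rV.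
Proof.
have mf A : measurable A -> measurable (@rV_cons n @^-1` A).
  by move=> mA; rewrite -[X in measurable X]setTI; exact: measurable_rV_cons.
move=> F mF tF mUF; rewrite /product_rV /pushforward preimage_bigcup.
apply: measure_semi_sigma_additive.
- by move=> k; exact: mf.
- apply/trivIsetP => i j _ _ ij; rewrite -preimage_setI.
  by move/trivIsetP : tF => /(_ _ _ _ _ ij) ->//; rewrite preimage_set0.
- by rewrite -preimage_bigcup; exact: mf.
Qed.

HB.instance Definition _ := isMeasure.Build _ _ _ product_rV
  product_rV0 product_rV_ge0 product_rV_semi_sigma_additive.

Let product_rV_sigma_finite : sigma_finite [set: borel_rV n.+1] product_rV.
Proof.
have /sigma_finiteP[F [FT ndF mF]] := sigma_finiteT (@lebesgue_measure R).
have /sigma_finiteP[G [GT ndG mG]] := sigma_finiteT m.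
exists (fun k => @rV_uncons n @^-1` (F k `*` G k)).
  apply/esym; rewrite -subTset => x _.
  have [k _ Fk] : (\bigcup_k F k) (rV_uncons x).1 by rewrite -FT.
  have [l _ Gl] : (\bigcup_k G k) (rV_uncons x).2 by rewrite -GT.
  exists (maxn k l) => //; split => /=.
    by have /subsetPset := ndF _ _ (leq_maxl k l); exact.
  by have /subsetPset := ndG _ _ (leq_maxr k l); exact.
move=> k; have [mFk Fkoo] := mF k; have [mGk Gkoo] := mG k; split.
  rewrite -[X in measurable X]setTI; apply: measurable_rV_uncons => //.
  exact: measurableX.
rewrite /product_rV /pushforward -comp_preimage.
rewrite (_ : @rV_uncons n \o @rV_cons n = id); last first.
  by apply/funext => x /=; rewrite rV_consK.
by rewrite preimage_id product_measure1E// lte_mul_pinfty// ge0_fin_numE.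
Qed.

HB.instance Definition _ := Measure_isSigmaFinite.Build _ _ _ product_rV
  product_rV_sigma_finite.

End product_step.

Fixpoint borel_lebesgue (n : nat) :
    {sigma_finite_measure set (borel_rV n) -> \bar R} :=
  match n with
  | 0 => @dirac _ (borel_rV 0) (0 : 'rV[R]_0) R
  | n'.+1 => product_rV (borel_lebesgue n')
  end.

(* R^n with the sigma-algebra of Lebesgue measurable sets. *)
Definition lebesgue_rV (n : nat) : measurableType _ :=
  caratheodory_type ((borel_lebesgue n)^*)%mu.

Definition volume (n : nat) : set (lebesgue_rV n) -> \bar R :=
  @completed_measure_extension _ _ _ (borel_lebesgue n).

HB.instance Definition _ (n : nat) := Measure.on (@volume n).

End LebesgueMeasure.

Section ConvexBodies.
Variables (R : realType) (n : nat).
Local Notation Rn := 'rV[R]_n.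

Definition unbounded_convex_body (C : set Rn) : Prop :=
  [/\ closed C, convex_set C, ~ bounded_set C & interior C !=set0].

(* \bigcap_(l > 0) l (C - p) *)
Definition asymptotic_cone (C : set Rn) (p : Rn) : set Rn :=
  \bigcap_(l in [set l : R | 0 < l]) [set l *: (x - p) | x in C].

Definition non_degenerate (K : set Rn) : Prop := interior K !=set0.

End ConvexBodies.

Section Perimeter.
Variables (R : realType) (n : nat).
Local Notation Rn := 'rV[R]_n.

(* The norm of the normed module 'rV[R]_n is the sup norm, which induces the
   usual topology and bounded sets but is not the norm in |xi| <= 1. *)
Definition euclidean_norm (x : Rn) : R := Num.sqrt (\sum_i x ord0 i ^+ 2).

Fixpoint continuously_differentiable (k : nat) (f : Rn -> Rn) : Prop :=
  match k with
  | 0 => continuous f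
  | k'.+1 => (forall x, differentiable f x) /\
      forall v, continuously_differentiable k' (fun x => 'D_v f x)
  end.

Definition smooth (f : Rn -> Rn) : Prop :=
  forall k, continuously_differentiable k f.

Definition vector_support (f : Rn -> Rn) : set Rn := closure [set x | f x != 0].

Definition divergence (f : Rn -> Rn) (x : Rn) : R := \tr ('J f x).

Definition test_field (C : set Rn) (xi : Rn -> Rn) : Prop :=
  [/\ smooth xi, compact (vector_support xi), vector_support xi `<=` interior C &
      forall x, euclidean_norm (xi x) <= 1].

Definition perimeter (C E : set Rn) : \bar R :=
  ereal_sup [set (\int[@volume R n]_(x in E) (divergence xi x)%:E)%E
            | xi in test_field C].

(* Profiles are nonnegative. As [fine] sends infinite values to 0 and
   x / 0 = 0, a bound [1 <= fine a / fine b] between two profiles forces both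
   to be positive and finite, so it cannot hold for junk values. *)
Definition isoperimetric_profile (C : set Rn) (v : R) : \bar R :=
  ereal_inf [set perimeter C E | E in [set E : set (lebesgue_rV R n) |
    [/\ measurable E, E `<=` C & volume E = v%:E]]].

End Perimeter.

(* Main.v *)
Require Import Defs.
From HB Require Import structures.
From mathcomp Require Import all_boot all_order all_algebra.
From mathcomp Require Import all_classical all_reals all_analysis.
From mathcomp Require Import measurable_realfun zify ring lra.

(* Write d for the dimension of the space, K for the asymptotic cone, B for
   the Euclidean unit ball and f(r) for the volume of the intersection of C
   with the ball of center p and radius r.

   Lower bound. Let D be closed and convex with D + K included in D, let E be
   a subset of D and let k^d |E| = |K n B|. Then P_D(E) >= d k |E|. Indeed E is
   mapped into K n B by some T whose i-th component increases with the i-th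
   variable and with div T >= d k on E; for finite unions of boxes a discrete
   such T is built by Hadwiger and Ohmann's induction. As T takes its values in
   K, the indicator function of D is nondecreasing along T, so that cutting T
   off near the boundary of D only adds a nonnegative divergence: after
   mollification one gets a test field whose integral on E is almost d k |E|.

   Upper bound. By convexity f(r) / r^d is nonincreasing, hence the relative
   perimeter of C n B(p, r) is at most f'(r) <= d f(r) / r.

   Both bounds agree for C = K and p = 0: if |K n B| rK^d = v then
   I_K(v) = d v / rK. If f(rC) = v they give d v / rK <= I_C(v) <= d v / rC, so
   the ratio lies between 1 and rK / rC <= (rK / rC)^d = f(rC) / (|K n B| rC^d),
   which tends to 1. *)

Set Implicit Arguments.
Unset Strict Implicit.
Unset Printing Implicit Defensive.

Import Order.TTheory GRing.Theory Num.Theory.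
Import numFieldNormedType.Exports.

Local Open Scope classical_set_scope.
Local Open Scope ring_scope.

Local Notation enorm := euclidean_norm.

(** * Boxes and the discrete transport map *)

Section Boxes.
Variables (R : realType) (n : nat).
Local Notation Rn := 'rV[R]_n.
Local Notation box := (Rn * Rn)%type.
Implicit Types (B : box) (s : seq box) (i j : 'I_n) (t : R).

(** The set E is merely measurable and D may have any convex boundary, so both bounds are obtained
    from test fields alone, by difference quotients in place of traces or coarea. The discrete T
    jumps across the cutting hyperplanes. Each jump increases the coordinate concerned, so the
    backward differences of T are nonnegative everywhere and have the required size on the boxes;
    this is all that survives of a divergence, and it is stable under mollification. The sharp
    constant enters only through the inequality of arithmetic and geometric means for a single pair
    of boxes. The field is a mollification of phi T, with phi a smooth cutoff. Its derivative along
    vectors of K in the unit ball is at least -1/rho, the slope of the truncation at radius rho.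
    Hence the divergence is at least -1/rho everywhere, and the part of E that the boxes miss is
    harmless as rho grows. The compact support inside the interior of D is gained by translating D
    along a vector interior to K. For balls f is never differentiated: volumes of thin shells are
    bounded by finite increments of f, and the width of the shell tends to 0 last. *)

Definition halfopen_box B : set Rn :=
  [set x | forall i, B.1 ord0 i < x ord0 i /\ x ord0 i <= B.2 ord0 i].

(** Half-open boxes serve for the source: each point falls on exactly one side of a cut. Closed ones
    serve for the target, because clamping a coordinate may reach either endpoint. *)
Definition closed_box B : set Rn :=
  [set x | forall i, B.1 ord0 i <= x ord0 i /\ x ord0 i <= B.2 ord0 i].

Definition halfopen_boxes s : set Rn := [set x | exists2 B, B \in s & halfopen_box B x].

Definition closed_boxes s : set Rn := [set x | exists2 B, B \in s & closed_box B x].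

Definition box_vol B : R := \prod_i (B.2 ord0 i - B.1 ord0 i).

Definition boxes_vol s : R := \sum_(B <- s) box_vol B.

Definition proper_box B := [forall i, B.1 ord0 i < B.2 ord0 i].

(** Disjointness in the form that the induction on cuts needs: some coordinate hyperplane lies
    between the two boxes. *)
Definition separated B B' :=
  [exists i, (B.2 ord0 i <= B'.1 ord0 i) || (B'.2 ord0 i <= B.1 ord0 i)].

Definition box_family s := all proper_box s && pairwise separated s.

Definition set_coord (x : Rn) i t : Rn := \row_j (if j == i then t else x ord0 j).

Lemma set_coordE x i t j :
  set_coord x i t ord0 j = if j == i then t else x ord0 j.
Proof. by rewrite mxE. Qed.

(** The filter drops the boxes that would become empty, so the remaining ones stay proper and the
    number of boxes can decrease. *)
Definition cut_below i t s : seq box :=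
  [seq (B.1, set_coord B.2 i (Num.min (B.2 ord0 i) t)) | B <- s & B.1 ord0 i < t].

Definition cut_above i t s : seq box :=
  [seq (set_coord B.1 i (Num.max (B.1 ord0 i) t), B.2) | B <- s & t < B.2 ord0 i].

Lemma box_vol_gt0 B : proper_box B -> 0 < box_vol B.
Proof.
by move=> /forallP pB; apply: prodr_gt0 => i _; rewrite subr_gt0.
Qed.

Lemma boxes_vol_ge0 s : box_family s -> 0 <= boxes_vol s.
Proof.
move=> /andP[/allP ps _]; rewrite /boxes_vol big_seq.
by apply: sumr_ge0 => B /ps/box_vol_gt0/ltW.
Qed.

Lemma boxes_vol_gt0 s : box_family s -> (0 < size s)%N -> 0 < boxes_vol s.
Proof.
case: s => // B s /andP[/= /andP[pB ps]] /andP[_ sps] _.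
rewrite /boxes_vol big_cons ltr_pwDl ?box_vol_gt0//.
by apply: boxes_vol_ge0; rewrite /box_family ps.
Qed.

Lemma box_volD1 i B :
  box_vol B = (B.2 ord0 i - B.1 ord0 i) *
    \prod_(k | k != i) (B.2 ord0 k - B.1 ord0 k).
Proof. by rewrite /box_vol (bigD1 i). Qed.

Definition clamp (a b t : R) : R := Num.max a (Num.min b t).

(** With [clamp] the sum runs over all of [s], whatever [t]; its continuity in [t] is then visible,
    as [exists_cut] requires. *)
Lemma cut_below_vol i t s : box_family s -> boxes_vol (cut_below i t s) =
  \sum_(B <- s) (clamp (B.1 ord0 i) (B.2 ord0 i) t - B.1 ord0 i) *
    \prod_(k | k != i) (B.2 ord0 k - B.1 ord0 k).
Proof.
move=> /andP[/allP ps _].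
rewrite /boxes_vol /cut_below big_map big_filter big_mkcond/=.
rewrite big_seq [RHS]big_seq; apply: eq_bigr => B /ps /forallP/(_ i) Bi.
rewrite (box_volD1 i)/= set_coordE eqxx.
rewrite (eq_bigr (fun k => B.2 ord0 k - B.1 ord0 k)); last first.
  by move=> k /negbTE ki; rewrite set_coordE ki.
rewrite /clamp; case: ifPn => h; last first.
  rewrite -leNgt in h.
  by rewrite min_r ?(le_trans h (ltW Bi))// max_l// subrr mul0r.
by congr (_ * _); rewrite max_r// le_min (ltW Bi) ltW.
Qed.

Lemma cut_above_vol i t s : box_family s -> boxes_vol (cut_above i t s) =
  \sum_(B <- s) (B.2 ord0 i - clamp (B.1 ord0 i) (B.2 ord0 i) t) *
    \prod_(k | k != i) (B.2 ord0 k - B.1 ord0 k).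
Proof.
move=> /andP[/allP ps _].
rewrite /boxes_vol /cut_above big_map big_filter big_mkcond/=.
rewrite big_seq [RHS]big_seq; apply: eq_bigr => B /ps /forallP/(_ i) Bi.
rewrite (box_volD1 i)/= set_coordE eqxx.
rewrite (eq_bigr (fun k => B.2 ord0 k - B.1 ord0 k)); last first.
  by move=> k /negbTE ki; rewrite set_coordE ki.
rewrite /clamp; case: ifPn => h.
  by rewrite (min_r (ltW h)).
rewrite -leNgt in h.
by rewrite min_l// max_r ?ltW// subrr mul0r.
Qed.

Lemma cut_vol i t s : box_family s ->
  boxes_vol (cut_below i t s) + boxes_vol (cut_above i t s) = boxes_vol s.
Proof.
move=> fs; rewrite cut_below_vol// cut_above_vol// -big_split/=.
by apply: eq_bigr => B _; rewrite (box_volD1 i) -mulrDl; congr (_ * _); ring.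
Qed.

Lemma cut_below_family i t s : box_family s -> box_family (cut_below i t s).
Proof.
move=> /andP[ps sps]; apply/andP; split.
  apply/allP => C /mapP[B]; rewrite mem_filter => /andP[Bt Bs] ->{C}.
  apply/forallP => k; rewrite set_coordE; have /allP/(_ _ Bs)/forallP pB := ps.
  by case: eqP => [->|]; rewrite ?lt_min ?pB.
rewrite /cut_below pairwise_map.
apply: sub_pairwise (pairwise_filter _ sps) => B B' /existsP[k /=].
move=> /orP kP; apply/existsP; exists k; rewrite !set_coordE.
by have [kE|_] := eqVneq k i; rewrite ?kE in kP *; case: kP => kP;
  rewrite ?ge_min ?kP ?orbT.
Qed.

Lemma cut_above_family i t s : box_family s -> box_family (cut_above i t s).
Proof.
move=> /andP[ps sps]; apply/andP; split.
  apply/allP => C /mapP[B]; rewrite mem_filter => /andP[Bt Bs] ->{C}.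
  apply/forallP => k; rewrite set_coordE; have /allP/(_ _ Bs)/forallP pB := ps.
  by case: eqP => [->|]; rewrite ?gt_max ?pB.
rewrite /cut_above pairwise_map.
apply: sub_pairwise (pairwise_filter _ sps) => B B' /existsP[k /=].
move=> /orP kP; apply/existsP; exists k; rewrite !set_coordE.
by have [kE|_] := eqVneq k i; rewrite ?kE in kP *; case: kP => kP;
  rewrite ?le_max ?kP ?orbT.
Qed.

Lemma size_cut_below i t s : (size (cut_below i t s) <= size s)%N.
Proof. by rewrite size_map size_filter count_size. Qed.

Lemma size_cut_above i t s : (size (cut_above i t s) <= size s)%N.
Proof. by rewrite size_map size_filter count_size. Qed.

Lemma size_cut_below_lt i t s B : B \in s -> t <= B.1 ord0 i ->
  (size (cut_below i t s) < size s)%N.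
Proof.
move=> Bs tB; rewrite size_map size_filter ltn_neqAle count_size andbT -all_count.
by apply/negP => /allP/(_ _ Bs); rewrite ltNge tB.
Qed.

Lemma size_cut_above_lt i t s B : B \in s -> B.2 ord0 i <= t ->
  (size (cut_above i t s) < size s)%N.
Proof.
move=> Bs tB; rewrite size_map size_filter ltn_neqAle count_size andbT -all_count.
by apply/negP => /allP/(_ _ Bs); rewrite ltNge tB.
Qed.

Lemma cut_below_halfopen i t s x : halfopen_boxes s x -> x ord0 i <= t ->
  halfopen_boxes (cut_below i t s) x.
Proof.
move=> [B Bs Bx] xt; exists (B.1, set_coord B.2 i (Num.min (B.2 ord0 i) t)).
  apply/mapP; exists B => //; rewrite mem_filter Bs andbT.
  by rewrite (lt_le_trans (Bx i).1).
move=> k; rewrite set_coordE; split; first exact: (Bx k).1.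
by case: eqP => [->|_]; [rewrite le_min xt (Bx i).2|exact: (Bx k).2].
Qed.

Lemma cut_above_halfopen i t s x : halfopen_boxes s x -> t < x ord0 i ->
  halfopen_boxes (cut_above i t s) x.
Proof.
move=> [B Bs Bx] xt; exists (set_coord B.1 i (Num.max (B.1 ord0 i) t), B.2).
  apply/mapP; exists B => //; rewrite mem_filter Bs andbT.
  by rewrite (lt_le_trans xt)// (Bx i).2.
move=> k; rewrite set_coordE; split; last exact: (Bx k).2.
by case: eqP => [->|_]; [rewrite gt_max xt (Bx i).1|exact: (Bx k).1].
Qed.

Lemma cut_below_closed i t s x : box_family s -> closed_boxes (cut_below i t s) x ->
  closed_boxes s x /\ x ord0 i <= t.
Proof.
move=> fs [C /mapP[B]]; rewrite mem_filter => /andP[Bt Bs] ->{C} Bx; split.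
  exists B => // k; have /= := Bx k; rewrite set_coordE => -[-> ].
  by case: eqP => [->|//]; rewrite le_min => /andP[].
by have /= := Bx i; rewrite set_coordE eqxx le_min => -[_ /andP[]].
Qed.

Lemma cut_above_closed i t s x : box_family s -> closed_boxes (cut_above i t s) x ->
  closed_boxes s x /\ t <= x ord0 i.
Proof.
move=> fs [C /mapP[B]]; rewrite mem_filter => /andP[Bt Bs] ->{C} Bx; split.
  exists B => // k; have /= := Bx k; rewrite set_coordE => -[+ ->].
  by case: eqP => [->|//]; rewrite ge_max => /andP[].
by have /= := Bx i; rewrite set_coordE eqxx ge_max => -[/andP[]].
Qed.

Lemma clamp_continuous a b : continuous (clamp a b).
Proof.
move=> t; apply: (@continuous_max _ _ (cst a) (fun t => Num.min b t) t).
  exact: cvg_cst.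
by apply: (@continuous_min _ _ (cst b) id t); [exact: cvg_cst|exact: cvg_id].
Qed.

Lemma clamp_le a b t u : t <= u -> clamp a b t <= clamp a b u.
Proof.
move=> tu; rewrite /clamp ge_max !le_max lexx/=.
by rewrite le_min !ge_min lexx tu !orbT.
Qed.

Lemma clamp_id a b t : a <= t -> t <= b -> clamp a b t = t.
Proof. by move=> at_ tb; rewrite /clamp min_r// max_r. Qed.

Lemma clamp_ge a b t : a <= clamp a b t.
Proof. by rewrite /clamp le_max lexx. Qed.

Lemma clamp_le_hi a b t : a <= b -> clamp a b t <= b.
Proof. by move=> ab; rewrite /clamp ge_max ab ge_min lexx. Qed.

Lemma exists_cut i s th : box_family s -> 0 <= th <= 1 ->
  exists t, boxes_vol (cut_below i t s) = th * boxes_vol s.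
Proof.
move=> fs /andP[th0 th1].
pose g (t : R) := \sum_(B <- s) (clamp (B.1 ord0 i) (B.2 ord0 i) t - B.1 ord0 i) *
    \prod_(k | k != i) (B.2 ord0 k - B.1 ord0 k).
have gc : continuous g.
  rewrite /g; elim: s {fs} g => [|B s IH] g.
    rewrite /g; under eq_fun do rewrite big_nil; exact: cst_continuous.
  rewrite /g; under eq_fun do rewrite big_cons.
  move=> t; apply: cvgD; last exact: IH.
  apply: cvgMl; apply: cvgB; [exact: clamp_continuous|exact: cvg_cst].
(* Crude bounds for all endpoints: everything lies above [a] and below [b], so [g] goes from 0 to
   the whole volume. *)
pose a := - (\sum_(B <- s) `|B.1 ord0 i|).
pose b := \sum_(B <- s) `|B.2 ord0 i|.
have aP B : B \in s -> a <= B.1 ord0 i.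
  move=> Bs; rewrite lerNl /a (big_rem _ Bs)/=.
  rewrite (le_trans (ler_norm _))// normrN lerDl sumr_ge0//.
have bP B : B \in s -> B.2 ord0 i <= b.
  move=> Bs; rewrite /b (big_rem _ Bs)/=.
  rewrite (le_trans (ler_norm _))// lerDl sumr_ge0//.
have ab : a <= b.
  by rewrite (@le_trans _ _ 0)// ?oppr_le0 sumr_ge0.
have /andP[/allP ps _] := fs.
have ga : g a = 0.
  rewrite /g big_seq big1// => B Bs; have /forallP/(_ i) Bi := ps _ Bs.
  rewrite /clamp min_r ?max_l ?subrr ?mul0r ?aP//.
  by rewrite (le_trans (aP _ Bs))// ltW.
have gb : g b = boxes_vol s.
  rewrite /g /boxes_vol big_seq [RHS]big_seq; apply: eq_bigr => B Bs.
  have /forallP/(_ i) Bi := ps _ Bs.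
  by rewrite /clamp min_l ?bP// max_r ?ltW// (box_volD1 i).
have v0 := boxes_vol_ge0 fs.
have [t _ gt] : exists2 c, c \in `[a, b] & g c = th * boxes_vol s.
  apply: IVT => //; first exact: continuous_subspaceT.
  by rewrite ga gb min_l// max_r// mulr_ge0// ler_piMl.
by exists t; rewrite cut_below_vol.
Qed.

Definition e_ i : Rn := delta_mx ord0 i.

Lemma e_E i j : e_ i ord0 j = (j == i)%:R.
Proof. by rewrite mxE eqxx. Qed.

(* A discrete substitute for the Knothe map, monotone in the sense that the
   i-th coordinate of [T] increases with the i-th variable; the last clause
   says that the divergence of [T] is at least [n * kappa] on [sE]. *)
Definition transport (kappa : R) sE sL (T : Rn -> Rn) : Prop :=
  [/\ forall j, measurable_fun [set: borel_rV R n]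
        (fun x : borel_rV R n => (T x) ord0 j : measurableTypeR R),
      forall x, closed_boxes sL (T x),
      forall i x (h : R), 0 <= h -> T (x - h *: e_ i) ord0 i <= T x ord0 i
    & forall x, halfopen_boxes sE x -> exists2 h0 : R, 0 < h0 &
        forall h, 0 < h < h0 -> n%:R * kappa * h <=
          \sum_i (T x ord0 i - T (x - h *: e_ i) ord0 i)].

(** The map is the increasing affine bijection between the boxes, coordinate by coordinate. Clamping
    extends it to the whole space and keeps it monotone with values in the target. *)
Lemma transport1 (kappa : R) B B' : 0 <= kappa -> proper_box B -> proper_box B' ->
  kappa ^+ n * box_vol B <= box_vol B' -> exists T, transport kappa [:: B] [:: B'] T.
Proof.
move=> k0 /forallP pB /forallP pB' kv.
pose q i := (B'.2 ord0 i - B'.1 ord0 i) / (B.2 ord0 i - B.1 ord0 i).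
have q0 i : 0 < q i by rewrite divr_gt0// subr_gt0.
pose T (x : Rn) : Rn := \row_i (B'.1 ord0 i +
  q i * (clamp (B.1 ord0 i) (B.2 ord0 i) (x ord0 i) - B.1 ord0 i)).
have nkq : n%:R * kappa <= \sum_i q i.
  case: (posnP n) => [n0|n_gt0].
    have -> : (n%:R : R) = 0 by rewrite n0.
    by rewrite mul0r; apply: sumr_ge0 => i _; exact: ltW.
  (* The product of the slopes [q i] is the quotient of the volumes, hence at least [kappa ^+ n]; so
     their arithmetic mean is at least [kappa]. *)
  have := @leif_AGM R 'I_n (mem 'I_n) q.
  rewrite card_ord => /(_ (fun i _ => ltW (q0 i)))[+ _].
  have pq : \prod_(i in 'I_n) q i = box_vol B' / box_vol B.
    by rewrite /q big_split/= prodfV.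
  rewrite pq => qn.
  have kn : kappa ^+ n <= ((\sum_i q i) / n%:R) ^+ n.
    rewrite (le_trans _ qn)// ler_pdivlMr ?box_vol_gt0//; exact/forallP.
  move: kn; rewrite ler_pXn2r ?nnegrE//; last first.
    by rewrite divr_ge0//; apply: sumr_ge0 => i _; exact: ltW.
  by rewrite ler_pdivlMr ?ltr0n// mulrC.
exists T; split.
- move=> j; under eq_fun do rewrite mxE.
  apply: measurable_funD; first exact: measurable_cst.
  apply: measurable_funM; first exact: measurable_cst.
  apply: measurable_funB; last exact: measurable_cst.
  apply: measurable_maxr; first exact: measurable_cst.
  apply: measurable_minr; first exact: measurable_cst.
  exact: measurable_coord.
- move=> x; exists B'; first exact: mem_head.
  move=> i; rewrite mxE lerDl mulr_ge0 ?subr_ge0 ?clamp_ge ?(ltW (q0 i))//; split=> //.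
  rewrite -lerBrDl /q mulrAC ler_pdivrMr ?subr_gt0// ler_pM2l ?subr_gt0//.
  by rewrite lerD2r clamp_le_hi// ltW.
- move=> i x h h0; rewrite !mxE lerD2l ler_pM2l// lerD2r clamp_le//.
  by rewrite !eqxx mulr1 gerBl.
- move=> x [B0]; rewrite inE => /eqP -> Bx.
  (* For smaller [h] every [x - h *: e_ i] is still in the box, where the clamp is the identity.
     This minimum is positive because the box is open below. *)
  exists (\big[Num.min/1]_i (x ord0 i - B.1 ord0 i)).
    by apply: lt_bigmin => // i _; rewrite subr_gt0 (Bx i).1.
  move=> h /andP[h0 /bigmin_gtP[_ hh]].
  rewrite (le_trans (ler_wpM2r (ltW h0) nkq))// mulr_suml; apply: ler_sum => i _.
  have /= hi := hh i isT; have [Bi1 Bi2] := Bx i.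
  rewrite !mxE !eqxx mulr1 clamp_id ?(ltW Bi1)// clamp_id; last 2 first.
  - by rewrite lerBrDr -lerBrDl ltW.
  - by rewrite (le_trans _ Bi2)// gerBl ltW.
  by rewrite -subr_ge0; apply: eq_ind_r (fun r => 0 <= r) _ _ _; [exact: lexx|ring].
Qed.

(** A step in direction [i] that crosses the source hyperplane goes from values at most [b] to
    values at least [b], so the jump has the right sign; steps in other directions do not cross it.
    The divergence bound is local: backward steps from the lower side stay there, and from the upper
    side they do so once [h] is less than the distance to the hyperplane. *)
Lemma transport_glue (kappa : R) i t b sE sL T1 T2 : box_family sL ->
  transport kappa (cut_below i t sE) (cut_below i b sL) T1 ->
  transport kappa (cut_above i t sE) (cut_above i b sL) T2 ->
  transport kappa sE sL (fun x => if x ord0 i <= t then T1 x else T2 x).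
Proof.
move=> fL [m1 L1 mono1 div1] [m2 L2 mono2 div2]; split.
- move=> j.
  rewrite (_ : (fun x : borel_rV R n => _) = (fun x : borel_rV R n =>
     if (x : Rn) ord0 i <= t then T1 x ord0 j else T2 x ord0 j)); last first.
    by apply/funext => x; case: ifP.
  apply: measurable_fun_ifT; [|exact: m1|exact: m2].
  by apply: measurable_fun_ler; [exact: measurable_coord|exact: measurable_cst].
- move=> x; case: ifP => _.
    exact: (cut_below_closed fL (L1 x)).1.
  exact: (cut_above_closed fL (L2 x)).1.
- move=> j x h h0.
  have xh : (x - h *: e_ i) ord0 i <= x ord0 i.
    by rewrite !mxE !eqxx mulr1 gerBl.
  have [<-|ji] := eqVneq i j.
    case: ifPn => a; case: ifPn => a'; rewrite ?mono1 ?mono2//.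
      by rewrite (le_trans (cut_below_closed fL (L1 _)).2)// (cut_above_closed fL (L2 _)).2.
    by rewrite (le_trans xh a') in a.
  have -> : (x - h *: e_ j) ord0 i = x ord0 i.
    by rewrite !mxE eqxx (negbTE ji) mulr0 subr0.
  by case: ifPn => _; rewrite ?mono1 ?mono2.
- move=> x Ex; case: ifPn => xt.
    have [h0 h00 H] := div1 x (cut_below_halfopen Ex xt).
    exists h0 => // h hh; rewrite (le_trans (H h hh))//; apply: ler_sum => j _.
    rewrite ifT//; apply: le_trans xt; rewrite !mxE eqxx gerBl mulr_ge0//.
    by case/andP: hh => /ltW.
  rewrite -ltNge in xt.
  have [h0 h00 H] := div2 x (cut_above_halfopen Ex xt).
  exists (Num.min h0 (x ord0 i - t)); first by rewrite lt_min h00 subr_gt0.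
  move=> h /andP[hh]; rewrite lt_min => /andP[hh0 hx].
  rewrite (le_trans (H h _)) ?hh//; apply: ler_sum => j _.
  rewrite ifF//; apply/negbTE; rewrite -ltNge !mxE eqxx /=.
  rewrite ltrBrDr -ltrBrDl (le_lt_trans _ hx)// ler_piMr ?(ltW hh)//.
  by case: (i == j); rewrite ?lexx ?ler01.
Qed.

(** The hyperplane through the upper face of one of two separated boxes leaves each of them on one
    side only, so each half is nonempty and has lost a box. *)
Lemma cut_two s : box_family s -> (1 < size s)%N -> exists i t,
  [/\ (0 < size (cut_below i t s))%N, (0 < size (cut_above i t s))%N,
      (size (cut_below i t s) < size s)%N & (size (cut_above i t s) < size s)%N].
Proof.
have H B1 B2 i s1 : box_family s1 -> B1 \in s1 -> B2 \in s1 ->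
    B1.2 ord0 i <= B2.1 ord0 i ->
    let t := B1.2 ord0 i in
    [/\ (0 < size (cut_below i t s1))%N, (0 < size (cut_above i t s1))%N,
      (size (cut_below i t s1) < size s1)%N & (size (cut_above i t s1) < size s1)%N].
  move=> /andP[/allP ps _] s1B s1B2 B12 t.
  have /forallP/(_ i) p1 := ps _ s1B; have /forallP/(_ i) p2 := ps _ s1B2.
  split; [| |exact: (size_cut_below_lt s1B2)|exact: (size_cut_above_lt s1B)].
    by rewrite size_map size_filter -has_count; apply/hasP; exists B1.
  rewrite size_map size_filter -has_count; apply/hasP; exists B2 => //.
  exact: le_lt_trans p2.
case: s => [|B1 [|B2 s]]// fs _; have /andP[_ /= /andP[/= /andP[]]] := fs.
move=> /existsP[i /orP[]] le12 _ _; exists i.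
  by exists (B1.2 ord0 i); apply: (H B1 B2); rewrite ?inE ?eqxx ?orbT.
by exists (B2.2 ord0 i); apply: (H B2 B1); rewrite ?inE ?eqxx ?orbT.
Qed.

Lemma size_gt0_vol s : 0 < boxes_vol s -> (0 < size s)%N.
Proof. by case: s => //; rewrite /boxes_vol big_nil ltxx. Qed.

(* Hadwiger and Ohmann's induction: both families are cut by parallel
   hyperplanes in the same proportion, one of which separates two boxes. *)
Lemma transport_exists (kappa : R) sE sL : 0 <= kappa ->
  box_family sE -> box_family sL -> (0 < size sE)%N -> (0 < size sL)%N ->
  kappa ^+ n * boxes_vol sE <= boxes_vol sL -> exists T, transport kappa sE sL T.
Proof.
move=> k0; have [N] := ubnP (size sE + size sL)%N.
elim: N sE sL => // N IH sE sL szN fE fL sE0 sL0 kv.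
(* Cutting both families in the proportion [th] preserves the inequality between [kappa ^+ n] times
   the source volume and the target volume, for the lower parts and for the upper ones. *)
have step i t b th : 0 < th < 1 ->
    boxes_vol (cut_below i t sE) = th * boxes_vol sE ->
    boxes_vol (cut_below i b sL) = th * boxes_vol sL ->
    (size (cut_below i t sE) + size (cut_below i b sL) < size sE + size sL)%N ->
    (size (cut_above i t sE) + size (cut_above i b sL) < size sE + size sL)%N ->
    exists T, transport kappa sE sL T.
  move=> /andP[th0 th1] vE vL sz1 sz2.
  have vE' : boxes_vol (cut_above i t sE) = (1 - th) * boxes_vol sE.
    by rewrite -(cut_vol i t fE) in vE *; lra.
  have vL' : boxes_vol (cut_above i b sL) = (1 - th) * boxes_vol sL.
    by rewrite -(cut_vol i b fL) in vL *; lra.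
  have [pE pL] := (boxes_vol_gt0 fE sE0, boxes_vol_gt0 fL sL0).
  have th1' : 0 < 1 - th by rewrite subr_gt0.
  have [T1 HT1] : exists T, transport kappa (cut_below i t sE) (cut_below i b sL) T.
    apply: IH; rewrite ?cut_below_family ?size_gt0_vol ?vE ?vL ?mulr_gt0//.
      by rewrite (leq_trans sz1)// -ltnS.
    by rewrite mulrCA ler_pM2l.
  have [T2 HT2] : exists T, transport kappa (cut_above i t sE) (cut_above i b sL) T.
    apply: IH; rewrite ?cut_above_family ?size_gt0_vol ?vE' ?vL' ?mulr_gt0//.
      by rewrite (leq_trans sz2)// -ltnS.
    by rewrite mulrCA ler_pM2l.
  by eexists; exact: (transport_glue fL HT1 HT2).
have ratio s i t : box_family s -> (0 < size (cut_below i t s))%N ->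
    (0 < size (cut_above i t s))%N ->
    exists2 th, 0 < th < 1 & boxes_vol (cut_below i t s) = th * boxes_vol s.
  move=> fs c1 c2; have v1 := boxes_vol_gt0 (cut_below_family i t fs) c1.
  have v2 := boxes_vol_gt0 (cut_above_family i t fs) c2.
  have vs := cut_vol i t fs.
  have v0 : 0 < boxes_vol s by rewrite -vs addr_gt0.
  exists (boxes_vol (cut_below i t s) / boxes_vol s).
    by rewrite divr_gt0//= ltr_pdivrMr// mul1r -vs ltrDl.
  by rewrite divfK// gt_eqF.
(* A family with two boxes or more is cut so that both halves lose a box. The other is cut at the
   matching volume and gains none, so the total size drops. *)
have [sE1|sE1] := ltnP 1 (size sE).
  have [i [t [c1 c2 c3 c4]]] := cut_two fE sE1.
  have [th th01 vE] := ratio _ _ _ fE c1 c2.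
  have [|b vL] := @exists_cut i sL th fL.
    by case/andP: th01 => /ltW -> /ltW ->.
  by apply: (step i t b th) => //; rewrite -addSn leq_add// ?size_cut_below ?size_cut_above.
have [sL1|sL1] := ltnP 1 (size sL).
  have [i [b [c1 c2 c3 c4]]] := cut_two fL sL1.
  have [th th01 vL] := ratio _ _ _ fL c1 c2.
  have [|t vE] := @exists_cut i sE th fE.
    by case/andP: th01 => /ltW -> /ltW ->.
  by apply: (step i t b th) => //; rewrite -addnS leq_add// ?size_cut_below ?size_cut_above.
case: sE sE0 sE1 fE kv {IH szN step ratio} => [|B []]// _ _ /andP[/= /andP[pB _] _].
case: sL sL0 sL1 fL => [|B' []]// _ _ /andP[/= /andP[pB' _] _].
by rewrite /boxes_vol !big_seq1; exact: transport1.
Qed.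

End Boxes.

(** * The Borel-Lebesgue measure on row vectors *)

Section BorelLebesgue.
Variable R : realType.
Local Notation mu n := (borel_lebesgue R n).

Lemma measurable_halfopen_box n (B : 'rV[R]_n * 'rV[R]_n) :
  measurable (halfopen_box B : set (borel_rV R n)).
Proof.
rewrite (_ : halfopen_box B = \bigcap_(i in [set: 'I_n])
    ((fun x : borel_rV R n => (x : 'rV[R]_n) ord0 i) @^-1`
      `]B.1 ord0 i, B.2 ord0 i]%classic)).
  apply: fin_bigcap_measurable => // i _.
  by rewrite -[X in measurable X]setTI; exact: (measurable_coord i).
apply/seteqP; split=> x /=; first by move=> Bx i _ /=; rewrite in_itv/=; apply/andP.
by move=> Bx i; have /= := Bx i I; rewrite in_itv/= => /andP.
Qed.

Lemma halfopen_box_measure n (B : 'rV[R]_n * 'rV[R]_n) :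
  mu n (halfopen_box B) =
  (\prod_i Num.max 0 (B.2 ord0 i - B.1 ord0 i))%:E.
Proof.
elim: n B => [|n IH] B.
  rewrite big_ord0 (_ : halfopen_box B = setT); first by rewrite /= diracT.
  by apply/seteqP; split => // x _ [].
pose tl (x : 'rV[R]_n.+1) : 'rV[R]_n := \row_i x ord0 (lift ord0 i).
have -> : mu n.+1 (halfopen_box B) =
    (lebesgue_measure \x mu n)%E (@rV_cons R n @^-1` halfopen_box B) by [].
rewrite (_ : @rV_cons R n @^-1` halfopen_box B =
    `]B.1 ord0 ord0, B.2 ord0 ord0]%classic `*` halfopen_box (tl B.1, tl B.2)).
  rewrite product_measure1E ?IH; [|exact: measurable_itv|exact: measurable_halfopen_box].
  rewrite big_ord_recl EFinM; congr (_ * _)%E.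
    rewrite [LHS]lebesgue_measure_itv/= lte_fin.
    case: ltP => h; first by rewrite max_r ?EFinB// subr_ge0 ltW.
    by rewrite max_l// subr_le0.
  by congr EFin; apply: eq_bigr => i _; rewrite !mxE.
apply/seteqP; split=> [[t x]|[t x]] /= Bx.
  split=> /=.
    by have := Bx ord0; rewrite rV_cons0 in_itv/= => /andP.
  by move=> i; have := Bx (lift ord0 i); rewrite rV_consS !mxE.
move=> i; case: (unliftP ord0 i) => [j|] ->.
  by rewrite rV_consS; have := Bx.2 j; rewrite !mxE.
by rewrite rV_cons0; have := Bx.1; rewrite in_itv/= => /andP.
Qed.

Lemma box_vol_measure n (B : 'rV[R]_n * 'rV[R]_n) : proper_box B ->
  mu n (halfopen_box B) = (box_vol B)%:E.
Proof.
move=> /forallP pB; rewrite halfopen_box_measure; congr EFin.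
by apply: eq_bigr => i _; rewrite max_r// subr_ge0 ltW.
Qed.

Definition halfopen_box_system n : set (set (borel_rV R n)) :=
  [set halfopen_box B | B in [set: 'rV[R]_n * 'rV[R]_n]].

Lemma coord_le_norm n (x : 'rV[R]_n) i : `|x ord0 i| <= `|x|.
Proof.
rewrite [leRHS]/Num.norm/= mx_normrE; apply/bigmax_geP; right => /=.
by exists (ord0, i).
Qed.

Lemma norm_le_coord n (x : 'rV[R]_n) c : 0 <= c ->
  (forall i, `|x ord0 i| <= c) -> `|x| <= c.
Proof.
move=> c0 xc; rewrite [leLHS]/Num.norm/= mx_normrE; apply/bigmax_leP; split => //.
by move=> [i j] _ /=; rewrite ord1.
Qed.

Definition cube n (r : R) : 'rV[R]_n * 'rV[R]_n := (const_mx (- r), const_mx r).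

Lemma cubes_cover n : \bigcup_k halfopen_box (cube n k%:R) = setT.
Proof.
rewrite -subTset => x _; exists (Num.truncn `|x|).+1 => // i /=; rewrite !mxE.
have xi : `|x ord0 i| < (Num.truncn `|x|).+1%:R.
  exact: le_lt_trans (coord_le_norm _ _) (truncnS_gt _).
by move: xi; rewrite ltr_norml => /andP[? /ltW].
Qed.

(** A slab in one coordinate is a countable union of boxes whose other sides grow. *)
Lemma borel_rV_boxes n : @measurable _ (borel_rV R n) = <<s @halfopen_box_system n >>.
Proof.
apply/seteqP; split; last first.
  apply: smallest_sub; first exact: sigma_algebra_measurable.
  by move=> _ [B _ <-]; exact: measurable_halfopen_box.
apply: smallest_sub; first exact: smallest_sigma_algebra.
move=> _ [i [A [mA ->]]].
have : measurable_fun [set: g_sigma_algebraType (@halfopen_box_system n)]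
    (fun x : 'rV[R]_n => x ord0 i : measurableTypeR R).
  apply: (@measurability _ _ _ (measurableTypeR R) _ _ (@ocitv R)) => //.
  move=> _ [_ [[a b] _ <-] <-] /=; rewrite setTI.
  rewrite (_ : _ @^-1` _ = \bigcup_k halfopen_box
    (set_coord (const_mx (- k%:R)) i a, set_coord (const_mx k%:R) i b)).
    apply: bigcupT_measurable => k; apply: sub_sigma_algebra.
    by eexists.
  apply/seteqP; split => x /=; rewrite in_itv/=.
    move=> /andP[ax xb]; have [k _ kx] : (\bigcup_k halfopen_box (cube n k%:R)) x.
      by rewrite cubes_cover.
    exists k => // j; have /= := kx j; rewrite !mxE.
    by case: eqP => [->|].
  by move=> [k _ /(_ i)] /=; rewrite !mxE eqxx => -[-> ->].
by move=> /(_ measurableT A mA); rewrite setTI.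
Qed.

Lemma halfopen_boxI n : setI_closed (@halfopen_box_system n).
Proof.
move=> _ _ [A _ <-] [B _ <-].
exists (\row_i Num.max (A.1 ord0 i) (B.1 ord0 i),
        \row_i Num.min (A.2 ord0 i) (B.2 ord0 i)) => //.
apply/seteqP; split => x /=.
  by move=> H; split => i; have /= := H i; rewrite !mxE gt_max le_min => -[/andP[? ?] /andP[? ?]].
by move=> [HA HB] i /=; rewrite !mxE gt_max le_min (HA i).1 (HA i).2 (HB i).1 (HB i).2.
Qed.

(** Half-open boxes generate the Borel sets, are stable under intersection, and exhaust the space by
    cubes of finite measure. *)
Lemma borel_lebesgue_unique n (m : {measure set (borel_rV R n) -> \bar R}) :
  (forall B, mu n (halfopen_box B) = m (halfopen_box B)) ->
  forall A, measurable A -> mu n A = m A.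
Proof.
move=> mB A mA; apply: (measure_unique (@halfopen_box_system n)
    (fun k => halfopen_box (cube n k%:R))) => //.
- exact: borel_rV_boxes.
- exact: halfopen_boxI.
- by move=> k; eexists.
- exact: cubes_cover.
- by move=> _ [B _ <-]; exact: mB.
- by move=> k; change (mu n (halfopen_box (cube n k%:R)) < +oo)%E;
    rewrite halfopen_box_measure ltry.
Qed.

Lemma measurable_affine n (p : 'rV[R]_n) (l : R) :
  measurable_fun [set: borel_rV R n] (fun x : borel_rV R n => (p + l *: (x : 'rV[R]_n) : borel_rV R n)).
Proof.
apply: measurable_to_rV => i; under eq_fun do rewrite !mxE.
apply: measurable_funD; first exact: measurable_cst.
by apply: measurable_funM; [exact: measurable_cst|exact: measurable_coord].
Qed.

(** The right-hand side is a measure of [A], namely a rescaled pushforward, so by uniqueness boxes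
    suffice; their preimages are boxes. *)
Lemma measure_affine n (p : 'rV[R]_n) (l : R) (A : set (borel_rV R n)) : 0 < l -> measurable A ->
  mu n A = ((l ^+ n)%:E * mu n [set x : 'rV[R]_n | A (p + l *: x)%R])%E.
Proof.
move=> l0 mA.
pose f (x : borel_rV R n) : borel_rV R n := p + l *: (x : 'rV[R]_n).
have ln0 : 0 <= l ^+ n by rewrite exprn_ge0// ltW.
pose m := mscale (NngNum ln0) (measure_function_pushforward__canonical__measure_function_Measure (mu n) (measurable_affine p l)).
apply: (@borel_lebesgue_unique n m) => // B.
have E : f @^-1` halfopen_box B = halfopen_box (l^-1 *: (B.1 - p), l^-1 *: (B.2 - p)).
  apply/seteqP; split=> x /= Bx i; have /= := Bx i; rewrite !mxE.
    by rewrite ltr_pdivrMl// ler_pdivlMl// ltrBlDl lerBrDl.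
  by rewrite ltr_pdivrMl// ler_pdivlMl// ltrBlDl lerBrDl.
change (mu n (halfopen_box B) = ((l ^+ n)%:E * mu n (f @^-1` halfopen_box B))%E).
rewrite E !halfopen_box_measure -EFinM; congr EFin.
rewrite -[X in _ = l ^+ X * _](card_ord n) -prodr_const -big_split/=.
apply: eq_bigr => i _; rewrite maxr_pMr ?(ltW l0)// mulr0 !mxE; congr Num.max.
by field; rewrite gt_eqF.
Qed.

Lemma measure_shift n (p : 'rV[R]_n) (A : set (borel_rV R n)) : measurable A ->
  mu n [set x : 'rV[R]_n | A (p + x)] = mu n A.
Proof.
move=> mA; rewrite (@measure_affine n p 1 A)// expr1n mul1e.
by congr (mu n _); apply/funext => x /=; rewrite scale1r.
Qed.

Lemma measurable_shift n (p : 'rV[R]_n) (A : set (borel_rV R n)) : measurable A ->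
  measurable ([set x : 'rV[R]_n | A (p + x)] : set (borel_rV R n)).
Proof.
move=> mA; have := measurable_affine p 1 measurableT mA; rewrite setTI.
by congr (measurable _); apply/funext => x /=; rewrite scale1r.
Qed.

Lemma measurable_scale n (p : 'rV[R]_n) (l : R) (A : set (borel_rV R n)) : measurable A ->
  measurable ([set x : 'rV[R]_n | A (p + l *: x)] : set (borel_rV R n)).
Proof. by move=> mA; have := measurable_affine p l measurableT mA; rewrite setTI. Qed.

Lemma measurable_fun_shift n (p : 'rV[R]_n) :
  measurable_fun [set: borel_rV R n] (fun x : borel_rV R n => (p + (x : 'rV[R]_n) : borel_rV R n)).
Proof. by move=> _ A mA; rewrite setTI; exact: measurable_shift. Qed.

Lemma measurable_fun_comp_shift n (p : 'rV[R]_n) (f : borel_rV R n -> R) :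
  measurable_fun setT f -> measurable_fun setT (fun x : borel_rV R n => f (p + (x : 'rV[R]_n) : borel_rV R n)).
Proof. by move=> mf; apply: (measurableT_comp mf (measurable_fun_shift p)). Qed.

Lemma integral_shift n (p : 'rV[R]_n) (f : borel_rV R n -> R) : measurable_fun setT f ->
  (mu n).-integrable setT (fun x : borel_rV R n => (f (p + (x : 'rV[R]_n) : borel_rV R n))%:E) ->
  \int[mu n]_x f (p + (x : 'rV[R]_n) : borel_rV R n) = \int[mu n]_x f x.
Proof.
move=> mf fi; rewrite /Rintegral; congr fine.
pose m := measure_function_pushforward__canonical__measure_function_Measure (mu n) (measurable_fun_shift p).
transitivity (\int[m]_x (f x)%:E)%E; last first.
  by apply: eq_measure_integral => A mA _; exact: measure_shift.
rewrite (@integral_pushforward _ _ _ _ _ _ (measurable_fun_shift p) (mu n) setT (EFin \o f)) //.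
exact/measurable_EFinP.
Qed.

Lemma bounded_borel_finite n (A : set (borel_rV R n)) (r : R) :
  (forall x : 'rV[R]_n, A x -> `|x| <= r) -> measurable A -> (mu n A < +oo)%E.
Proof.
move=> Ar mA; apply: (@le_lt_trans _ _ (mu n (halfopen_box (cube n (r + 1))))).
  apply: le_measure; rewrite ?inE//; first exact: measurable_halfopen_box.
  move=> x /Ar xr i; rewrite !mxE; have := le_trans (coord_le_norm _ _) xr.
  by move=> /(_ i); rewrite ler_norml => /andP[x1 x2]; split; lra.
by rewrite halfopen_box_measure ltry.
Qed.

Lemma integrable_indic_finite n (A : set (borel_rV R n)) : measurable A ->
  (mu n A < +oo)%E -> (mu n).-integrable setT (fun x => (\1_A x)%:E).
Proof.
move=> mA Aoo; apply/integrableP; split; first exact/measurable_EFinP/measurable_indic.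
rewrite (eq_integral (fun x => (\1_A x)%:E)) ?integral_indic ?setIT// => x _.
by rewrite gee0_abs// lee_fin indicE.
Qed.

Lemma integrable_bounded_support n (f : borel_rV R n -> R) (M r : R) :
  measurable_fun setT f -> (forall x, `|f x| <= M) ->
  (forall x : 'rV[R]_n, r < `|x| -> f x = 0) -> (mu n).-integrable setT (EFin \o f).
Proof.
move=> mf fM fr; pose Q := halfopen_box (cube n (`|r| + 1)).
have mQ : measurable (Q : set (borel_rV R n)) by exact: measurable_halfopen_box.
apply: (@le_integrable _ _ _ _ _ _ _ (fun x : borel_rV R n => (M * \1_Q x)%:E)) => //.
- exact/measurable_EFinP.
- move=> x _ /=; rewrite lee_fin.
  have [Qx|Qx] := pselect (Q x).
    by rewrite indicE mem_set// mulr1 (le_trans (fM x))// ler_norm.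
  rewrite indicE memNset// mulr0 normr0 fr ?normr0// ltNge; apply/negP => xr; apply: Qx.
  move=> i; rewrite !mxE; have := le_trans (coord_le_norm _ _) xr.
  move=> /(_ i); rewrite ler_norml; have := ler_norm r.
  by move=> rr /andP[x1 x2]; split; lra.
- have Qoo : (mu n Q < +oo)%E by rewrite halfopen_box_measure ltry.
  rewrite (_ : (fun x => _) = (fun x => M%:E * (\1_Q x)%:E)%E) //.
  apply: integrableZl => //; exact: integrable_indic_finite.
Qed.

Lemma measurable_lebesgue n (A : set 'rV[R]_n) :
  measurable (A : set (borel_rV R n)) -> measurable (A : set (lebesgue_rV R n)).
Proof. by move=> mA; apply: sub_caratheodory; apply: sub_sigma_algebra. Qed.

Lemma volume_borel n (A : set 'rV[R]_n) :
  measurable (A : set (borel_rV R n)) -> @volume R n A = mu n A.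
Proof. exact: measurable_mu_extE. Qed.

Lemma measurable_fun_lebesgue_borel n :
  measurable_fun [set: lebesgue_rV R n] (idfun : lebesgue_rV R n -> borel_rV R n).
Proof. by move=> _ A mA; rewrite setTI; exact: measurable_lebesgue. Qed.

(** [volume] is defined on the larger completed sigma-algebra. The identity, measurable from it to
    the Borel one, pushes [volume] forward to the Borel measure and carries integrals of Borel
    functions along. *)
Lemma integral_volume n (D : set (borel_rV R n)) (f : borel_rV R n -> R) :
  measurable D -> measurable_fun setT f -> (mu n).-integrable D (EFin \o f) ->
  (\int[@volume R n]_(x in D) (f x)%:E = \int[mu n]_(x in D) (f x)%:E)%E.
Proof.
move=> mD mf fi.
pose m := measure_function_pushforward__canonical__measure_function_Measure (@volume R n) (@measurable_fun_lebesgue_borel n).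
have mE A : measurable A -> A `<=` D -> m A = mu n A by move=> mA _; exact: volume_borel.
have mef : measurable_fun setT (EFin \o f) by exact/measurable_EFinP.
rewrite -(eq_measure_integral (mu n) mE).
rewrite (@integral_pushforward _ _ _ _ _ _ (@measurable_fun_lebesgue_borel n) (@volume R n) D (EFin \o f))//.
apply/integrableP; split.
  apply: measurable_funTS; apply: (measurableT_comp mef).
  exact: measurable_fun_lebesgue_borel.
have /integrableP[_] := fi; rewrite -(eq_measure_integral (mu n) mE).
rewrite (@ge0_integral_pushforward _ _ _ _ _ _ (@measurable_fun_lebesgue_borel n) (@volume R n) D (fun x => `|(f x)%:E|)%E)//.
by apply: measurable_funTS; exact: measurableT_comp.
Qed.

End BorelLebesgue.

(** * Approximation by dyadic cubes *)

Section Dyadic.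
Variables (R : realType) (n : nat).
Local Notation Rn := 'rV[R]_n.
Local Notation mu := (borel_lebesgue R n).
Local Notation Zn := 'rV[int]_n.

(** The ceiling matches cubes that are open below and closed above. *)
Definition dyadic_index (k : nat) (x : Rn) : Zn := \row_i Num.ceil (2 ^+ k * x ord0 i).

Definition dyadic_cube (k : nat) (m : Zn) : Rn * Rn :=
  (\row_i ((m ord0 i - 1)%:~R / 2 ^+ k), \row_i ((m ord0 i)%:~R / 2 ^+ k)).

Definition dyadic_set (k : nat) (P : set Zn) : set Rn := [set x | P (dyadic_index k x)].

Lemma dyadic_cubeE k m x : halfopen_box (dyadic_cube k m) x <-> dyadic_index k x = m.
Proof.
split=> [H|<- i].
  apply/rowP => i; rewrite mxE; apply/eqP; rewrite ceil_eq.
  have := H i; rewrite !mxE/= ltr_pdivrMr// ler_pdivlMr// mulrC.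
  by move=> [-> ->].
rewrite !mxE ltr_pdivrMr// ler_pdivlMr// [x ord0 i * _]mulrC.
exact/andP/ceil_itv.
Qed.

Definition dyadic_parent (m : Zn) : Zn := \row_i Num.ceil ((m ord0 i)%:~R / 2 : R).

Lemma dyadic_indexS k x : dyadic_index k x = dyadic_parent (dyadic_index k.+1 x).
Proof.
apply/rowP => i; rewrite !mxE; apply/le_anti/andP; split.
  rewrite ceil_le_int; apply: le_trans (ceil_ge _).
  rewrite ler_pdivlMr//; apply: le_trans (ceil_ge _).
  by rewrite exprS -mulrA [leLHS]mulrC.
rewrite ceil_le_int ler_pdivrMr// -[2 in leRHS]/(2%:~R) -intrM ler_int ceil_le_int.
by rewrite intrM exprS -mulrA mulrC ler_pM2r// ceil_ge.
Qed.

Lemma dyadic_refine k k' x y : (k <= k')%N ->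
  dyadic_index k' x = dyadic_index k' y -> dyadic_index k x = dyadic_index k y.
Proof.
move=> /subnK <-; elim: (k' - k)%N => [//|j IH]; rewrite addSn => xy.
by apply: IH; rewrite dyadic_indexS xy -dyadic_indexS.
Qed.

Lemma dyadic_set_refine k k' P : (k <= k')%N ->
  exists P', dyadic_set k P = dyadic_set k' P'.
Proof.
move=> kk'; exists [set dyadic_index k' x | x in dyadic_set k P].
apply/seteqP; split=> x; first by move=> Px; exists x.
by move=> [y Py /(dyadic_refine kk') yx]; rewrite /dyadic_set/= -yx.
Qed.

Lemma measurable_dyadic_set k P : measurable (dyadic_set k P : set (borel_rV R n)).
Proof.
rewrite (_ : dyadic_set k P = \bigcup_m (if m \in P then halfopen_box (dyadic_cube k m) else set0)).
  apply: countable_bigcupT_measurable; first exact: countableP.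
  by move=> m; case: ifP => // _; exact: measurable_halfopen_box.
apply/seteqP; split=> x.
  move=> Px; exists (dyadic_index k x) => //; rewrite mem_set//.
  exact/dyadic_cubeE.
move=> [m _]; case: ifPn => [|//]; rewrite inE => Pm /dyadic_cubeE mx.
by rewrite /dyadic_set/= mx.
Qed.

(** The whole closed cube has to lie in [O], since the transport takes its values in closed
    boxes. *)
Definition dyadic_inner k (O : set Rn) : set Rn :=
  dyadic_set k [set m | closed_box (dyadic_cube k m) `<=` O].

Lemma dyadic_inner_sub k O : dyadic_inner k O `<=` O.
Proof.
by move=> x /= ; apply => i; have [/ltW ? ?] := (dyadic_cubeE k _ x).2 erefl i.
Qed.

Lemma dyadic_cube_parent k x :
  closed_box (dyadic_cube k.+1 (dyadic_index k.+1 x)) `<=`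
  closed_box (dyadic_cube k (dyadic_index k x)).
Proof.
move=> y yb i; have := yb i; rewrite (dyadic_indexS k x) !mxE.
set m : int := Num.ceil (2 ^+ k.+1 * x ord0 i).
have /andP[c1 c2] := ceil_itv (m%:~R / 2 : R).
set c := Num.ceil _ in c1 c2 *.
have c3 : (c - 1) * 2 <= m - 1.
  rewrite -ltzD1 subrK -(ltr_int R) intrM.
  by rewrite -ltr_pdivlMr.
have c4 : m <= c * 2.
  by rewrite -(ler_int R) intrM -ler_pdivrMr.
rewrite !ler_pdivrMr// !ler_pdivlMr// => -[y1 y2].
have c3' : (c - 1)%:~R * 2 <= (m - 1)%:~R :> R by rewrite -[2]/(2%:~R) -intrM ler_int.
have c4' : m%:~R <= c%:~R * 2 :> R by rewrite -[2]/(2%:~R) -intrM ler_int.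
split; rewrite -(@ler_pM2r _ (2 : R))//.
  by rewrite (le_trans c3')// (le_trans y1)// exprS mulrCA mulrC.
by rewrite (le_trans _ c4')// (le_trans _ y2)// exprS mulrCA mulrC.
Qed.

Lemma dyadic_inner_nondecreasing O : {homo dyadic_inner ^~ O : k l / (k <= l)%N >-> k `<=` l}.
Proof.
apply: homo_leq => [A x //|B A C AB BC|k x]; first exact: subset_trans BC.
by move=> Px; apply: subset_trans Px; exact: dyadic_cube_parent.
Qed.

Lemma dyadic_fine (e : R) : 0 < e -> exists k, (2 ^+ k)^-1 < e.
Proof.
move=> e0; exists (Num.truncn e^-1).+1.
rewrite invf_plt ?posrE ?exprn_gt0//; apply: (lt_trans (truncnS_gt _)).
by rewrite -natrX ltr_nat ltn_expl.
Qed.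

Lemma dyadic_inner_cover O : open O -> \bigcup_k dyadic_inner k O = O.
Proof.
move=> oO; apply/seteqP; split=> x; first by move=> [k _]; exact: dyadic_inner_sub.
move=> Ox; have /nbhs_ballP[e /= e0 eO] := open_nbhs_nbhs (conj oO Ox).
have [k ke] := dyadic_fine e0.
exists k => // y yb; apply: eO; rewrite -ball_normE /=.
apply: le_lt_trans ke; apply: norm_le_coord; first by rewrite invr_ge0 ltW.
move=> i; have [x1 x2] := (dyadic_cubeE k _ x).2 erefl i; have [y1 y2] := yb i.
move: x1 x2 y1 y2; rewrite !mxE intrD mulrDl mulN1r ler_norml.
by move=> x1 x2 y1 y2; apply/andP; split; lra.
Qed.

Lemma coord_open i (a : R) : open [set x : Rn | a < x ord0 i].
Proof.
rewrite (_ : [set x : Rn | _] = (fun x : Rn => x ord0 i) @^-1` [set t | a < t])//.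
by apply: open_comp => [x _|]; [exact: coord_continuous|exact: open_gt].
Qed.

Definition dyadic_system : set (set (borel_rV R n)) :=
  [set A | exists k P, A = dyadic_set k P].

Lemma open_dyadic (O : set Rn) : open O -> <<s dyadic_system >> O.
Proof.
move=> oO; rewrite -(dyadic_inner_cover oO).
apply: (@bigcupT_measurable _ (g_sigma_algebraType dyadic_system)) => k.
by apply: sub_sigma_algebra; eexists; eexists; reflexivity.
Qed.

Lemma borel_rV_dyadic : @measurable _ (borel_rV R n) = <<s dyadic_system >>.
Proof.
apply/seteqP; split; last first.
  apply: smallest_sub; first exact: sigma_algebra_measurable.
  by move=> _ [k [P ->]]; exact: measurable_dyadic_set.
apply: smallest_sub; first exact: smallest_sigma_algebra.
move=> _ [i [A [mA ->]]].
have : measurable_fun [set: g_sigma_algebraType dyadic_system]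
    (fun x : 'rV[R]_n => x ord0 i : measurableTypeR R).
  apply: (@measurability _ _ _ (measurableTypeR R) _ _ _ (RGenOInfty.measurableE R)) => //.
  move=> _ [_ [a ->] <-] /=; rewrite setTI preimage_itvoy.
  exact: (open_dyadic (@coord_open i a)).
by move=> /(_ measurableT A mA); rewrite setTI.
Qed.

Lemma open_measurable_rV (O : set Rn) : open O -> measurable (O : set (borel_rV R n)).
Proof. by move=> oO; rewrite borel_rV_dyadic; exact: open_dyadic. Qed.

Lemma closed_measurable_rV (F : set Rn) : closed F -> measurable (F : set (borel_rV R n)).
Proof.
move=> cF; rewrite -(setCK F); apply: measurableC.
by apply: open_measurable_rV; exact: closed_openC.
Qed.

Lemma continuous_measurable_rV (f : Rn -> R) : continuous f ->
  measurable_fun [set: borel_rV R n] (f : borel_rV R n -> R).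
Proof.
move=> cf; apply: (@measurability _ _ _ (measurableTypeR R) _ _ _ (RGenOInfty.measurableE R)) => //.
move=> _ [_ [a ->] <-] /=; rewrite setTI preimage_itvoy.
apply: open_measurable_rV.
by apply: (@open_comp _ _ f [set t | a < t]) => [x _|]; [exact: cf|exact: open_gt].
Qed.

Lemma boxes_measure s : box_family s -> measurable (halfopen_boxes s : set (borel_rV R n)) /\
  mu (halfopen_boxes s) = (boxes_vol s)%:E.
Proof.
elim: s => [|B s IH].
  move=> _; rewrite (_ : halfopen_boxes [::] = set0).
    by rewrite measure0 /boxes_vol big_nil.
  by apply/seteqP; split => // x [].
move=> /andP[/= /andP[pB ps] /andP[/allP sB ss]].
have [|ms vs] := IH; first by rewrite /box_family ps.
have mB := measurable_halfopen_box B.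
have E : halfopen_boxes (B :: s) = halfopen_box B `|` halfopen_boxes s.
  apply/seteqP; split=> x.
    by move=> [C]; rewrite inE => /orP[/eqP ->|Cs] Cx; [left|right; exists C].
  move=> [Bx|[C Cs Cx]]; first by exists B => //; rewrite mem_head.
  by exists C => //; rewrite inE Cs orbT.
rewrite E; split; first exact: measurableU.
suff muU : mu (halfopen_box B `|` halfopen_boxes s) =
    (mu (halfopen_box B) + mu (halfopen_boxes s))%E.
  by rewrite muU (box_vol_measure pB) vs /boxes_vol big_cons.
apply: measureU => //; apply/seteqP; split=> // x [Bx [C Cs Cx]].
have /existsP[i] := sB C Cs.
move=> /orP[h|h].
  by have := lt_le_trans (Cx i).1 (Bx i).2; rewrite ltNge h.
by have := lt_le_trans (Bx i).1 (Cx i).2; rewrite ltNge h.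
Qed.

Lemma dyadic_cube_family (s : seq Zn) k : uniq s -> box_family (map (dyadic_cube k) s).
Proof.
move=> us; apply/andP; split.
  apply/allP => _ /mapP[m _ ->]; apply/forallP => i; rewrite !mxE.
  by rewrite ltr_pM2r ?invr_gt0// ltr_int gtrDl.
rewrite pairwise_map; move: us; rewrite uniq_pairwise; apply: sub_pairwise => m m' /= mm'.
have [i mi] : exists i, m ord0 i != m' ord0 i.
  apply/existsP; apply: contraNT mm' => /existsPn h; apply/eqP/rowP => i.
  by apply/eqP; have := h i; rewrite negbK.
apply/existsP; exists i; rewrite !mxE !ler_pM2r ?invr_gt0// !ler_int.
by rewrite !lerBrDr !lezD1 -neq_lt.
Qed.

Lemma dyadic_boxes k (P : set Zn) (A : set Rn) (r : R) :
  dyadic_set k P = A -> (forall x, A x -> `|x| <= r) ->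
  exists s, [/\ box_family s, halfopen_boxes s = A &
    forall B, B \in s -> exists2 x, A x & B = dyadic_cube k (dyadic_index k x)].
Proof.
move=> <- Ar; pose S := [set dyadic_index k x | x in dyadic_set k P].
have fS : finite_set S.
  (* Boundedness of [A] confines all coordinates of the indices to [[-N, N]], so the indices are the
     image of a finite function space. *)
  pose N := (Num.truncn (2 ^+ k * r)).+1.
  pose f (g : {ffun 'I_n -> 'I_(N + N).+1}) : Zn := \row_i ((g i)%:Z - N%:Z).
  apply: (@sub_finite_set _ _ (f @` setT)); last exact/finite_image/finite_finset.
  move=> _ [x Px <-].
  have xN i : - N%:Z <= Num.ceil (2 ^+ k * x ord0 i) <= N%:Z.
    have xi : `|2 ^+ k * x ord0 i| < N%:R.
      apply: le_lt_trans (truncnS_gt _); rewrite normrM ger0_norm ?exprn_ge0//.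
      by rewrite ler_pM2l ?exprn_gt0// (le_trans (coord_le_norm _ _))// Ar.
    rewrite ceil_le_int; move: xi; rewrite ltr_norml => /andP[x1 x2].
    rewrite (ltW x2) andbT -(ler_int R) intrN.
    by rewrite (le_trans (ltW x1))// ceil_ge.
  exists [ffun i => inord (absz (Num.ceil (2 ^+ k * x ord0 i) + N%:Z))] => //.
  apply/rowP => i; rewrite !mxE ffunE inordK; have := xN i; lia.
have [s us sS] : exists2 s : seq Zn, uniq s & S = [set` s].
  have /finite_seqP[s ->] := fS; exists (undup s); first exact: undup_uniq.
  by apply/seteqP; split => m /=; rewrite mem_undup.
exists (map (dyadic_cube k) s); split.
- exact: dyadic_cube_family.
- apply/seteqP; split=> x.
    move=> [_ /mapP[m ms ->]] /dyadic_cubeE xm.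
    have : S m by rewrite sS.
    by move=> [y Py ym]; rewrite /dyadic_set/= xm -ym.
  move=> Px; exists (dyadic_cube k (dyadic_index k x)); last exact/dyadic_cubeE.
  apply: map_f; have : S (dyadic_index k x) by exists x.
  by rewrite sS.
- move=> B /mapP[m ms ->]; have : S m by rewrite sS.
  by move=> [y Py <-]; exists y.
Qed.

End Dyadic.

Section MeasureLimits.
Context d (T : measurableType d) (R : realType) (m : {measure set T -> \bar R}).

Lemma measure_bigcup_approx (F : (set T)^nat) (v e : R) :
  (forall i, measurable (F i)) -> {homo F : k l / (k <= l)%N >-> k `<=` l} ->
  (v%:E <= m (\bigcup_i F i))%E -> 0 < e -> exists N, ((v - e)%:E < m (F N))%E.
Proof.
move=> mF ndF vF e0; apply: contrapT => /forallNP H.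
have : (m (\bigcup_i F i) <= (v - e)%:E)%E.
  apply: (@cvge_to_le _ _ _ _ (m \o F) _ _ (nondecreasing_cvg_mu mF _ _)).
  - exact: bigcupT_measurable.
  - by move=> k l kl; apply/subsetPset; exact: ndF.
  - by apply: nearW => N; rewrite leNgt; apply/negP; exact: H.
by move=> /(le_trans vF); rewrite lee_fin lerBrDr gerDl leNgt e0.
Qed.

Lemma measure_bigcap_approx (F : (set T)^nat) (v e : R) :
  (m (F 0%N) < +oo)%E ->
  (forall i, measurable (F i)) -> {homo F : k l / (k <= l)%N >-> l `<=` k} ->
  (m (\bigcap_i F i) <= v%:E)%E -> 0 < e -> exists N, (m (F N) < (v + e)%:E)%E.
Proof.
move=> F0 mF niF vF e0; apply: contrapT => /forallNP H.
have : ((v + e)%:E <= m (\bigcap_i F i))%E.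
  apply: (@cvge_to_ge _ _ _ _ (m \o F) _ _ (nonincreasing_cvg_mu F0 mF _ _)).
  - exact: bigcapT_measurable.
  - by move=> k l kl; apply/subsetPset; exact: niF.
  - by apply: nearW => N; rewrite leNgt; apply/negP; exact: H.
by move=> /le_trans/(_ vF); rewrite lee_fin gerDl leNgt e0.
Qed.

End MeasureLimits.

(** * Approximation of measurable and open sets by finite families of boxes *)

Section Approximation.
Variables (R : realType) (n : nat).
Local Notation Rn := 'rV[R]_n.
Local Notation mu := (borel_lebesgue R n).
Local Notation vol := (@volume R n).

Let sdiff (A B : set Rn) : set (borel_rV R n) := (A `\` B) `|` (B `\` A).

Lemma cube_dyadic (N : nat) :
  halfopen_box (cube n (N%:R : R)) = dyadic_set 0 [set m | forall i, - N%:Z < m ord0 i <= N%:Z].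
Proof.
apply/seteqP; split=> x /= Nx i; have := Nx i; rewrite !mxE expr0 mul1r.
  move=> [x1 x2]; rewrite ceil_le_int x2 andbT -(ltr_int R) intrN.
  exact: lt_le_trans (ceil_ge _).
rewrite ceil_le_int => /andP[x1 ->]; split => //.
rewrite ltNge; apply/negP; rewrite -[N%:R]/(N%:Z%:~R) -intrN -ceil_le_int.
by rewrite leNgt x1.
Qed.

(** The sets that can be so approximated for every error form a sigma-algebra containing the dyadic
    sets, which generate the Borel sets. *)
Lemma dyadic_approx (A : set (borel_rV R n)) (N : nat) (e : R) : measurable A -> 0 < e ->
  exists k P, (mu (sdiff A (dyadic_set k P) `&` halfopen_box (cube n (N%:R : R))) <= e%:E)%E.
Proof.
set Q := halfopen_box _.
have mQ : measurable (Q : set (borel_rV R n)) := measurable_halfopen_box _.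
have Qoo : (mu Q < +oo)%E by rewrite halfopen_box_measure ltry.
have mD k P := @measurable_dyadic_set R n k P.
have msd (A1 B1 : set (borel_rV R n)) : measurable A1 -> measurable B1 -> measurable (sdiff A1 B1).
  by move=> ? ?; apply: measurableU; exact: measurableD.
pose D := [set A1 : set (borel_rV R n) | measurable A1 /\ forall e, 0 < e ->
  exists k P, (mu (sdiff A1 (dyadic_set k P) `&` Q) <= e%:E)%E].
move=> mA e0; suff : D A by move=> [_]; exact.
move: A mA {e e0}; rewrite borel_rV_dyadic; apply: smallest_sub; last first.
  move=> _ [k [P ->]]; split => // e e0; exists k, P.
  by rewrite /sdiff setDv setU0 set0I measure0 lee_fin ltW.
have D0 : D set0.
  split => // e e0; exists 0%N, set0.
  by rewrite /sdiff setDv setU0 set0I measure0 lee_fin ltW.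
have DU A1 A2 : D A1 -> D A2 -> D (A1 `|` A2).
  move=> [mA1 H1] [mA2 H2]; split; first exact: measurableU.
  move=> e e0; have e20 : 0 < e / 2 by rewrite divr_gt0.
  have [k1 [P1 h1]] := H1 _ e20; have [k2 [P2 h2]] := H2 _ e20.
  have [P1' E1] := @dyadic_set_refine R n _ _ P1 (leq_maxl k1 k2).
  have [P2' E2] := @dyadic_set_refine R n _ _ P2 (leq_maxr k1 k2).
  exists (maxn k1 k2), (P1' `|` P2').
  rewrite (_ : dyadic_set _ _ = dyadic_set k1 P1 `|` dyadic_set k2 P2); last first.
    by rewrite E1 E2.
  apply: (@le_trans _ _ (mu ((sdiff A1 (dyadic_set k1 P1) `&` Q) `|`
                             (sdiff A2 (dyadic_set k2 P2) `&` Q)))).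
    apply: le_measure; rewrite ?inE.
    - by apply: measurableI => //; apply: msd; exact: measurableU.
    - by apply: measurableU; apply: measurableI => //; exact: msd.
    - by move=> x [[[[a|a] b]|[[a|a] b]] q]; rewrite /sdiff/=;
        have := pselect (A1 x); have := pselect (A2 x);
        have := pselect (dyadic_set k1 P1 x); have := pselect (dyadic_set k2 P2 x); move: b; rewrite /setU/=; tauto.
  apply: le_trans (measureU2 _ _ _) _; [by apply: measurableI => //; exact: msd..|].
  by rewrite (splitr e) EFinD leeD.
split => //.
- move=> A1 [mA1 H1]; rewrite setTD; split; first exact: measurableC.
  move=> e /H1[k [P h]]; exists k, (~` P).
  rewrite (_ : sdiff _ _ = sdiff A1 (dyadic_set k P))//.
  apply/seteqP; split=> x; rewrite /sdiff /dyadic_set/=;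
    have := pselect (A1 x); have := pselect (P (dyadic_index k x)); rewrite /setD /setU /setC/=; tauto.
- move=> F DF.
  have mF k : measurable (F k) by have [] := DF k.
  have DN N' : D (\bigcup_(i < N') F i).
    elim: N' => [|N' IH]; first by rewrite bigcup_mkord big_ord0.
    by rewrite bigcup_mkord big_ord_recr/= -bigcup_mkord; exact: DU.
  split; first exact: bigcupT_measurable.
  move=> e e0; have e20 : 0 < e / 2 by rewrite divr_gt0.
  (* The tail of a countable union decreases to the empty set inside the cube [Q] of finite measure,
     so a finite union suffices up to [e / 2]. *)
  pose G N' : set (borel_rV R n) := Q `&` (\bigcup_i F i `\` \bigcup_(i < N') F i).
  have mG N' : measurable (G N').
    apply: measurableI => //; apply: measurableD; first exact: bigcupT_measurable.
    by have [] := DN N'.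
  have [|||N' hN'] := @measure_bigcap_approx _ _ _ mu G 0 (e / 2) _ mG _ _ e20.
  + apply: le_lt_trans Qoo; apply: le_measure; rewrite ?inE//.
    exact: subIsetl.
  + move=> k l kl x [Qx [xF xl]]; split => //; split => // -[i ik Fx]; apply: xl.
    by exists i => //; exact: leq_trans kl.
  + rewrite (_ : \bigcap_i _ = set0) ?measure0//.
    apply/seteqP; split => // x Gx; have [_ [[i _ Fx] _]] := Gx 0%N I.
    by have [_ [_]] := Gx i.+1 I; apply; exists i => /=.
  have [mB /(_ _ e20) [k [P h]]] := DN N'.
  exists k, P; apply: (@le_trans _ _ (mu (G N' `|`
      (sdiff (\bigcup_(i < N') F i) (dyadic_set k P) `&` Q)))).
    apply: le_measure; rewrite ?inE.
    - by apply: measurableI => //; apply: msd => //; exact: bigcupT_measurable.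
    - by apply: measurableU => //; apply: measurableI => //; exact: msd.
    - move=> x [[[a b]|[a b]] q].
        have [xN|xN] := pselect ((\bigcup_(i < N') F i) x); last by left.
        by right; split => //; left.
      right; split => //; right; split => // -[i _ Fx]; apply: b.
      by exists i.
  apply: le_trans (measureU2 _ _ _) _ => //.
    by apply: measurableI => //; exact: msd.
  by rewrite (splitr e) EFinD leeD// ltW// -[e / 2]add0r.
Qed.

(** [vol] is by definition the outer measure induced by the Borel one, so an almost optimal
    countable cover by Borel sets provides [A]. *)
Lemma outer_borel (E : set (lebesgue_rV R n)) (v e : R) :
  vol E = v%:E -> 0 < e -> exists A : set Rn,
    [/\ measurable (A : set (borel_rV R n)), E `<=` A & (mu A <= (v + e)%:E)%E].
Proof.
move=> Ev e0; have Efin : vol E \is a fin_num by rewrite Ev.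
have [x [F [mF EF] <-]] := lb_ereal_inf_adherent e0 Efin.
rewrite -[ereal_inf _]/(vol E) Ev => xlt.
exists (\bigcup_k F k); split => //; first exact: bigcupT_measurable.
apply: le_trans (ltW xlt).
apply: measure_sigma_subadditive => //; exact: bigcupT_measurable.
Qed.

(** [E] is enclosed in a Borel set [A], truncated to a large cube, and [A] is approximated there by
    a dyadic set; each of the three operations costs at most [e / 4]. *)
Lemma box_approx (E : set (lebesgue_rV R n)) (v e : R) : measurable E ->
  vol E = v%:E -> 0 < e ->
  exists s (r : R), [/\ box_family s, boxes_vol s <= v + e,
    ((v - e)%:E <= vol (E `&` halfopen_boxes s))%E &
    forall x, halfopen_boxes s x -> `|x| <= r].
Proof.
move=> mE Ev e0; have e40 : 0 < e / 4 by rewrite divr_gt0.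
have [A [mA EA muA]] := outer_borel Ev e40.
have mAL := measurable_lebesgue mA.
pose Q (N : nat) : set (borel_rV R n) := halfopen_box (cube n (N%:R : R)).
have mQ N : measurable (Q N : set (borel_rV R n)) := measurable_halfopen_box _.
have mQL N := measurable_lebesgue (mQ N).
have [|||N hN] := @measure_bigcup_approx _ _ _ vol (fun N => E `&` Q N) v _ _ _ _ e40.
- by move=> N; exact: measurableI.
- move=> k l kl x [Ex Qx]; split => // i; have := Qx i; rewrite !mxE.
  have kl' : k%:R <= l%:R :> R by rewrite ler_nat.
  by move=> [x1 x2]; split; lra.
- by rewrite -setI_bigcupr (cubes_cover R n) setIT -Ev.
have [k [P hP]] := dyadic_approx N mA e40.
(* The cube has integer vertices, so it is a dyadic set of level 0 and thus of level [k]; its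
   intersection with the approximation is again dyadic, and bounded. *)
have [Q' QE] := @dyadic_set_refine R n _ _ [set m : 'rV[int]_n | forall i, - N%:Z < m ord0 i <= N%:Z] (leq0n k).
pose D : set (borel_rV R n) := dyadic_set k P `&` Q N.
have DE : dyadic_set k (P `&` Q') = D by rewrite /D /Q cube_dyadic QE.
have QN x : Q N x -> `|x| <= N%:R.
  move=> Qx; apply: norm_le_coord => // i; have := Qx i; rewrite !mxE ler_norml.
  by move=> [/ltW -> ->].
have mD : measurable (D : set (borel_rV R n)).
  by apply: measurableI => //; exact: measurable_dyadic_set.
have mDL := measurable_lebesgue mD.
have [|s [fs sD _]] := @dyadic_boxes R n k _ D N%:R DE.
  by move=> x [_ /QN].
exists s, N%:R; rewrite sD; split => //.
- rewrite -lee_fin -(boxes_measure fs).2 sD.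
  apply: (@le_trans _ _ (mu (A `|` (sdiff A (dyadic_set k P) `&` Q N)))).
    apply: le_measure; rewrite ?inE//.
      apply: measurableU => //; apply: measurableI => //.
      by apply: measurableU; apply: measurableD => //; exact: measurable_dyadic_set.
    move=> x [Px Qx]; have [Ax|Ax] := pselect (A x); [by left|right].
    by split => //; right.
  apply: le_trans (measureU2 _ _ _) _ => //.
    apply: measurableI => //.
    by apply: measurableU; apply: measurableD => //; exact: measurable_dyadic_set.
  apply: le_trans (leeD muA hP) _.
  by rewrite -EFinD lee_fin; lra.
- have h : (vol (E `&` Q N) <= vol (E `&` D) + (e / 4)%:E)%E.
    have msd : measurable (sdiff A (dyadic_set k P) `&` Q N).
      apply: measurableI => //.
      by apply: measurableU; apply: measurableD => //; exact: measurable_dyadic_set.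
    apply: (@le_trans _ _ (vol ((E `&` D) `|` (sdiff A (dyadic_set k P) `&` Q N)))).
      apply: le_measure; rewrite ?inE//.
      - exact: measurableI.
      - by apply: measurableU; [exact: measurableI|exact: measurable_lebesgue].
      - move=> x [Ex Qx]; have [Px|Px] := pselect (dyadic_set k P x); first by left.
        by right; split => //; left; split => //; exact: EA.
    apply: le_trans (measureU2 _ _ _) _; [exact: measurableI|exact: measurable_lebesgue|].
    have hP' : (vol (sdiff A (dyadic_set k P) `&` Q N) <= (e / 4)%:E)%E by rewrite volume_borel.
    exact: leeD2l.
  have := lt_le_trans hN h; rewrite -lteBlDr//.
  by move=> /ltW; apply: le_trans; rewrite -EFinB lee_fin; lra.
- by move=> x [_ /QN].
Qed.

Lemma open_box_approx (O : set Rn) (v r e : R) : open O -> (forall x, O x -> `|x| <= r) ->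
  (v%:E <= mu O)%E -> 0 < e ->
  exists s, [/\ box_family s, v - e <= boxes_vol s & closed_boxes s `<=` O].
Proof.
move=> oO Or vO e0.
have [|||k hk] := @measure_bigcup_approx _ _ _ mu (fun k => dyadic_inner k O) v _ _ _ _ e0.
- by move=> k; exact: measurable_dyadic_set.
- exact: dyadic_inner_nondecreasing.
- by rewrite dyadic_inner_cover.
have [|s [fs sO sB]] := @dyadic_boxes R n k _ (dyadic_inner k O) r erefl.
  by move=> x /dyadic_inner_sub; exact: Or.
exists s; split => //.
- by rewrite -lee_fin -(boxes_measure fs).2 sO ltW.
- by move=> x [B /sB[y /= yO ->]]; exact: yO.
Qed.

End Approximation.

(** * Euclidean norm and convex sets *)

Lemma cvg_sum_fin (R : realType) n (T : Type) (F : set_system T) (FF : Filter F)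
    (f : 'I_n -> T -> R) (a : 'I_n -> R) :
  (forall i, f i x @[x --> F] --> a i) ->
  (\sum_i f i x) @[x --> F] --> \sum_i a i.
Proof. by move=> fa; apply: cvg_big => //; exact: add_continuous. Qed.

Section EuclideanNorm.
Variables (R : realType) (n : nat).
Local Notation Rn := 'rV[R]_n.
Implicit Types x y : Rn.

Lemma enorm_ge0 x : 0 <= enorm x.
Proof. exact: sqrtr_ge0. Qed.

Lemma enorm_sqr x : enorm x ^+ 2 = \sum_i x ord0 i ^+ 2.
Proof. by rewrite sqr_sqrtr// sumr_ge0// => i _; exact: sqr_ge0. Qed.

Lemma coord_le_enorm x i : `|x ord0 i| <= enorm x.
Proof.
rewrite -(@ler_pXn2r _ 2)// ?nnegrE ?enorm_ge0// enorm_sqr (bigD1 i)//=.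
by rewrite -normrX ger0_norm ?sqr_ge0// lerDl sumr_ge0// => j _; exact: sqr_ge0.
Qed.

Lemma norm_le_enorm x : `|x| <= enorm x.
Proof. by apply: norm_le_coord => [|i]; [exact: enorm_ge0|exact: coord_le_enorm]. Qed.

Lemma enorm_eq0 x : enorm x = 0 -> x = 0.
Proof.
move=> x0; apply/rowP => i; rewrite mxE; apply/eqP; rewrite -normr_le0 -x0.
exact: coord_le_enorm.
Qed.

Lemma enormZ (c : R) x : enorm (c *: x) = `|c| * enorm x.
Proof.
rewrite /enorm -sqrtr_sqr -sqrtrM ?sqr_ge0// mulr_sumr.
by congr Num.sqrt; apply: eq_bigr => i _; rewrite mxE exprMn.
Qed.

Lemma enormN x : enorm (- x) = enorm x.
Proof. by rewrite -scaleN1r enormZ normrN normr1 mul1r. Qed.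

(** Bounding the summands by products of absolute values covers scalar products and sums of absolute
    values alike. The proof sums [2 * s * t <= s ^+ 2 + t ^+ 2] over coordinates normalised by
    [enorm x] and [enorm y]. *)
Lemma cauchy_schwarz (a : 'I_n -> R) x y :
  (forall i, a i <= `|x ord0 i| * `|y ord0 i|) ->
  \sum_i a i <= enorm x * enorm y.
Proof.
move=> axy.
have [/eqP|x0] := boolP (enorm x == 0).
  move=> x0; rewrite x0 mul0r; apply: sumr_le0 => i _; rewrite (le_trans (axy i))//.
  by rewrite (enorm_eq0 x0) mxE normr0 mul0r.
have [/eqP|y0] := boolP (enorm y == 0).
  move=> y0; rewrite y0 mulr0; apply: sumr_le0 => i _; rewrite (le_trans (axy i))//.
  by rewrite (enorm_eq0 y0) mxE normr0 mulr0.
set A := enorm x in x0 *; set B := enorm y in y0 *.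
have A0 : 0 < A by rewrite lt0r x0 enorm_ge0.
have B0 : 0 < B by rewrite lt0r y0 enorm_ge0.
have H i : a i <= A * B / 2 * (x ord0 i ^+ 2 / A ^+ 2 + y ord0 i ^+ 2 / B ^+ 2).
  rewrite (le_trans (axy i))//.
  rewrite -(@real_normK _ (x ord0 i)) ?num_real// -(@real_normK _ (y ord0 i)) ?num_real//.
  set s := `|x ord0 i|; set t := `|y ord0 i|.
  rewrite -subr_ge0 (_ : _ - _ = (A * B / 2) * (s / A - t / B) ^+ 2); last first.
    by field; rewrite x0 y0.
  by rewrite mulr_ge0 ?sqr_ge0// divr_ge0// mulr_ge0// ltW.
apply: le_trans (ler_sum _ (fun i _ => H i)) _.
rewrite -mulr_sumr big_split/= -!mulr_suml -!enorm_sqr.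
by rewrite !divff ?expf_neq0// le_eqVlt; apply/orP; left; apply/eqP; field.
Qed.

Lemma ler_enormD x y : enorm (x + y) <= enorm x + enorm y.
Proof.
rewrite -(@ler_pXn2r _ 2)// ?nnegrE ?addr_ge0 ?enorm_ge0// enorm_sqr sqrrD !enorm_sqr.
have := @cauchy_schwarz (fun i => x ord0 i * y ord0 i) x y.
move=> cs.
rewrite (eq_bigr (fun i => x ord0 i ^+ 2 + x ord0 i * y ord0 i *+ 2 + y ord0 i ^+ 2)); last first.
  by move=> i _; rewrite mxE sqrrD.
rewrite 2!big_split/= sumrMnl lerD2r lerD2l lerMn2r/=.
by apply: cs => i; rewrite -normrM ler_norm.
Qed.

Lemma enorm_continuous : continuous (@enorm R n).
Proof.
move=> x; apply: continuous_comp; last exact: sqrt_continuous.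
apply: (@cvg_sum_fin R n Rn (nbhs x) _ (fun i (y : Rn) => y ord0 i ^+ 2)
  (fun i => x ord0 i ^+ 2)) => i; apply: (@cvg_comp _ _ _ (fun y : Rn => y ord0 i) (fun t : R => t ^+ 2)).
  exact: coord_continuous.
exact: exprn_continuous.
Qed.

Lemma enorm_shift_continuous p : continuous (fun x => enorm (x - p)).
Proof.
move=> x; apply: (@continuous_comp _ _ _ (fun x => x - p) (@enorm R n)).
  exact: (@cvgB _ _ _ (nbhs x) _ id (cst p) x p (@cvg_id _ (nbhs x)) (cvg_cst p)).
exact: enorm_continuous.
Qed.

Definition eball (p : Rn) (r : R) : set Rn := [set x | enorm (x - p) <= r].

Lemma eball_closed p r : closed (eball p r).
Proof.
apply: (@preimage_closed Rn R (fun x => enorm (x - p)) [set t | t <= r]);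
  last exact: closed_le.
by move=> x _; exact: enorm_shift_continuous.
Qed.

Lemma eball_norm p r x : eball p r x -> `|x| <= r + `|p|.
Proof.
move=> xr; rewrite -[x](subrK p) (le_trans (ler_normD _ _))// lerD2r.
exact: le_trans (norm_le_enorm _) xr.
Qed.

End EuclideanNorm.

(** * Convex sets: interior points and negligible boundary *)

Section ConvexSets.
Variables (R : realType) (n : nat).
Local Notation Rn := 'rV[R]_n.
Local Notation mu := (borel_lebesgue R n).

Lemma convex_comb (D : set Rn) (x y : Rn) (l : R) : convex_set D ->
  0 <= l <= 1 -> D x -> D y -> D (l *: x + (1 - l) *: y).
Proof.
move=> cD /andP[l0 l1] Dx Dy.
by have := cD x y (Itv01 l0 l1); rewrite !inE; apply.
Qed.

(** A point [y] near the combination is itself a combination of [x] with some [z], and [z], found by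
    solving for it, is within [e] of [q]. *)
Lemma convex_interior_comb (D : set Rn) (q x : Rn) (l : R) : convex_set D ->
  interior D q -> D x -> 0 <= l < 1 -> interior D (q + l *: (x - q)).
Proof.
move=> cD /nbhs_ballP[e /= e0 qD] Dx /andP[l0 l1].
have l1' : 0 < 1 - l by rewrite subr_gt0.
apply/nbhs_ballP; exists ((1 - l) * e); first by rewrite /= mulr_gt0.
move=> y; rewrite -ball_normE /= => yb.
pose z := q + (1 - l)^-1 *: (y - (q + l *: (x - q))).
have Dz : D z.
  apply: qD; rewrite -ball_normE /= /z opprD addrA subrr sub0r normrN normrZ.
  by rewrite gtr0_norm ?invr_gt0// ltr_pdivrMl// distrC.
have -> : y = l *: x + (1 - l) *: z.
  rewrite /z scalerDr scalerA divff ?gt_eqF// scale1r.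
  by apply/rowP => i; rewrite !mxE; ring.
by apply: convex_comb => //; rewrite l0 ltW.
Qed.

Lemma expr_lt_near1 (c e : R) : 0 <= c -> 0 < e -> exists2 l : R, 0 < l < 1 & c - e < l ^+ n * c.
Proof.
move=> c0 e0.
have : (fun l : R => l ^+ n * c) l @[l --> 1^'-] --> 1 ^+ n * c.
  apply: cvg_at_left_filter; apply: cvgMl; exact: exprn_continuous.
rewrite expr1n mul1r => /cvgrPdist_lt/(_ e e0) H.
near (1:R)^'- => l; exists l.
  by apply/andP; split; near: l; [exact: nbhs_left_gt|exact: nbhs_left_lt].
have : `|c - l ^+ n * c| < e by near: l.
by rewrite ltr_norml => /andP[_]; lra.
Unshelve. all: by end_near. Qed.

(** The homothety of ratio [l < 1] centred at an interior point sends [D] into its interior and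
    multiplies the volume by [l ^+ n]; then [l] tends to 1. *)
Lemma convex_interior_measure (D : set Rn) (r : R) : convex_set D ->
  measurable (D : set (borel_rV R n)) -> interior D !=set0 ->
  (forall x, D x -> `|x| <= r) -> mu (interior D) = mu D.
Proof.
move=> cD mD [q Dq] Dr.
have mi : measurable (interior D : set (borel_rV R n)).
  by apply: open_measurable_rV; exact: open_interior.
have Doo : (mu D < +oo)%E by exact: bounded_borel_finite Dr mD.
have Dfin : mu D \is a fin_num by rewrite ge0_fin_numE.
apply/eqP; rewrite eq_le; apply/andP; split.
  by apply: le_measure; rewrite ?inE//; exact: interior_subset.
have iD : (mu (interior D) <= mu D)%E.
  by apply: le_measure; rewrite ?inE//; exact: interior_subset.
have ifin : mu (interior D) \is a fin_num by rewrite ge0_fin_numE// (le_lt_trans iD).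
rewrite -(fineK Dfin) -(fineK ifin) lee_fin; apply/ler_addgt0Pl => e e0.
have [l /andP[l0 l1] le] := @expr_lt_near1 (fine (mu D)) e (fine_ge0 (measure_ge0 _ _)) e0.
suff H : ((l ^+ n)%:E * mu D <= mu (interior D))%E.
  have : l ^+ n * fine (mu D) <= fine (mu (interior D)).
    by rewrite -lee_fin EFinM !fineK.
  lra.
rewrite (@measure_affine _ _ (q - l *: q) l (interior D))//.
apply: lee_wpmul2l; first by rewrite lee_fin exprn_ge0// ltW.
apply: le_measure; rewrite ?inE//; first exact: measurable_scale.
move=> x Dx /=; have := @convex_interior_comb D q x l cD Dq Dx.
rewrite (ltW l0) l1 => /(_ isT); congr (_ _).
by rewrite scalerBr addrA addrAC.
Qed.

Lemma convex_setI_eball (D : set Rn) (p : Rn) (s : R) : convex_set D ->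
  convex_set (D `&` eball p s).
Proof.
move=> cD.
move=> x y l; rewrite !inE => -[Dx xr] [Dy yr]; split.
  by have := cD x y l; rewrite !inE; apply.
rewrite /eball/=; set z := (X in X - p).
have -> : z - p = l%:num *: (x - p) + (1 - l%:num) *: (y - p).
  have -> : z = l%:num *: x + (1 - l%:num) *: y by [].
  by apply/rowP => i; rewrite !mxE; ring.
rewrite (le_trans (ler_enormD _ _))// !enormZ !ger0_norm//.
rewrite /eball/= in xr yr.
have : l%:num * enorm (x - p) <= l%:num * s by rewrite ler_wpM2l.
have : (1 - l%:num) * enorm (y - p) <= (1 - l%:num) * s by rewrite ler_wpM2l.
lra.
Qed.

Lemma closed_bounded_measure_split (D : set Rn) : closed D -> convex_set D -> interior D !=set0 ->
  forall p r, mu ((D `\` interior D) `&` eball p r) = 0%E.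
Proof.
move=> clD cD [q Dq] p r.
(* [s] exceeds [r], so that [B] contains the points in question, and exceeds [enorm (q - p)], so
   that [q] is interior to [B]. *)
pose s := Num.max (r + 1) (enorm (q - p) + 1).
pose B := D `&` eball p s.
have cB : convex_set B by exact: convex_setI_eball.
have near_ball x t : enorm (x - p) < t -> nbhs x (eball p t).
  move=> xt; pose e := t - enorm (x - p).
  have : nbhs x [set y : Rn | enorm (y - p) < t].
    apply: open_nbhs_nbhs; split => //.
    apply: (@open_comp Rn R (fun x => enorm (x - p)) [set u | u < t]) => [z _|].
      exact: enorm_shift_continuous.
    exact: open_lt.
  by apply: filterS => y /= /ltW.
have mB : measurable (B : set (borel_rV R n)).
  by apply: measurableI; apply: closed_measurable_rV => //; exact: eball_closed.
have iB : interior B !=set0.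
  exists q; apply: filterI => //; apply: near_ball.
  by rewrite lt_max ltrDl ltr01 orbT.
have Bn x : B x -> `|x| <= s + `|p| by move=> [_ /eball_norm].
have mi : measurable (interior B : set (borel_rV R n)).
  by apply: open_measurable_rV; exact: open_interior.
have Boo : (mu B < +oo)%E by exact: bounded_borel_finite Bn mB.
have : mu (B `\` interior B) = 0%E.
  have BE : B `&` interior B = interior B by apply/setIidPr; exact: interior_subset.
  have E1 : mu (B `\` interior B) = (mu B - mu (B `&` interior B))%E by exact: measureD.
  by rewrite E1 BE (convex_interior_measure cB mB iB Bn) subee// ge0_fin_numE.
apply: subset_measure0.
- apply: measurableI; last by apply: closed_measurable_rV; exact: eball_closed.
  by apply: measurableD; [exact: closed_measurable_rV|apply: open_measurable_rV; exact: open_interior].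
- exact: measurableD.
- move=> x [[Dx niD] xr]; split.
    by split => //; rewrite /eball/= (le_trans xr)// le_max lerDl ler01.
  by move=> iBx; apply: niD; apply: filterS iBx => y [].
Qed.

Lemma convex_boundary_null (D : set Rn) : closed D -> convex_set D -> interior D !=set0 ->
  mu (D `\` interior D) = 0%E.
Proof.
move=> clD cD iD.
have mb : measurable ((D `\` interior D) : set (borel_rV R n)).
  by apply: measurableD; [exact: closed_measurable_rV|apply: open_measurable_rV; exact: open_interior].
pose F (k : nat) : set (borel_rV R n) := (D `\` interior D) `&` eball 0 k%:R.
have mF k : measurable (F k).
  by apply: measurableI => //; apply: closed_measurable_rV; exact: eball_closed.
have FE : D `\` interior D = \bigcup_k F k.
  rewrite /F -setI_bigcupr; apply/esym/setIidPl => x _.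
  exists (Num.truncn (enorm x)).+1 => //.
  by rewrite /eball/= subr0 ltW// truncnS_gt.
apply/eqP; rewrite eq_le measure_ge0 andbT FE.
have := @nondecreasing_cvg_mu _ _ _ mu F mF; rewrite -FE => /(_ mb) H.
apply: (@cvge_to_le _ _ _ _ (mu \o F) _ _ (H _)).
  move=> k l kl; apply/subsetPset => x [Dx xk]; split => //.
  by rewrite /eball/= (le_trans xk)// ler_nat.
apply: nearW => k /=; rewrite /F.
by have := @closed_bounded_measure_split D clD cD iD 0 k%:R => /eqP; rewrite eq_le => /andP[].
Qed.

End ConvexSets.

(** * Asymptotic cones and volumes of balls *)

Section Cones.
Variables (R : realType) (n : nat).
Local Notation Rn := 'rV[R]_n.
Local Notation mu := (borel_lebesgue R n).
Implicit Types (C D K : set Rn) (p x y : Rn) (r s t : R).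

Definition convex_cone K : Prop :=
  [/\ closed K, forall x y, K x -> K y -> K (x + y),
      forall t x, 0 <= t -> K x -> K (t *: x) & interior K !=set0].

Lemma convex_cone_convex K : convex_cone K -> convex_set K.
Proof.
move=> [_ Kadd Kscale _] x y l; rewrite !inE => Kx Ky.
apply: Kadd; apply: Kscale => //.
by rewrite /= subr_ge0.
Qed.

Lemma convex_cone0 K : convex_cone K -> K 0.
Proof.
by move=> [_ _ Kscale [q /interior_subset Kq]]; rewrite -(scale0r q); exact: Kscale.
Qed.

(** An interior point is scaled up until the ball around it has radius 1. The vector [q0] is the
    direction in which sets will be translated. *)
Lemma convex_cone_cube K : convex_cone K -> exists q0, forall y, `|y| <= 1 -> K (q0 + y).
Proof.
move=> [_ _ Kscale [q /nbhs_ballP[e /= e0 qK]]]; exists ((2 / e) *: q) => y y1.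
rewrite (_ : _ + y = (2 / e) *: (q + (e / 2) *: y)); last first.
  rewrite scalerDr scalerA (_ : 2 / e * (e / 2) = 1) ?scale1r//.
  by field; rewrite gt_eqF.
apply: Kscale; first by rewrite divr_ge0// ltW.
apply: qK; rewrite -ball_normE /= opprD addrA subrr sub0r normrN normrZ.
rewrite gtr0_norm ?divr_gt0// (@le_lt_trans _ _ (e / 2))//.
  by rewrite ler_piMr// ltW// divr_gt0.
by rewrite ltr_pdivrMr// ltr_pMr// ltr1n.
Qed.

Lemma affine_continuous p t : continuous (fun x => p + t *: x).
Proof.
move=> x; apply: (@cvgD _ _ _ (nbhs x) _ (cst p) (fun x => t *: x)).
  exact: cvg_cst.
exact: (@cvgZl_tmp _ _ _ (nbhs x) _ t id x (@cvg_id _ (nbhs x))).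
Qed.

Lemma asymptotic_coneP C p y :
  asymptotic_cone C p y <-> forall t, 0 < t -> C (p + t *: y).
Proof.
split=> [H t t0|H l /= l0].
  have [|x Cx <-] := H t^-1; first by rewrite /= invr_gt0.
  by rewrite scalerA divff ?gt_eqF// scale1r addrC subrK.
exists (p + l^-1 *: y); first by apply: H; rewrite invr_gt0.
by rewrite addrC addKr scalerA divff ?gt_eqF// scale1r.
Qed.

(** A recession direction at [p] is one at every point [x]: segments from [x] to ever more distant
    points of the ray from [p] converge to the ray from [x]. *)
Lemma asymptotic_cone_add C p x y : closed C -> convex_set C ->
  C x -> asymptotic_cone C p y -> C (x + y).
Proof.
move=> clC cC Cx /asymptotic_coneP Ky.
(* This point is the combination of [x] and [p + e^-1 *: y] with weights [1 - e] and [e]. *)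
apply: (@closed_cvg _ _ (0 : R)^'+ _ (fun e : R => x + y + e *: (p - x)) C clC).
  near=> e.
  have e1 : e < 1 by near: e; exact: nbhs_right_lt.
  rewrite (_ : _ + _ = (1 - e) *: x + (1 - (1 - e)) *: (p + e^-1 *: y)); last first.
    rewrite subKr [e *: (p + e^-1 *: y)]scalerDr scalerA divff ?gt_eqF// scale1r.
    by apply/rowP => i; rewrite !mxE; ring.
  apply: convex_comb => //; first by rewrite subr_ge0 (ltW e1)/= gerBl ltW.
  by apply: Ky; rewrite invr_gt0.
rewrite -[X in _ --> X]addr0 -(scale0r (p - x)).
apply: cvg_at_right_filter.
apply: (@cvgD _ _ _ (nbhs (0 : R)) _ (cst (x + y)) (fun e => e *: (p - x))).
  exact: cvg_cst.
exact: scalel_continuous.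
Unshelve. all: by end_near. Qed.

Lemma asymptotic_cone_convex_cone C p : closed C -> convex_set C -> C p ->
  interior (asymptotic_cone C p) !=set0 -> convex_cone (asymptotic_cone C p).
Proof.
move=> clC cC Cp Kint; split => //.
- rewrite (_ : asymptotic_cone C p =
      \bigcap_(t in [set t : R | 0 < t]) ((fun y => p + t *: y) @^-1` C)).
    apply: closed_bigI => t _; apply: preimage_closed => // y _.
    exact: affine_continuous.
  by apply/seteqP; split => y; [move=> /asymptotic_coneP H t /H|move=> H; apply/asymptotic_coneP].
- move=> x y Kx Ky; apply/asymptotic_coneP => t t0.
  rewrite scalerDr addrA; apply: (@asymptotic_cone_add C p) => //.
    by move/asymptotic_coneP : Kx; exact.
  move/asymptotic_coneP : Ky => Ky; apply/asymptotic_coneP => u u0.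
  by rewrite scalerA; apply: Ky; rewrite mulr_gt0.
- move=> t x; rewrite le_eqVlt => /orP[/eqP <- _|t0 /asymptotic_coneP Kx].
    by rewrite scale0r; apply/asymptotic_coneP => u _; rewrite scaler0 addr0.
  by apply/asymptotic_coneP => u u0; rewrite scalerA; apply: Kx; rewrite mulr_gt0.
Qed.

Lemma open_measure_gt0 (O : set Rn) : open O -> O !=set0 -> (0 < mu O)%E.
Proof.
move=> oO [x Ox]; have /nbhs_ballP[e /= e0 eO] := open_nbhs_nbhs (conj oO Ox).
pose B : Rn * Rn := (x, x + const_mx (e / 2)).
have e20 : 0 < e / 2 by rewrite divr_gt0.
apply: (@lt_le_trans _ _ (mu (halfopen_box B))).
  rewrite halfopen_box_measure lte_fin; apply: prodr_gt0 => i _.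
  by rewrite !mxE addrAC subrr add0r lt_max e20 orbT.
apply: le_measure; rewrite ?inE; [exact: measurable_halfopen_box|exact: open_measurable_rV|].
move=> y By; apply: eO; rewrite -ball_normE /= (@le_lt_trans _ _ (e / 2))//.
  apply: norm_le_coord => [|i]; first exact: ltW.
  have := By i; rewrite !mxE ler_norml => -[y1 y2]; apply/andP; split; lra.
by rewrite ltr_pdivrMr// ltr_pMr// ltr1n.
Qed.

Definition ball_vol D p r : R := fine (mu (D `&` eball p r)).

Lemma measurable_ball_sect D p r : closed D ->
  measurable ((D `&` eball p r) : set (borel_rV R n)).
Proof.
by move=> clD; apply: measurableI; apply: closed_measurable_rV => //; exact: eball_closed.
Qed.

Lemma ball_volE D p r : closed D -> mu (D `&` eball p r) = (ball_vol D p r)%:E.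
Proof.
move=> clD; rewrite /ball_vol fineK// ge0_fin_numE//.
apply: (@bounded_borel_finite _ _ _ (r + `|p|)); last exact: measurable_ball_sect.
by move=> x [_ /eball_norm].
Qed.

Lemma ball_vol_ge0 D p r : 0 <= ball_vol D p r.
Proof. exact/fine_ge0/measure_ge0. Qed.

Lemma ball_vol_le D p r s : closed D -> r <= s -> ball_vol D p r <= ball_vol D p s.
Proof.
move=> clD rs; rewrite -lee_fin -!ball_volE//.
apply: le_measure; rewrite ?inE; [exact: measurable_ball_sect..|].
by move=> x [Dx xr]; split => //; exact: le_trans xr rs.
Qed.

(** The homothety of centre [p] and ratio [r / s] maps the part of [D] in the large ball into its
    part in the small one. *)
Lemma ball_vol_growth D p r s : closed D -> convex_set D -> D p -> 0 < r -> r <= s ->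
  ball_vol D p s <= (s / r) ^+ n * ball_vol D p r.
Proof.
move=> clD cD Dp r0 rs; have s0 := lt_le_trans r0 rs.
rewrite -lee_fin EFinM -!ball_volE//.
rewrite (@measure_affine _ _ (p - (s / r) *: p) (s / r))//; last 2 first.
- by rewrite divr_gt0.
- exact: measurable_ball_sect.
apply: lee_wpmul2l; first by rewrite lee_fin exprn_ge0// divr_ge0// ltW.
apply: le_measure; rewrite ?inE.
- by apply: measurable_scale; exact: measurable_ball_sect.
- exact: measurable_ball_sect.
- move=> x /= [Dz zs].
  have xE : x = (r / s) *: (p - (s / r) *: p + (s / r) *: x) + (1 - r / s) *: p.
    rewrite scalerDr scalerBr !scalerA (_ : r / s * (s / r) = 1); last first.
      by field; rewrite !gt_eqF.
    by apply/rowP => i; rewrite !mxE; ring.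
  split.
    rewrite xE; apply: convex_comb => //.
    by rewrite divr_ge0 ?(ltW r0) ?(ltW s0)//= ler_pdivrMr// mul1r.
  move: zs; rewrite /eball/= (_ : _ - p = (s / r) *: (x - p)); last first.
    by apply/rowP => i; rewrite !mxE; ring.
  rewrite enormZ ger0_norm ?divr_ge0 ?(ltW r0) ?(ltW s0)//.
  by rewrite mulrAC ler_pdivrMr// ler_pM2l.
Qed.

(** Half-sides [2 * r] rather than [r] keep the lower faces, which a half-open box omits, away from
    the ball. *)
Lemma ball_vol_small D p r : closed D -> 0 < r -> ball_vol D p r <= (4 * r) ^+ n.
Proof.
move=> clD r0; rewrite -lee_fin -ball_volE//.
pose B : Rn * Rn := (p - const_mx (2 * r), p + const_mx (2 * r)).
apply: (@le_trans _ _ (mu (halfopen_box B))).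
  apply: le_measure; rewrite ?inE; [exact: measurable_ball_sect|exact: measurable_halfopen_box|].
  move=> x [_ xr] i; have := le_trans (coord_le_enorm _ i) xr; rewrite !mxE ler_norml.
  by move=> /andP[x1 x2]; split; lra.
rewrite halfopen_box_measure lee_fin -[X in _ <= _ ^+ X](card_ord n) -prodr_const.
apply: ler_prod => i _; rewrite !mxE le_max lexx/= ge_max mulr_ge0 ?(ltW r0)//=.
by lra.
Qed.

(** Exact to first order at [x = 1]; the surplus factor [x ^+ m] disappears when the two radii that
    it compares come together. *)
Lemma exprn_growth (m : nat) (x : R) : 1 <= x -> x ^+ m - 1 <= m%:R * (x - 1) * x ^+ m.
Proof.
move=> x1; have x0 : 0 <= x by exact: le_trans x1.
elim: m => [|m IH]; first by rewrite expr0 subrr !mul0r.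
have h : 1 <= x ^+ m by exact: exprn_ege1.
rewrite exprS (_ : x * x ^+ m - 1 = x * (x ^+ m - 1) + (x - 1)); last by ring.
have : x * (x ^+ m - 1) <= x * (m%:R * (x - 1) * x ^+ m) by rewrite ler_wpM2l.
have : (x - 1) * 1 <= (x - 1) * (x * x ^+ m).
  by rewrite ler_wpM2l ?subr_ge0// mulr_ege1.
rewrite -[m.+1%:R]natr1; set a := m%:R; set b := x ^+ m; move=> A1 A2.
have -> : (a + 1) * (x - 1) * (x * b) = x * (a * (x - 1) * b) + (x - 1) * (x * b) by ring.
lra.
Qed.

(** [ball_vol_growth] makes the volume Lipschitz in the radius on compact intervals of positive
    numbers, so every intermediate value is attained. *)
Lemma ball_vol_surj D p v : (0 < n)%N -> closed D -> convex_set D -> D p -> 0 < v ->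
  (exists r, v <= ball_vol D p r) -> exists2 r, 0 < r & ball_vol D p r = v.
Proof.
move=> n0 clD cD Dp v0 [b0 vb0].
(* With [4 * a] at most both 1 and [v], its [n]-th power is at most [v], as [n] is positive. *)
pose a := Num.min (v / 4) (1 / 4).
have a0 : 0 < a by rewrite lt_min !divr_gt0.
have av : ball_vol D p a <= v.
  apply: le_trans (ball_vol_small p clD a0) _.
  have a1 : 4 * a <= 1 by rewrite mulrC -ler_pdivlMr// ge_min lexx orbT.
  have av : 4 * a <= v by rewrite mulrC -ler_pdivlMr// ge_min lexx.
  rewrite -(prednK n0) exprS (le_trans _ av)// ler_piMr ?mulr_ge0 ?(ltW a0)//.
  by rewrite exprn_ile1// mulr_ge0// ltW.
pose b := Num.max a b0.
have ab : a <= b by rewrite le_max lexx.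
have b_gt0 := lt_le_trans a0 ab.
have vb : v <= ball_vol D p b.
  by rewrite (le_trans vb0)// ball_vol_le// le_max lexx orbT.
(* The bound from [exprn_growth] at [s / r], with the worst radii in [[a, b]]. *)
pose L := ball_vol D p b * (n%:R * (b / a) ^+ n / a).
have L0 : 0 <= L.
  by rewrite !mulr_ge0 ?ball_vol_ge0 ?exprn_ge0 ?invr_ge0 ?divr_ge0// ltW.
have lip r s : a <= r -> r <= s -> s <= b -> ball_vol D p s - ball_vol D p r <= L * (s - r).
  move=> ar rs sb; have r0 := lt_le_trans a0 ar.
  have g := ball_vol_growth clD cD Dp r0 rs.
  apply: (@le_trans _ _ (((s / r) ^+ n - 1) * ball_vol D p r)).
    by rewrite mulrBl mul1r lerD2r.
  have sr1 : 1 <= s / r by rewrite ler_pdivlMr// mul1r.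
  apply: (@le_trans _ _ ((n%:R * (s / r - 1) * (s / r) ^+ n) * ball_vol D p b)).
    apply: ler_pM; rewrite ?ball_vol_ge0 ?subr_ge0 ?exprn_ege1//.
      exact: exprn_growth.
    by apply: ball_vol_le => //; exact: le_trans sb.
  have s_gt0 := lt_le_trans r0 rs.
  have XY : (s / r) ^+ n / r <= (b / a) ^+ n / a.
    apply: ler_pM; rewrite ?exprn_ge0 ?invr_ge0 ?divr_ge0 ?(ltW r0) ?(ltW s_gt0)//.
      rewrite lerXn2r ?nnegrE ?divr_ge0 ?(ltW r0) ?(ltW s_gt0) ?(ltW a0) ?(ltW b_gt0)//.
      by apply: ler_pM; rewrite ?invr_ge0 ?(ltW r0) ?(ltW s_gt0)// lef_pV2.
    by rewrite lef_pV2.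
  rewrite /L mulrC -[leRHS]mulrA ler_wpM2l ?ball_vol_ge0//.
  rewrite (_ : n%:R * (s / r - 1) * (s / r) ^+ n = n%:R * (s - r) * ((s / r) ^+ n / r)); last first.
    by field; rewrite gt_eqF.
  rewrite [leRHS](_ : _ = n%:R * (s - r) * ((b / a) ^+ n / a)); last by ring.
  by rewrite ler_wpM2l// mulr_ge0// subr_ge0.
pose g t := ball_vol D p (clamp a b t).
have gc : continuous g.
  move=> t; apply/cvgrPdist_lt => e e0.
  have cc := @clamp_continuous R a b t.
  have e'0 : 0 < e / (L + 1) by rewrite divr_gt0// ltr_wpDl.
  move/cvgrPdist_lt : cc => /(_ _ e'0); apply: filterS => u.
  rewrite /g; set y := clamp a b u; set x := clamp a b t => xy.
  have H (x' y' : R) : a <= x' -> x' <= y' -> y' <= b -> `|x' - y'| < e / (L + 1) ->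
      `|ball_vol D p x' - ball_vol D p y'| < e.
    move=> ax xy' yb h; rewrite distrC ger0_norm ?subr_ge0 ?ball_vol_le//.
    apply: (le_lt_trans (lip _ _ ax xy' yb)).
    apply: (@le_lt_trans _ _ (L * (e / (L + 1)))).
      by rewrite ler_wpM2l// ltW// -(ger0_norm (_ : 0 <= y' - x')) ?subr_ge0// distrC.
    by rewrite mulrCA gtr_pMr// ltr_pdivrMr ?mul1r ?ltrDl// ltr_wpDl.
  have [xy'|/ltW yx'] := leP x y.
    by apply: H => //; [exact: clamp_ge|exact: clamp_le_hi].
  rewrite distrC; apply: H => //; [exact: clamp_ge|exact: clamp_le_hi|by rewrite distrC].
have [r _ gr] : exists2 c, c \in `[a, b] & g c = v.
  apply: IVT => //; first exact: continuous_subspaceT.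
  rewrite /g !clamp_id// min_l ?max_r ?av ?vb// ball_vol_le//.
by exists (clamp a b r) => //; exact: lt_le_trans (clamp_ge _ _ _).
Qed.

Lemma ball_vol_cone K r : convex_cone K -> 0 < r ->
  ball_vol K 0 r = r ^+ n * ball_vol K 0 1.
Proof.
move=> cK r0; have [clK _ Ks _] := cK.
apply/EFin_inj; rewrite EFinM -!ball_volE//.
rewrite (@measure_affine _ _ 0 r)//; last exact: measurable_ball_sect.
congr (_ * mu _)%E; apply/seteqP; split=> x /=; rewrite add0r /eball/= !subr0 enormZ gtr0_norm//.
  move=> [Kx xr]; split; last by rewrite -ler_pdivlMl// mulVf ?gt_eqF// in xr.
  by rewrite -[x]scale1r -(@mulVf _ r) ?gt_eqF// -scalerA; apply: Ks => //; rewrite invr_ge0 ltW.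
by move=> [Kx xr]; split; [apply: Ks => //; exact: ltW|rewrite ler_piMr// ltW].
Qed.

Lemma cone_ball_open K : convex_cone K ->
  exists O : set Rn, [/\ open O, O !=set0 & O `<=` K `&` eball 0 1].
Proof.
move=> cK; have [clK _ Ks [q Kq]] := cK.
exists (interior K `&` [set x : Rn | enorm (x - 0) < 1]); split.
- apply: openI; first exact: open_interior.
  apply: (@open_comp Rn R (fun x => enorm (x - 0)) [set u | u < 1]) => [z _|].
    exact: enorm_shift_continuous.
  exact: open_lt.
- set N := enorm q + 1.
  have N0 : 0 < N by rewrite ltr_wpDl ?enorm_ge0.
  have l0 : 0 < N^-1 by rewrite invr_gt0.
  exists (N^-1 *: q); split.
    have := Kq => /nbhs_ballP[e /= e0 qK]; apply/nbhs_ballP.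
    exists (N^-1 * e); first by rewrite /= mulr_gt0.
    move=> y; rewrite -ball_normE /= => yb.
    have -> : y = N^-1 *: (N *: y) by rewrite scalerA mulVf ?gt_eqF// scale1r.
    apply: Ks; first exact: ltW.
    apply: qK; rewrite -ball_normE /=.
    have -> : q - N *: y = N *: (N^-1 *: q - y).
      by rewrite scalerBr scalerA divff ?gt_eqF// scale1r.
    by rewrite normrZ gtr0_norm// -ltr_pdivlMl.
  by rewrite /= subr0 enormZ gtr0_norm// mulrC ltr_pdivrMr// mul1r ltrDl.
- by move=> x [/interior_subset Kx /ltW x1].
Qed.

Lemma ball_vol_cone_gt0 K : convex_cone K -> 0 < ball_vol K 0 1.
Proof.
move=> cK; have [clK _ _ _] := cK; have [U [oU U0 hU]] := cone_ball_open cK.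
rewrite -lte_fin -ball_volE//; apply: lt_le_trans (open_measure_gt0 oU U0) _.
by apply: le_measure; rewrite ?inE; [exact: open_measurable_rV|exact: measurable_ball_sect|].
Qed.

Lemma ball_vol_ge_cone C p r : closed C -> convex_set C -> C p ->
  convex_cone (asymptotic_cone C p) -> 0 < r ->
  r ^+ n * ball_vol (asymptotic_cone C p) 0 1 <= ball_vol C p r.
Proof.
move=> clC cC Cp cK r0; have [clK _ _ _] := cK.
rewrite -lee_fin EFinM -!ball_volE//.
rewrite [leRHS](@measure_affine _ _ p r)//; last exact: measurable_ball_sect.
apply: lee_wpmul2l; first by rewrite lee_fin exprn_ge0// ltW.
apply: le_measure; rewrite ?inE.
- exact: measurable_ball_sect.
- by apply: measurable_scale; exact: measurable_ball_sect.
- move=> x [/asymptotic_coneP Kx]; rewrite /eball/= subr0 => x1; split; first exact: Kx.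
  by rewrite addrC addKr enormZ gtr0_norm// ler_piMr// ltW.
Qed.

(** By convexity the rescaled sets [(C - p) / k] in the unit ball decrease to the part of the cone
    there, so their volumes converge. [ball_vol_growth] extends the bound at one integer radius to
    all larger radii. *)
Lemma ball_vol_asymptotic C p e : closed C -> convex_set C -> C p ->
  convex_cone (asymptotic_cone C p) -> 0 < e -> exists2 r, 0 < r &
  forall s, r <= s -> ball_vol C p s <= s ^+ n * (ball_vol (asymptotic_cone C p) 0 1 + e).
Proof.
move=> clC cC Cp cK e0; have [clK _ _ _] := cK.
pose F (k : nat) : set (borel_rV R n) := [set x : Rn | (C `&` eball p k.+1%:R) (p + k.+1%:R *: x)].
have mF k : measurable (F k) by apply: measurable_scale; exact: measurable_ball_sect.
have k0 k : 0 < k.+1%:R :> R by rewrite ltr0n.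
have FE k : F k = [set x : Rn | C (p + k.+1%:R *: x) /\ enorm x <= 1].
  have E x : eball p k.+1%:R (p + k.+1%:R *: x) = (enorm x <= 1) :> Prop.
    by rewrite /eball/= addrC addKr enormZ gtr0_norm// -[leRHS]mulr1 ler_pM2l.
  by apply/seteqP; split=> x [Cx]; rewrite ?E => x1; split => //=; rewrite E.
have [|||k hk] := @measure_bigcap_approx _ _ _ mu F (ball_vol (asymptotic_cone C p) 0 1) e _ mF _ _ e0.
- apply: (@bounded_borel_finite _ _ _ 1) => //.
  by move=> x; rewrite FE => -[_]; apply: le_trans; exact: norm_le_enorm.
- move=> k l kl x; rewrite !FE => -[Cx x1]; split => //.
  have -> : p + k.+1%:R *: x = (k.+1%:R / l.+1%:R) *: (p + l.+1%:R *: x) + (1 - k.+1%:R / l.+1%:R) *: p.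
    by apply/rowP => i; rewrite !mxE; field; rewrite gt_eqF.
  apply: convex_comb => //; rewrite divr_ge0 ?ler0n//= ler_pdivrMr// mul1r.
  by rewrite ler_nat ltnS.
- rewrite -ball_volE//; apply: le_measure; rewrite ?inE; [exact: bigcapT_measurable|exact: measurable_ball_sect|].
  move=> x Fx; split.
    (* Integer dilations suffice: [p + t *: x] lies on the segment from [p] to
       [p + k.+1%:R *: x]. *)
    apply/asymptotic_coneP => t t0; pose k := Num.truncn t.
    have := Fx k I; rewrite FE => -[Cx _].
    have tk : t < k.+1%:R by exact: truncnS_gt.
    have -> : p + t *: x = (t / k.+1%:R) *: (p + k.+1%:R *: x) + (1 - t / k.+1%:R) *: p.
      by apply/rowP => i; rewrite !mxE; field; rewrite gt_eqF.
    apply: convex_comb => //; rewrite divr_ge0 ?ler0n ?(ltW t0)//= ler_pdivrMr// mul1r.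
    exact: ltW.
  by have := Fx 0%N I; rewrite FE => -[_]; rewrite /eball/= subr0.
exists k.+1%:R => // s ks; have s0 := lt_le_trans (k0 k) ks.
apply: le_trans (ball_vol_growth clC cC Cp (k0 k) ks) _.
rewrite expr_div_n -mulrA ler_wpM2l ?exprn_ge0 ?(ltW s0)//.
rewrite ler_pdivrMl ?exprn_gt0// -lee_fin -ball_volE//.
rewrite (@measure_affine _ _ p k.+1%:R)//; last exact: measurable_ball_sect.
rewrite EFinM; apply: lee_wpmul2l; first by rewrite lee_fin exprn_ge0// ltW.
exact: ltW.
Qed.

End Cones.

(** * Smoothness from uniform Taylor expansions *)

Section Taylor.
Variables (R : realType) (n : nat).
Local Notation Rn := 'rV[R]_n.
Implicit Types (f g : Rn -> R) (x h : Rn) (k : nat).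

(* Unlike differentiability, this passes to convolutions with an L^1 function
   without differentiating under the integral sign. *)
Fixpoint taylor k f : Prop :=
  (exists M, forall x, `|f x| <= M) /\
  match k with
  | 0 => True
  | k'.+1 => exists g : 'I_n -> Rn -> R, (forall i, taylor k' (g i)) /\
      exists M, forall x h,
        `|f (x + h) - f x - \sum_i h ord0 i * g i x| <= M * `|h| ^+ 2
  end.

Lemma taylor_bounded k f : taylor k f -> exists2 M, 0 <= M & forall x, `|f x| <= M.
Proof.
move=> H; have [M fM] : exists M, forall x, `|f x| <= M by case: k H => [|k] [].
by exists M => //; rewrite (le_trans (normr_ge0 (f 0))).
Qed.

Lemma taylor_ext k f g : f =1 g -> taylor k f -> taylor k g.
Proof. by move=> /funext ->. Qed.

Lemma taylorW k f : taylor k.+1 f -> taylor k f.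
Proof.
elim: k f => [|k IH] f [bf [g [kg tf]]]; first by split.
by split => //; exists g; split => // i; exact: IH.
Qed.

Lemma taylor_le k l f : (k <= l)%N -> taylor l f -> taylor k f.
Proof.
by move=> /subnK <-; elim: (l - k)%N => [//|m IH]; rewrite addSn => /taylorW.
Qed.

Lemma taylor_cst k (c : R) : taylor k (fun=> c).
Proof.
elim: k c => [|k IH] c; (split; first by exists `|c|) => //.
exists (fun=> fun=> 0); split => // ; exists 0 => x h.
by rewrite subrr big1 ?subrr ?normr0 ?mul0r// => i _; rewrite mulr0.
Qed.

Lemma taylorD k f g : taylor k f -> taylor k g -> taylor k (fun x => f x + g x).
Proof.
elim: k f g => [|k IH] f g [[Mf fM] Hf] [[Mg gM] Hg];
  (split; first by exists (Mf + Mg) => x; rewrite (le_trans (ler_normD _ _))// lerD).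
  by [].
have [f' [kf' [Tf fT]]] := Hf; have [g' [kg' [Tg gT]]] := Hg.
exists (fun i x => f' i x + g' i x); split; first by move=> i; exact: (IH _ _ (kf' i) (kg' i)).
exists (Tf + Tg) => x h.
rewrite (eq_bigr (fun i => h ord0 i * f' i x + h ord0 i * g' i x)); last first.
  by move=> i _; rewrite mulrDr.
rewrite big_split/= (_ : _ - _ - _ = (f (x + h) - f x - \sum_i h ord0 i * f' i x) +
  (g (x + h) - g x - \sum_i h ord0 i * g' i x)); last by ring.
by rewrite (le_trans (ler_normD _ _))// mulrDl lerD.
Qed.

Lemma taylor_sum_coord (g : 'I_n -> Rn -> R) k : (forall i, taylor k (g i)) ->
  exists2 M, 0 <= M & forall h x, `|\sum_i h ord0 i * g i x| <= M * `|h|.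
Proof.
move=> kg; have [M HM] := choice (fun i => let: ex_intro2 M M0 H := taylor_bounded (kg i) in
   ex_intro (fun M => 0 <= M /\ forall x, `|g i x| <= M) M (conj M0 H)).
exists (\sum_i M i); first by apply: sumr_ge0 => i _; have [] := HM i.
move=> h' x; rewrite (le_trans (ler_norm_sum _ _ _))// mulr_suml; apply: ler_sum => i _.
by rewrite normrM mulrC ler_pM ?(HM i).2 ?coord_le_norm.
Qed.

(** For [h] of norm at most 1 the expansion gives a linear bound; for larger [h] boundedness
    does. *)
Lemma taylor_lipschitz f : taylor 1 f ->
  exists2 L, 0 <= L & forall x h, `|f (x + h) - f x| <= L * `|h|.
Proof.
move=> tf; have [M0 M0_ge0 fM0] := taylor_bounded tf.
have [_ [g [kg [M fM]]]] := tf.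
have [G G0 gG] := @taylor_sum_coord g 0 kg.
exists (G + `|M| + 2 * M0); first by rewrite !addr_ge0// mulr_ge0.
move=> x h; have [h1|h1] := leP `|h| 1.
  apply: (@le_trans _ _ ((G + `|M|) * `|h|)); last first.
    by rewrite ler_wpM2r// lerDl mulr_ge0.
  rewrite -[f (x + h) - f x](subrK (\sum_i h ord0 i * g i x)).
  rewrite (le_trans (ler_normD _ _))// addrC mulrDl lerD//.
  rewrite (le_trans (fM x h))// expr2 mulrA ler_wpM2r//.
  rewrite (@le_trans _ _ (`|M| * `|h|))//; first by rewrite ler_wpM2r// ler_norm.
  by rewrite ler_piMr.
apply: (@le_trans _ _ (2 * M0)).
  by rewrite (le_trans (ler_normB _ _))// mulr_natl mulr2n lerD.
rewrite -[leLHS]mulr1 ler_pM//; first by rewrite mulr_ge0.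
  by rewrite lerDr addr_ge0.
exact: ltW.
Qed.

Lemma taylorM k f g : taylor k f -> taylor k g -> taylor k (fun x => f x * g x).
Proof.
elim: k f g => [|k IH] f g.
  move=> [[Mf fM] _] [[Mg gM] _]; split => //; exists (Mf * Mg) => x.
  by rewrite normrM ler_pM.
move=> tf tg; have [Mf Mf0 fM] := taylor_bounded tf; have [Mg Mg0 gM] := taylor_bounded tg.
split; first by exists (Mf * Mg) => x; rewrite normrM ler_pM.
have [_ [f' [kf' [Tf fT]]]] := tf; have [_ [g' [kg' [Tg gT]]]] := tg.
exists (fun i x => f x * g' i x + f' i x * g x); split.
  by move=> i; exact: (taylorD (IH _ _ (taylorW tf) (kg' i)) (IH _ _ (kf' i) (taylorW tg))).
have [L L0 fL] := taylor_lipschitz (@taylor_le 1 k.+1 _ isT tf).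
have [G G0 gG] := @taylor_sum_coord g' k kg'.
exists (Mf * Tg + Tf * Mg + L * G) => x h.
(* Two remainders, and a product of an increment of [f] with the linear part of [g]; the latter is
   quadratic in [h] because [f] is Lipschitz. *)
rewrite (_ : _ - _ - _ = f (x + h) * (g (x + h) - g x - \sum_i h ord0 i * g' i x) +
   (f (x + h) - f x - \sum_i h ord0 i * f' i x) * g x +
   (f (x + h) - f x) * \sum_i h ord0 i * g' i x); last first.
  rewrite (eq_bigr (fun i => f x * (h ord0 i * g' i x) + g x * (h ord0 i * f' i x))); last first.
    by move=> i _; ring.
  by rewrite big_split/= -!mulr_sumr; ring.
rewrite (le_trans (ler_normD _ _))// [leRHS]mulrDl lerD//; last first.
  by rewrite normrM expr2 mulrACA ler_pM.
rewrite (le_trans (ler_normD _ _))// [leRHS]mulrDl lerD// normrM.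
  by rewrite -mulrA ler_pM.
by rewrite mulrAC ler_pM.
Qed.

Lemma taylorZ k (c : R) f : taylor k f -> taylor k (fun x => c * f x).
Proof. by move=> tf; apply: taylorM => //; exact: taylor_cst. Qed.

Lemma taylor_sum k (I : finType) (f : I -> Rn -> R) : (forall i, taylor k (f i)) ->
  taylor k (fun x => \sum_i f i x).
Proof.
move=> tf; elim: (index_enum I) => [|i s IH].
  by apply: (@taylor_ext _ (fun=> 0)); [move=> x; rewrite big_nil|exact: taylor_cst].
apply: (@taylor_ext _ (fun x => f i x + \sum_(j <- s) f j x)).
  by move=> x; rewrite big_cons.
exact: taylorD.
Qed.

Lemma taylor_prod k (I : finType) (f : I -> Rn -> R) : (forall i, taylor k (f i)) ->
  taylor k (fun x => \prod_i f i x).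
Proof.
move=> tf; elim: (index_enum I) => [|i s IH].
  by apply: (@taylor_ext _ (fun=> 1)); [move=> x; rewrite big_nil|exact: taylor_cst].
apply: (@taylor_ext _ (fun x => f i x * \prod_(j <- s) f j x)).
  by move=> x; rewrite big_cons.
exact: taylorM.
Qed.

Lemma lipschitz_continuous m (f : Rn -> 'rV[R]_m) (L : R) :
  (forall x h, `|f (x + h) - f x| <= L * `|h|) -> continuous f.
Proof.
move=> fL x; apply: (iffRL (@cvgrPdist_lt _ _ _ (nbhs x) _ f (f x))) => e e0.
apply/nbhs_ballP; exists (e / (`|L| + 1)); first by rewrite /= divr_gt0.
move=> y; rewrite -ball_normE /= distrC => xy; rewrite distrC.
have := fL x (y - x); rewrite [x + _]addrC subrK => /le_lt_trans; apply.
apply: (@le_lt_trans _ _ ((`|L| + 1) * `|y - x|)).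
  by rewrite ler_wpM2r// (le_trans (ler_norm _))// lerDl.
by rewrite mulrC -ltr_pdivlMr.
Qed.

Lemma lipschitz_continuousR f (L : R) :
  (forall x h, `|f (x + h) - f x| <= L * `|h|) -> continuous f.
Proof.
move=> fL x; apply: (iffRL (@cvgrPdist_lt _ _ _ (nbhs x) _ f (f x))) => e e0.
apply/nbhs_ballP; exists (e / (`|L| + 1)); first by rewrite /= divr_gt0.
move=> y; rewrite -ball_normE /= distrC => xy; rewrite distrC.
have := fL x (y - x); rewrite [x + _]addrC subrK => /le_lt_trans; apply.
apply: (@le_lt_trans _ _ ((`|L| + 1) * `|y - x|)).
  by rewrite ler_wpM2r// (le_trans (ler_norm _))// lerDl.
by rewrite mulrC -ltr_pdivlMr.
Qed.

Lemma taylor_continuous f : taylor 1 f -> continuous f.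
Proof. by move=> /taylor_lipschitz[L _ fL]; exact: lipschitz_continuousR fL. Qed.

Section VectorFields.
Variable f : Rn -> Rn.

Lemma taylor_differentiable (g : 'I_n -> 'I_n -> Rn -> R) :
  (forall j, exists M, forall x h,
    `|f (x + h) ord0 j - f x ord0 j - \sum_i h ord0 i * g j i x| <= M * `|h| ^+ 2) ->
  forall x, differentiable f x /\
    forall v, 'D_v f x = \row_j \sum_i v ord0 i * g j i x.
Proof.
move=> /choice[M fM] x.
pose J : 'M[R]_n := \matrix_(i, j) g j i x.
pose df : {linear Rn -> Rn} := mulmxr J.
have dfE v : df v = \row_j \sum_i v ord0 i * g j i x.
  apply/rowP => j; rewrite /df/= !mxE; apply: eq_bigr => i _; by rewrite mxE.
pose T := \sum_j `|M j|.
have T0 : 0 <= T by rewrite sumr_ge0.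
have dfc : continuous df.
  pose G := \sum_j \sum_i `|g j i x|.
  apply: (@lipschitz_continuous _ df G) => y h.
  rewrite linearD addrC addKr dfE; apply: norm_le_coord.
    by apply: mulr_ge0 => //; apply: sumr_ge0 => j _; exact: sumr_ge0.
  move=> j; rewrite mxE (le_trans (ler_norm_sum _ _ _))//.
  apply: (@le_trans _ _ ((\sum_i `|g j i x|) * `|h|)); last first.
    rewrite ler_wpM2r// /G [leRHS](bigD1 j)//= lerDl.
    by apply: sumr_ge0 => k _; exact: sumr_ge0.
  rewrite mulr_suml; apply: ler_sum => i _.
  by rewrite normrM mulrC ler_wpM2l// coord_le_norm.
have dxf : f \o shift x = cst (f x) + df +o_ (0 : Rn) id.
  apply/eqaddoP => e e0; apply/nbhs_ballP; exists (e / (T + 1)).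
    by rewrite /= divr_gt0// ltr_wpDl.
  move=> h; rewrite -ball_normE /= sub0r normrN => he.
  rewrite -[X in `|X|]/(f (h + x) - (f x + df h)).
  apply: (@le_trans _ _ (T * `|h| ^+ 2)).
    apply: norm_le_coord; first by rewrite mulr_ge0// exprn_ge0.
    move=> j; rewrite dfE !mxE opprD addrA [h + x]addrC (le_trans (fM j x h))//.
    rewrite ler_wpM2r ?exprn_ge0// (le_trans (ler_norm _))//.
    by rewrite /T (bigD1 j)//= lerDl sumr_ge0.
  rewrite expr2 mulrA ler_wpM2r//.
  apply: (@le_trans _ _ ((T + 1) * `|h|)); first by rewrite ler_wpM2r// lerDl.
  by rewrite mulrC -ler_pdivlMr ?ltr_wpDl// ltW.
have dE := diff_unique dfc dxf.
have df' : differentiable f x by apply/diff_locallyP; rewrite dE.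
by split => // v; rewrite deriveE// dE dfE.
Qed.

End VectorFields.

Lemma taylor_continuously_differentiable k (f : Rn -> Rn) :
  (forall j, taylor k.+1 (fun x => f x ord0 j)) -> continuously_differentiable k f.
Proof.
elim: k f => [|k IH] f tf.
  have [L HL] := choice (fun j => let: ex_intro2 M M0 H := taylor_lipschitz (tf j) in
     ex_intro (fun M => forall x h, `|f (x + h) ord0 j - f x ord0 j| <= M * `|h|) M H).
  apply: (@lipschitz_continuous _ f (\sum_j `|L j|)) => x h; apply: norm_le_coord.
    by rewrite mulr_ge0// sumr_ge0.
  move=> j; rewrite !mxE (le_trans (HL j x h))// ler_wpM2r//.
  by rewrite (le_trans (ler_norm _))// (bigD1 j)//= lerDl sumr_ge0.
have [g Hg] := choice (fun j => (tf j).2).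
have td := taylor_differentiable (fun j => (Hg j).2).
split; first by move=> x; have [] := td x.
move=> v; apply: IH => j.
apply: (@taylor_ext _ (fun x => \sum_i v ord0 i * g j i x)).
  by move=> x; rewrite (td x).2 mxE.
by apply: taylor_sum => i; apply: taylorZ; exact: (Hg j).1 i.
Qed.

Lemma taylor_smooth (f : Rn -> Rn) :
  (forall j k, taylor k (fun x => f x ord0 j)) -> smooth f.
Proof. by move=> tf k; exact: taylor_continuously_differentiable. Qed.

Lemma divergenceE (f : Rn -> Rn) x : differentiable f x ->
  divergence f x = \sum_i ('D_(e_ R i) f x) ord0 i.
Proof.
move=> df; rewrite /divergence /mxtrace; apply: eq_bigr => i _.
rewrite deriveEjacobian//; have -> : e_ R i = delta_mx 0 i by [].
by rewrite -rowE [RHS]mxE.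
Qed.

(** Backward differences, uniformly in [x], because these are what [transport] controls. *)
Lemma taylor_divergence (f : Rn -> Rn) : (forall j, taylor 2 (fun x => f x ord0 j)) ->
  taylor 1 (divergence f) /\
  exists M, forall x (h : R), 0 <= h ->
   `|h * divergence f x - \sum_i (f x ord0 i - f (x - h *: e_ R i) ord0 i)| <= M * h ^+ 2.
Proof.
move=> tf; have [g Hg] := choice (fun j => (tf j).2).
have td := taylor_differentiable (fun j => (Hg j).2).
have dE : divergence f = fun x => \sum_i g i i x.
  apply/funext => x; rewrite (divergenceE (td x).1); apply: eq_bigr => i _.
  rewrite (td x).2 mxE (bigD1 i)//= e_E eqxx mul1r big1 ?addr0// => j ji.
  by rewrite e_E (negbTE ji) mul0r.
split.
  rewrite dE; apply: taylor_sum => i.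
  exact: (Hg i).1 i.
have [M HM] := choice (fun j => (Hg j).2).
exists (\sum_i `|M i|) => x h h0; rewrite dE mulr_sumr -sumrB.
rewrite (le_trans (ler_norm_sum _ _ _))// mulr_suml; apply: ler_sum => i _.
have e1 : `|e_ R i| <= 1.
  by apply: norm_le_coord => // j; rewrite e_E; case: (_ == _); rewrite ?normr1 ?normr0.
have := HM i x (- (h *: e_ R i)).
rewrite (bigD1 i)//= big1 ?addr0; last first.
  by move=> j ji; rewrite !mxE eqxx (negbTE ji) mulr0 oppr0 mul0r.
rewrite !mxE !eqxx mulr1 normrN normrZ ger0_norm// => H.
rewrite (_ : _ - _ = f (x - h *: e_ R i) ord0 i - f x ord0 i - - h * g i i x); last by ring.
apply: (le_trans H); apply: (@le_trans _ _ (`|M i| * (h * `|e_ R i|) ^+ 2)).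
  by rewrite ler_wpM2r ?ler_norm// exprn_ge0// mulr_ge0.
rewrite ler_wpM2l// lerXn2r ?nnegrE ?mulr_ge0//.
by rewrite ler_piMr.
Qed.

End Taylor.

(** * Mollifiers and convolution *)

Section Flat.
Variable R : realType.
Implicit Types (t u s : R) (m k : nat).

(** The classical function that is flat at 0. The negative powers are included so that the linear
    span of the family is closed under differentiation, and one induction yields all orders. *)
Definition flat m t : R := if 0 < t then t^-1 ^+ m * expR (- t^-1) else 0.

(* The derivative of [flat m]. *)
Definition flat' m t : R := flat m.+2 t - m%:R * flat m.+1 t.

Lemma flat_pos m t : 0 < t -> flat m t = t^-1 ^+ m * expR (- t^-1).
Proof. by move=> t0; rewrite /flat t0. Qed.

Lemma flat_npos m t : t <= 0 -> flat m t = 0.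
Proof. by move=> t0; rewrite /flat ltNge t0. Qed.

Lemma flat_ge0 m t : 0 <= flat m t.
Proof.
have [t0|t0] := ltP 0 t; last by rewrite flat_npos.
by rewrite flat_pos// mulr_ge0 ?expR_ge0// exprn_ge0// invr_ge0 ltW.
Qed.

Lemma flat_gt0 m t : 0 < t -> 0 < flat m t.
Proof. by move=> t0; rewrite flat_pos// mulr_gt0 ?expR_gt0// exprn_gt0// invr_gt0. Qed.

(** With [s = t^-1], [expR s] is the [m]-th power of [expR (s / m)], which is at least [s / m]. *)
Lemma flat_le m t : flat m t <= m%:R ^+ m.
Proof.
have [t0|t0] := ltP 0 t; last by rewrite flat_npos// exprn_ge0.
rewrite flat_pos// expRN ler_pdivrMr ?expR_gt0//; set s := t^-1.
have s0 : 0 <= s by rewrite invr_ge0 ltW.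
case: m => [|m]; first by rewrite !expr0 mul1r -expR0 ler_expR.
have -> : s = m.+1%:R * (s / m.+1%:R) by rewrite mulrC divfK// pnatr_eq0.
rewrite expRM_natl -exprMn lerXn2r ?nnegrE ?mulr_ge0 ?divr_ge0 ?expR_ge0//.
rewrite ler_pM2l ?ltr0n//; apply: le_trans (expR_ge1Dx _).
by rewrite lerDr.
Qed.

Lemma flat_norm_le m t : `|flat m t| <= m%:R ^+ m.
Proof. by rewrite ger0_norm ?flat_ge0// flat_le. Qed.

Lemma flatS m t : flat m t = t * flat m.+1 t.
Proof.
have [t0|t0] := ltP 0 t; last by rewrite !flat_npos// mulr0.
by rewrite !flat_pos// exprS -mulrA mulVKf// gt_eqF.
Qed.

Lemma flat'_bounded m : exists2 M, 0 <= M & forall t, `|flat' m t| <= M.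
Proof.
exists (m.+2%:R ^+ m.+2 + m%:R * m.+1%:R ^+ m.+1).
  by apply: addr_ge0; [exact: exprn_ge0|apply: mulr_ge0 => //; exact: exprn_ge0].
move=> t; rewrite (le_trans (ler_normB _ _))// lerD ?flat_norm_le//.
by rewrite normrM ger0_norm// ler_wpM2l// flat_norm_le.
Qed.

Lemma flat'S m t : exists2 M, 0 <= M & forall t, `|flat' m t| <= M * `|t|.
Proof.
exists (m.+3%:R ^+ m.+3 + m%:R * m.+2%:R ^+ m.+2).
  by apply: addr_ge0; [exact: exprn_ge0|apply: mulr_ge0 => //; exact: exprn_ge0].
move=> u; rewrite /flat' (flatS m.+2) (flatS m.+1).
rewrite (_ : _ - _ = (flat m.+3 u - m%:R * flat m.+2 u) * u); last by ring.
rewrite normrM ler_wpM2r// (le_trans (ler_normB _ _))// lerD ?flat_norm_le//.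
by rewrite normrM ger0_norm// ler_wpM2l// flat_norm_le.
Qed.

Lemma is_derive_flat m t : 0 < t ->
  is_derive t 1 (fun u : R => u^-1 ^+ m * expR (- u^-1)) (flat' m t).
Proof.
move=> t0; have tn0 : t != 0 by rewrite gt_eqF.
have d1 : is_derive t 1 (fun u : R => u^-1) (- t ^- 2).
  by apply: (is_derive_eq (@is_deriveV R id t 1 1 tn0 (is_derive_id _ _))); rewrite /GRing.scale/= mulr1.
have d2 : is_derive t 1 (fun u : R => expR (- u^-1)) (expR (- t^-1) * (- - t ^- 2)).
  have d1N : is_derive t 1 (fun u : R => - u^-1) (- - t ^- 2) by exact: is_deriveN.
  exact: (@is_derive1_comp _ expR (fun u => - u^-1) t _ _ (is_derive_expR _) d1N).
have d3 := is_deriveX m d1.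
rewrite (_ : (fun u : R => _) = ((fun u : R => u^-1) ^+ m * (fun u : R => expR (- u^-1)))); last first.
  by apply/funext => u; rewrite fctE exprfctE.
apply: (is_derive_eq (is_deriveM d3 d2)).
rewrite /flat' !flat_pos// /GRing.scale/= exprfctE; case: m d3 => [|m] _.
  by rewrite !expr0 !mul0r mulr0 addr0 subr0 mul1r opprK mulrC exprVn.
by rewrite -exprVn /= !exprS; ring.
Qed.

Lemma flat_MVT m t u : 0 < t -> 0 < u -> exists c,
  [/\ 0 < c, `|c - t| <= `|u - t| & flat m u - flat m t = flat' m c * (u - t)].
Proof.
move=> t0 u0.
have H a b : 0 < a -> a <= b -> exists c,
    [/\ a <= c, c <= b & flat m b - flat m a = flat' m c * (b - a)].
  move=> a0 ab; have b0 := lt_le_trans a0 ab.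
  have [||c] := @MVT_segment R (fun u : R => u^-1 ^+ m * expR (- u^-1)) (flat' m) a b ab.
  - by move=> x; rewrite in_itv/= => /andP[ax _]; exact: is_derive_flat (lt_trans a0 ax).
  - apply: derivable_within_continuous => x; rewrite in_itv/= => /andP[ax _].
    by have [] := @is_derive_flat m x (lt_le_trans a0 ax).
  - rewrite in_itv/= => /andP[ac cb] E; exists c; split => //.
    by rewrite -E !flat_pos.
have [tu|ut] := leP t u.
  have [c [tc cu E]] := H t u t0 tu; exists c; split => //.
    exact: lt_le_trans tc.
  by rewrite !ger0_norm ?subr_ge0// lerD2r.
have [c [uc ct E]] := H u t u0 (ltW ut); exists c; split.
- exact: lt_le_trans uc.
- by rewrite distrC [leRHS]distrC !ger0_norm ?subr_ge0 ?(ltW ut)// lerD2l lerN2.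
- by rewrite -opprB E -mulrN opprB.
Qed.

Lemma flat_lipschitz m : exists2 L, 0 <= L & forall t u, `|flat m u - flat m t| <= L * `|u - t|.
Proof.
have [M M0 fM] := flat'_bounded m.
pose N : R := m.+1%:R ^+ m.+1.
have N0 : 0 <= N by exact: exprn_ge0.
have H t u : 0 < u -> t <= 0 -> `|flat m u - flat m t| <= N * `|u - t|.
  move=> u0 t0; rewrite (flat_npos _ t0) subr0 flatS normrM mulrC.
  apply: ler_pM => //; first exact: flat_norm_le.
  by rewrite (gtr0_norm u0) ger0_norm ?subr_ge0 ?(le_trans t0 (ltW u0))// lerDl oppr_ge0.
exists (M + N); first exact: addr_ge0.
move=> t u; have [t0|t0] := ltP 0 t; have [u0|u0] := ltP 0 u.
- have [c [_ _ ->]] := flat_MVT m t0 u0.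
  by rewrite normrM ler_wpM2r// (le_trans (fM c))// lerDl.
- rewrite distrC [`|u - t|]distrC (le_trans (H u t t0 u0))//.
  by rewrite ler_wpM2r// lerDr.
- by rewrite (le_trans (H t u u0 t0))// ler_wpM2r// lerDr.
- by rewrite !flat_npos// subrr normr0 mulr_ge0// addr_ge0.
Qed.

(** On the positive side this follows from the mean value theorem and the Lipschitz bound for
    [flat']. When [t] and [t + s] lie on different sides of 0, both are at most [|s|] in absolute
    value and the flatness at 0 makes every term quadratic. *)
Lemma flat_taylor m : exists M, forall t s,
  `|flat m (t + s) - flat m t - s * flat' m t| <= M * s ^+ 2.
Proof.
have [L1 L10 lip1] := flat_lipschitz m.+1.
have [L2 L20 lip2] := flat_lipschitz m.+2.
pose L := L2 + m%:R * L1.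
have L0 : 0 <= L by apply: addr_ge0 => //; exact: mulr_ge0.
have lip' t u : `|flat' m u - flat' m t| <= L * `|u - t|.
  rewrite (_ : _ - _ = (flat m.+2 u - flat m.+2 t) - m%:R * (flat m.+1 u - flat m.+1 t)); last first.
    by rewrite /flat'; ring.
  rewrite (le_trans (ler_normB _ _))// mulrDl lerD// normrM ger0_norm// -mulrA ler_wpM2l//.
have [N N0 fN] := flat'S m 0.
pose P : R := m.+2%:R ^+ m.+2.
have P0 : 0 <= P by exact: exprn_ge0.
have sq t s : `|t| <= `|s| -> `|flat m t| <= P * s ^+ 2.
  move=> ts; rewrite flatS flatS mulrA normrM mulrC ler_pM ?flat_norm_le//.
  by rewrite normrM -(@real_normK _ s) ?num_real// expr2 ler_pM.
exists (L + P + N) => t s.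
have [t0|t0] := ltP 0 t; have [u0|u0] := ltP 0 (t + s).
- have [c [_ cs ->]] := flat_MVT m t0 u0.
  rewrite addrAC subrr add0r in cs *; rewrite [s * _]mulrC -mulrBl normrM.
  apply: (@le_trans _ _ (L * `|s| * `|s|)).
    by rewrite ler_wpM2r// (le_trans (lip' t c))// ler_wpM2l.
  rewrite -mulrA -expr2 real_normK ?num_real// ler_wpM2r ?sqr_ge0//.
  by rewrite -addrA lerDl addr_ge0.
- have ts : `|t| <= `|s|.
    rewrite gtr0_norm// -normrN (le_trans _ (ler_norm _))//; lra.
  rewrite (flat_npos _ u0) sub0r -opprD normrN (le_trans (ler_normD _ _))//.
  apply: (@le_trans _ _ ((P + N) * s ^+ 2)).
    rewrite mulrDl lerD//; first exact: sq.
    rewrite normrM mulrC -(@real_normK _ s) ?num_real// expr2 mulrA ler_wpM2r//.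
    by rewrite (le_trans (fN t))// ler_wpM2l.
  by rewrite ler_wpM2r ?sqr_ge0// -addrA lerDr.
- rewrite (flat_npos _ t0) /flat' !(flat_npos _ t0) mulr0 subrr mulr0 !subr0.
  have h : `|flat m (t + s)| <= P * s ^+ 2.
    apply: sq; rewrite gtr0_norm// (le_trans _ (ler_norm _))//; lra.
  by rewrite (le_trans h)// ler_wpM2r ?sqr_ge0//; lra.
- rewrite !(flat_npos _ u0) !(flat_npos _ t0) /flat' !(flat_npos _ t0) mulr0 subrr mulr0 !subr0 normr0.
  by apply: mulr_ge0; [apply: addr_ge0 => //; exact: addr_ge0|exact: sqr_ge0].
Qed.

End Flat.

Section Mollifier.
Variables (R : realType) (n : nat).
Local Notation Rn := 'rV[R]_n.
Local Notation mu := (borel_lebesgue R n).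

Lemma taylor_flat k m (i : 'I_n) (a c : R) : taylor k (fun x : Rn => flat m (a + c * x ord0 i)).
Proof.
elim: k m => [|k IH] m; (split; first by exists (m%:R ^+ m) => x; exact: flat_norm_le) => //.
exists (fun j x => (if j == i then c else 0) *
  (flat m.+2 (a + c * x ord0 i) + (- m%:R) * flat m.+1 (a + c * x ord0 i))); split.
  by move=> j; apply: taylorZ; apply: taylorD; [exact: IH|apply: taylorZ; exact: IH].
have [M HM] := flat_taylor R m; exists (`|M| * c ^+ 2) => x h.
rewrite (bigD1 i)//= eqxx big1 ?addr0; last by move=> j /negbTE ->; rewrite mul0r mulr0.
have := HM (a + c * x ord0 i) (c * h ord0 i).
have -> : a + c * (x + h) ord0 i = a + c * x ord0 i + c * h ord0 i.
  by rewrite mxE mulrDr addrA.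
have -> : h ord0 i * (c * (flat m.+2 (a + c * x ord0 i) + - m%:R * flat m.+1 (a + c * x ord0 i))) =
    c * h ord0 i * flat' m (a + c * x ord0 i) by rewrite /flat'; ring.
move=> /le_trans; apply.
apply: (@le_trans _ _ (`|M| * (c * h ord0 i) ^+ 2)).
  by rewrite ler_wpM2r ?sqr_ge0 ?ler_norm.
rewrite exprMn -mulrA ler_wpM2l// ler_wpM2l ?sqr_ge0//.
by rewrite -(@real_normK _ (h ord0 i)) ?num_real// lerXn2r ?nnegrE// coord_le_norm.
Qed.

(** Positive exactly where all coordinates lie in []-eta, 0[]: mollifying at [x] uses only points
    below [x]. The affine arguments are written in the form of [taylor_flat]. *)
Definition bump (eta : R) (x : Rn) : R :=
  \prod_i (flat 0 (0 + -1 * x ord0 i) * flat 0 (eta + 1 * x ord0 i)).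

Lemma taylor_bump k eta : taylor k (bump eta).
Proof. by apply: taylor_prod => i; apply: taylorM; exact: taylor_flat. Qed.

Lemma bump_ge0 eta x : 0 <= bump eta x.
Proof. by apply: prodr_ge0 => i _; rewrite mulr_ge0 ?flat_ge0. Qed.

Lemma bump_gt0 eta (x : Rn) : (forall i, - eta < x ord0 i < 0) -> 0 < bump eta x.
Proof.
move=> xe; apply: prodr_gt0 => i _; have /andP[x1 x2] := xe i.
by rewrite mulr_gt0// flat_gt0//; lra.
Qed.

Lemma bump_supp eta (x : Rn) : bump eta x != 0 -> forall i, - eta < x ord0 i < 0.
Proof.
move=> /prodf_neq0 H i; have := H i isT; rewrite mulf_eq0 negb_or => /andP[h1 h2].
apply/andP; split; rewrite ltNge; apply/negP => h.
  by move: h2; rewrite flat_npos ?eqxx//; lra.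
by move: h1; rewrite flat_npos ?eqxx//; lra.
Qed.

Lemma bump_integrable eta : (mu).-integrable setT (EFin \o (bump eta : borel_rV R n -> R)).
Proof.
have [M M0 bM] := taylor_bounded (taylor_bump 0 eta).
apply: (@integrable_bounded_support R n _ M `|eta|) => //.
  exact: (continuous_measurable_rV (taylor_continuous (taylor_bump 1 eta))).
move=> x ex; apply/eqP; apply/negPn/negP => /bump_supp H.
move: ex; rewrite ltNge; apply/negP; rewrite negbK; apply: norm_le_coord => // i.
have /andP[x1 x2] := H i; rewrite ler_norml.
by rewrite (le_trans _ (ltW x1)) ?lerN2 ?ler_norm//= (le_trans (ltW x2)).
Qed.

Lemma bump_integral_gt0 eta : 0 < eta -> 0 < \int[mu]_x (bump eta x).
Proof.
move=> e0; pose x0 : Rn := const_mx (- (eta / 2)).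
have b0 : 0 < bump eta x0.
  by apply: bump_gt0 => i; rewrite mxE; apply/andP; split; lra.
pose O := [set x : Rn | bump eta x0 / 2 < bump eta x].
have oO : open O.
  apply: (@open_comp Rn R (bump eta) [set u | bump eta x0 / 2 < u]) => [z _|].
    exact: (taylor_continuous (taylor_bump 1 eta)).
  exact: open_gt.
have mO : measurable (O : set (borel_rV R n)) by exact: open_measurable_rV.
have Opos : (0 < mu O)%E.
  apply: open_measure_gt0 => //; exists x0; rewrite /O/=.
  by rewrite ltr_pdivrMr// ltr_pMr// ltr1n.
have Ofin : (mu O < +oo)%E.
  apply: (@bounded_borel_finite _ _ _ `|eta|) => // x Ox.
  apply: norm_le_coord => // i.
  have /bump_supp/(_ i)/andP[x1 x2] : bump eta x != 0.
    by rewrite gt_eqF// (lt_trans _ Ox)// divr_gt0.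
  rewrite ler_norml.
  by rewrite (le_trans _ (ltW x1)) ?lerN2 ?ler_norm//= (le_trans (ltW x2)).
apply: (@lt_le_trans _ _ (\int[mu]_x (bump eta x0 / 2 * \1_O x))).
  rewrite RintegralZl//; last exact: integrable_indic_finite.
  rewrite mulr_gt0 ?divr_gt0// /Rintegral integral_indic// setIT.
  by rewrite fine_gt0// Opos.
apply: le_Rintegral => //.
- rewrite (_ : EFin \o _ = (fun x => (bump eta x0 / 2)%:E * (\1_O x)%:E)%E)//.
  by apply: integrableZl => //; exact: integrable_indic_finite.
- exact: bump_integrable.
- move=> x _; rewrite indicE; have [xO|xO] := boolP (x \in O).
    by rewrite mulr1; rewrite inE in xO; exact: ltW.
  by rewrite mulr0 bump_ge0.
Qed.

Lemma mollifier_exists eta : 0 < eta -> exists sg : Rn -> R,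
  [/\ forall k, taylor k sg, forall x, 0 <= sg x,
      forall x, sg x != 0 -> forall i, - eta < x ord0 i < 0 &
      \int[mu]_x (sg x) = 1].
Proof.
move=> e0; have I0 := bump_integral_gt0 e0.
exists (fun x => (\int[mu]_x (bump eta x))^-1 * bump eta x); split.
- by move=> k; apply: taylorZ; exact: taylor_bump.
- by move=> x; rewrite mulr_ge0 ?bump_ge0// invr_ge0 ltW.
- by move=> x; rewrite mulf_eq0 negb_or => /andP[_]; exact: bump_supp.
- rewrite RintegralZl//; last exact: bump_integrable.
  by rewrite mulVf// gt_eqF.
Qed.

Section Convolution.
Variables (w : Rn -> R) (M r : R).
Hypothesis mw : measurable_fun setT (w : borel_rV R n -> R).
Hypothesis wM : forall x, `|w x| <= M.
Hypothesis wr : forall x, r < `|x| -> w x = 0.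

(** Convolution with the reflected kernel, that is, the average of [w (x + y)] with weight [sg y].
    In this form [x] occurs only in the smooth factor. *)
Definition conv (w sg : Rn -> R) (x : Rn) : R := \int[mu]_z (w z * sg (z - x)).

Lemma measurable_sg_shift (sg : Rn -> R) x : continuous sg ->
  measurable_fun setT ((fun z => sg (z - x)) : borel_rV R n -> R).
Proof.
move=> csg; rewrite (_ : (fun z => _) = (fun z => sg (- x + z))).
  by apply: (@measurable_fun_comp_shift R n (- x) sg); exact: continuous_measurable_rV.
by apply/funext => z; rewrite addrC.
Qed.

Lemma conv_integrable (sg : Rn -> R) x : taylor 1 sg ->
  mu.-integrable setT (EFin \o ((fun z => w z * sg (z - x)) : borel_rV R n -> R)).
Proof.
move=> tsg; have [N N0 sN] := taylor_bounded tsg.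
apply: (@integrable_bounded_support R n _ (M * N) r).
- apply: measurable_funM => //; apply: measurable_sg_shift; exact: taylor_continuous.
- by move=> z; rewrite normrM ler_pM.
- by move=> z /wr ->; rewrite mul0r.
Qed.

Lemma w_integrable : mu.-integrable setT (EFin \o ((fun z => `|w z|) : borel_rV R n -> R)).
Proof.
apply: (@integrable_bounded_support R n _ M r).
- exact: measurableT_comp.
- by move=> z; rewrite normr_id.
- by move=> z /wr ->; rewrite normr0.
Qed.

Lemma conv_bound (g : Rn -> R) (c : R) : measurable_fun setT (g : borel_rV R n -> R) ->
  0 <= c -> (forall z, `|g z| <= c) -> `|\int[mu]_z (w z * g z)| <= c * \int[mu]_z `|w z|.
Proof.
move=> mg c0 gc.
have ig : mu.-integrable setT (EFin \o ((fun z => w z * g z) : borel_rV R n -> R)).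
  apply: (@integrable_bounded_support R n _ (M * c) r).
  - exact: measurable_funM.
  - by move=> z; rewrite normrM ler_pM.
  - by move=> z /wr ->; rewrite mul0r.
apply: le_trans (le_normr_Rintegral _ ig) _ => //.
rewrite -RintegralZl//; last exact: w_integrable.
apply: le_Rintegral => //.
- apply: (@integrable_bounded_support R n _ (M * c) r).
  + by apply: measurableT_comp => //; exact: measurable_funM.
  + by move=> z; rewrite normr_id normrM ler_pM.
  + by move=> z /wr ->; rewrite mul0r normr0.
- rewrite (_ : EFin \o _ = (fun x => c%:E * (`|w x|)%:E)%E)//.
  by apply: integrableZl => //; exact: w_integrable.
- by move=> z _; rewrite normrM mulrC ler_wpM2r.
Qed.

Lemma Rintegral_sum (f : 'I_n -> Rn -> R) :
  (forall i, mu.-integrable setT (EFin \o (f i : borel_rV R n -> R))) ->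
  mu.-integrable setT (EFin \o ((fun z => \sum_i f i z) : borel_rV R n -> R)) /\
  \int[mu]_z (\sum_i f i z) = \sum_i \int[mu]_z (f i z).
Proof.
move=> fi; elim: (index_enum _) => [|i s [IH1 IH2]].
  rewrite big_nil; have -> : (fun z : Rn => \sum_(i <- [::]) f i z) = cst 0.
    by apply/funext => z; rewrite big_nil.
  split; first exact: integrable0.
  by rewrite /Rintegral integral0_eq.
have -> : (fun z : Rn => \sum_(j <- i :: s) f j z) = (fun z => f i z + \sum_(j <- s) f j z).
  by apply/funext => z; rewrite big_cons.
split.
  exact: (integrableD measurableT (fi i) IH1).
by rewrite RintegralD// IH2 big_cons.
Qed.

(** The expansion of [sg] at [z - x] with increment [- h] is integrated against [w]; its remainder
    is uniform, so it costs a factor [\int |w|]. One order is given up because the coefficients must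
    be measurable, which is drawn from the continuity in [taylor 1]. *)
Lemma conv_taylor k (sg : Rn -> R) : taylor k.+1 sg -> taylor k (conv w sg).
Proof.
elim: k sg => [|k IH] sg tsg.
  split => //; have [N N0 sN] := taylor_bounded tsg.
  exists (N * \int[mu]_z `|w z|) => x; apply: conv_bound => //.
  exact: measurable_sg_shift (taylor_continuous tsg).
have tsg1 : taylor 1 sg by exact: taylor_le tsg.
split; first by have [N _ HN] := taylor_bounded (IH sg (taylorW tsg)); exists N.
have [_ [g [kg [T HT]]]] := tsg.
exists (fun i x => - conv w (g i) x); split.
  move=> i; apply: (@taylor_ext _ _ _ (fun x => -1 * conv w (g i) x)).
    by move=> x; rewrite mulN1r.
  by apply: taylorZ; exact: (IH _ (kg i)).
have tg i : taylor 1 (g i) by exact: (@taylor_le _ _ 1 k.+1 _ _ (kg i)).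
exists (`|T| * \int[mu]_z `|w z|) => x h.
have [si sE] := @Rintegral_sum (fun i z => h ord0 i * (w z * g i (z - x)))
  (fun i => integrableZl measurableT (h ord0 i) (conv_integrable x (tg i))).
have -> : conv w sg (x + h) - conv w sg x - \sum_i h ord0 i * - conv w (g i) x =
    \int[mu]_z (w z * (sg (z - (x + h)) - sg (z - x) - \sum_i (- h) ord0 i * g i (z - x))).
  have -> : \sum_i h ord0 i * - conv w (g i) x = - \int[mu]_z (\sum_i h ord0 i * (w z * g i (z - x))).
    rewrite sE -sumrN; apply: eq_bigr => i _.
    rewrite RintegralZl//; last exact: conv_integrable.
    by rewrite mulrN.
  rewrite opprK /conv -RintegralB//; [|exact: conv_integrable..].
  rewrite -RintegralD//.
    apply: eq_Rintegral => z _ /=; rewrite !mulrBr; congr (_ + _).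
    rewrite mulr_sumr -sumrN; apply: eq_bigr => i _; rewrite mxE; ring.
  exact: (integrableB measurableT (conv_integrable (x + h) tsg1) (conv_integrable x tsg1)).
rewrite mulrAC; apply: conv_bound.
- apply: measurable_funB; first by apply: measurable_funB; exact: measurable_sg_shift (taylor_continuous tsg1).
  apply: measurable_sum => i; apply: measurable_funM => //.
  exact: measurable_sg_shift (taylor_continuous (tg i)).
- by rewrite mulr_ge0 ?sqr_ge0.
- move=> z; have := HT (z - x) (- h); rewrite normrN opprD addrA => /le_trans; apply.
  by rewrite ler_wpM2r ?sqr_ge0 ?ler_norm.
Qed.

Lemma convE (sg : Rn -> R) x : taylor 1 sg -> (exists s, forall y, s < `|y| -> sg y = 0) ->
  conv w sg x = \int[mu]_y (w (x + y) * sg y) /\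
  mu.-integrable setT (EFin \o ((fun y => w (x + y) * sg y) : borel_rV R n -> R)).
Proof.
move=> tsg [s ss]; have [N N0 sN] := taylor_bounded tsg.
have csg := taylor_continuous tsg.
have ii : mu.-integrable setT (EFin \o ((fun y => w (x + y) * sg y) : borel_rV R n -> R)).
  apply: (@integrable_bounded_support R n _ (M * N) s).
  - apply: measurable_funM; first exact: (@measurable_fun_comp_shift R n x w).
    exact: continuous_measurable_rV.
  - by move=> z; rewrite normrM ler_pM.
  - by move=> z /ss ->; rewrite mulr0.
split => //; rewrite /conv -(@integral_shift R n x (fun z => w z * sg (z - x))).
- by apply: eq_Rintegral => y _; rewrite addrAC subrr add0r.
- by apply: measurable_funM => //; exact: measurable_sg_shift.
- move: ii; congr (_.-integrable _ _); apply/funext => y /=.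
  by rewrite addrAC subrr add0r.
Qed.

End Convolution.
End Mollifier.

(** * The test field of the lower bound *)

Section TestField.
Variables (R : realType) (n : nat).
Local Notation Rn := 'rV[R]_n.
Local Notation mu := (borel_lebesgue R n).
Variables (D K : set Rn) (q0 : Rn) (s rho eta : R).
Hypothesis clD : closed D.
Hypothesis coneK : convex_cone K.
Hypothesis DK : forall x k, D x -> K k -> D (x + k).
Hypothesis q0K : forall y, `|y| <= 1 -> K (q0 + y).
Hypotheses (s0 : 0 < s) (rho1 : 1 <= rho) (eta0 : 0 < eta).
Hypotheses (eta_s : eta <= s / 8) (eta1 : eta <= 1 / 8).

Variable sg : Rn -> R.
Hypothesis sg_taylor : forall k, taylor k sg.
Hypothesis sg_ge0 : forall x, 0 <= sg x.
Hypothesis sg_supp : forall x, sg x != 0 -> forall i, - eta < x ord0 i < 0.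
Hypothesis sg_int : \int[mu]_x (sg x) = 1.

Let rho0 : 0 < rho. Proof. exact: lt_le_trans rho1. Qed.

(** The translate of [D] by [t *: q0]. The divergence will be large at level [s], the cutoff lives
    at level [s / 2], the support of the field at [s / 4], and level 0 is [D]. *)
Definition shifted t : set Rn := [set x | D (x - t *: q0)].

Lemma shifted_closed t : closed (shifted t).
Proof.
apply: (@preimage_closed Rn Rn (fun x => x - t *: q0) D) => // x _.
exact: (@cvgB _ _ _ (nbhs x) _ id (cst (t *: q0)) x _ (@cvg_id _ (nbhs x)) (cvg_cst _)).
Qed.

(** Lowering the level by [u] leaves [u *: q0], which absorbs any displacement of norm at most [u],
    as [K] contains the unit cube around [q0]. *)
Lemma shifted_add t u (x z : Rn) : 0 < u -> shifted (t + u) x -> `|z| <= u -> shifted t (x + z).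
Proof.
move=> u0 Dx zu; rewrite /shifted/=.
rewrite (_ : _ - _ = (x - (t + u) *: q0) + u *: (q0 + u^-1 *: z)); last first.
  rewrite scalerDr scalerA divff ?gt_eqF// scale1r scalerDl.
  by apply/rowP => i; rewrite !mxE; ring.
apply: DK => //; have [_ _ Ks _] := coneK; apply: Ks; first exact: ltW.
by apply: q0K; rewrite normrZ gtr0_norm ?invr_gt0// mulrC ler_pdivrMr ?mul1r.
Qed.

Lemma shifted_cone t x k : shifted t x -> K k -> shifted t (x + k).
Proof. by move=> Dx Kk; rewrite /shifted/= addrAC; exact: DK. Qed.

(** The second factor is a ramp from 1 on [|x| <= rho] to 0 at [2 * rho], of slope [1 / rho]. *)
Definition cutoff (x : Rn) : R := \1_(shifted (s / 2)) x * clamp 0 1 ((2 * rho - `|x|) / rho).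

Lemma clamp01 (t : R) : 0 <= clamp 0 1 t <= 1.
Proof. by rewrite clamp_ge clamp_le_hi. Qed.

Lemma clamp_lip (a b : R) : 0 <= a -> forall c d : R, clamp c d (b - a) >= clamp c d b - a.
Proof.
move=> a0 c d; rewrite lerBlDr /clamp ge_max; apply/andP; split.
  by rewrite -[leLHS]addr0 lerD// le_max lexx.
rewrite -lerBlDr le_max; apply/orP; right.
rewrite le_min lerBlDr ge_min lerDl a0 /=.
by rewrite lerB// ge_min lexx orbT.
Qed.

Lemma cutoff_ge0 x : 0 <= cutoff x.
Proof. by rewrite mulr_ge0//; case/andP: (clamp01 ((2 * rho - `|x|) / rho)). Qed.

Lemma cutoff_le1 x : cutoff x <= 1.
Proof.
have /andP[c0 c1] := clamp01 ((2 * rho - `|x|) / rho).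
by rewrite -[leRHS]mulr1 ler_pM// indicE; case: (_ \in _).
Qed.

Lemma cutoff_norm x : `|cutoff x| <= 1.
Proof. by rewrite ger0_norm ?cutoff_ge0// cutoff_le1. Qed.

Lemma cutoff_supp x : cutoff x != 0 -> shifted (s / 2) x /\ `|x| <= 2 * rho.
Proof.
rewrite mulf_eq0 negb_or indicE => /andP[h1 h2]; split.
  by move: h1; case: (boolP (x \in _)); rewrite ?inE//= eqxx.
rewrite leNgt; apply/negP => xr; move: h2.
rewrite /clamp max_l ?eqxx// ge_min; apply/orP; right.
by rewrite ler_pdivrMr// mul0r subr_le0 ltW.
Qed.

Lemma cutoff_eq1 x : shifted (s / 2) x -> `|x| <= rho -> cutoff x = 1.
Proof.
move=> Ax xr; rewrite /cutoff indicE mem_set// mul1r /clamp min_l ?max_r//.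
by rewrite ler_pdivlMr//; lra.
Qed.

Lemma norm_continuous_rV : continuous (fun x : Rn => `|x|).
Proof. by apply: (@lipschitz_continuousR _ _ _ 1) => x h; rewrite mul1r (le_trans (ler_dist_dist _ _))// addrC addKr. Qed.

Lemma measurable_cutoff : measurable_fun setT (cutoff : borel_rV R n -> R).
Proof.
apply: measurable_funM.
  apply: measurable_indic; apply: closed_measurable_rV; exact: shifted_closed.
apply: measurable_maxr; first exact: measurable_cst.
apply: measurable_minr; last first.
  apply: measurable_funM; last exact: measurable_cst.
  apply: measurable_funB; first exact: measurable_cst.
  exact: (continuous_measurable_rV norm_continuous_rV).
exact: measurable_cst.
Qed.

(* The only decrease along [K] comes from the truncation at infinity, hence the
   error [h / rho]. *)
Lemma cutoff_mono x k (h : R) : K k -> enorm k <= 1 -> 0 <= h ->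
  cutoff x - h / rho <= cutoff (x + h *: k).
Proof.
move=> Kk k1 h0; have hr : 0 <= h / rho by rewrite divr_ge0// ltW.
have [Ax|Ax] := pselect (shifted (s / 2) x); last first.
  rewrite {1}/cutoff indicE memNset// mul0r sub0r.
  by rewrite (le_trans _ (cutoff_ge0 _))// oppr_le0.
have Axk : shifted (s / 2) (x + h *: k).
  by apply: shifted_cone => //; have [_ _ Ks _] := coneK; exact: Ks.
rewrite /cutoff !indicE !mem_set// !mul1r.
apply: le_trans (clamp_lip _ hr _ _) _; apply: clamp_le.
rewrite -mulrBl ler_pM2r ?invr_gt0// -addrA lerD2l -opprD lerN2.
rewrite (le_trans (ler_normD _ _))// lerD2l normrZ ger0_norm// ler_piMr//.
exact: le_trans (norm_le_enorm _) k1.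
Qed.

Lemma sg_bounded_supp : exists r, forall y, r < `|y| -> sg y = 0.
Proof.
exists eta => y ye; apply/eqP; apply/negPn/negP => /sg_supp H.
move: ye; rewrite ltNge => /negP; apply; apply: norm_le_coord; first exact: ltW.
by move=> i; have /andP[y1 y2] := H i; rewrite ler_norml (ltW y1)/= (le_trans (ltW y2))// ltW.
Qed.

Lemma sg_norm y : sg y != 0 -> `|y| <= eta.
Proof.
move=> /sg_supp H; apply: norm_le_coord; first exact: ltW.
by move=> i; have /andP[y1 y2] := H i; rewrite ler_norml (ltW y1)/= (le_trans (ltW y2))// ltW.
Qed.

Lemma sg_integrable : mu.-integrable setT (EFin \o (sg : borel_rV R n -> R)).
Proof.
have [M M0 bM] := taylor_bounded (sg_taylor 0).
have [r hr] := sg_bounded_supp.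
apply: (@integrable_bounded_support R n _ M r) => //.
exact: (continuous_measurable_rV (taylor_continuous (sg_taylor 1))).
Qed.

Section Conv.
Variables (w : Rn -> R) (M : R).
Hypothesis mw : measurable_fun setT (w : borel_rV R n -> R).
Hypothesis wM : forall x, `|w x| <= M.

Lemma conv_sgE x : conv w sg x = \int[mu]_y (w (x + y) * sg y) /\
  mu.-integrable setT (EFin \o ((fun y => w (x + y) * sg y) : borel_rV R n -> R)).
Proof. exact: (convE mw wM x (sg_taylor 1) sg_bounded_supp). Qed.

Lemma conv_sg_ge c x : (forall y, sg y != 0 -> c <= w (x + y)) -> c <= conv w sg x.
Proof.
move=> cw; have [-> ii] := conv_sgE x.
rewrite -[leLHS]mulr1 -sg_int -RintegralZl//; last exact: sg_integrable.
apply: le_Rintegral => //; first exact: (integrableZl measurableT c sg_integrable).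
move=> y _; have [/eqP ->|/cw h] := boolP (sg y == 0); first by rewrite !mulr0.
by rewrite ler_wpM2r.
Qed.

Lemma conv_sg_le c x : (forall y, sg y != 0 -> w (x + y) <= c) -> conv w sg x <= c.
Proof.
move=> cw; have [-> ii] := conv_sgE x.
rewrite -[leRHS]mulr1 -sg_int -RintegralZl//; last exact: sg_integrable.
apply: le_Rintegral => //; first exact: (integrableZl measurableT c sg_integrable).
move=> y _; have [/eqP ->|/cw h] := boolP (sg y == 0); first by rewrite !mulr0.
by rewrite ler_wpM2r.
Qed.

Lemma conv_sg_eq0 x : (forall y, sg y != 0 -> w (x + y) = 0) -> conv w sg x = 0.
Proof.
move=> w0; apply/eqP; rewrite eq_le conv_sg_le ?conv_sg_ge// => y /w0 ->//.
Qed.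

End Conv.

Lemma cutoff_zero x : 2 * rho < `|x| -> cutoff x = 0.
Proof.
by move=> xr; apply/eqP; apply/negPn/negP => /cutoff_supp[_]; rewrite leNgt xr.
Qed.

Definition phi := conv cutoff sg.

Lemma phi_taylor k : taylor k phi.
Proof. exact: (conv_taylor measurable_cutoff cutoff_norm cutoff_zero). Qed.

Let csg := conv_sgE measurable_cutoff cutoff_norm.

Lemma phi_ge0 x : 0 <= phi x.
Proof. by apply: (conv_sg_ge measurable_cutoff cutoff_norm) => y _; exact: cutoff_ge0. Qed.

Lemma phi_le1 x : phi x <= 1.
Proof. by apply: (conv_sg_le measurable_cutoff cutoff_norm) => y _; exact: cutoff_le1. Qed.

Lemma phi_supp x : phi x != 0 -> exists y, [/\ `|y| <= eta, shifted (s / 2) (x + y) & `|x + y| <= 2 * rho].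
Proof.
move=> p0; apply: contrapT => H; move/eqP : p0; apply.
apply: (conv_sg_eq0 measurable_cutoff cutoff_norm) => y /sg_norm ye.
apply/eqP; apply/negPn/negP => /cutoff_supp[A B]; apply: H.
by exists y.
Qed.

Lemma phi_eq1 x : (forall y, `|y| <= eta -> shifted (s / 2) (x + y) /\ `|x + y| <= rho) -> phi x = 1.
Proof.
move=> H; apply/eqP; rewrite eq_le phi_le1/=.
apply: (conv_sg_ge measurable_cutoff cutoff_norm) => y /sg_norm /H[A B].
by rewrite cutoff_eq1.
Qed.

Lemma phi_mono x k (h : R) : K k -> enorm k <= 1 -> 0 <= h ->
  phi x - h / rho <= phi (x + h *: k).
Proof.
move=> Kk k1 h0; rewrite /phi (csg x).1 (csg (x + h *: k)).1.
rewrite -[h / rho]mulr1 -sg_int -RintegralZl//; last exact: sg_integrable.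
rewrite -RintegralB//; [|exact: (csg x).2|exact: (integrableZl measurableT (h / rho) sg_integrable)].
apply: le_Rintegral => //; last 2 first.
- exact: (csg (x + h *: k)).2.
- by move=> y _; rewrite -mulrBl ler_wpM2r// addrAC cutoff_mono.
exact: (integrableB measurableT (csg x).2 (integrableZl measurableT (h / rho) sg_integrable)).
Qed.

(** [phi_mono] divided by [h], as [h] tends to 0. It will be applied to [k = T z]. *)
Lemma phi_deriv : exists (dphi : 'I_n -> Rn -> R) (M : R),
  [/\ 0 <= M, forall x h, `|phi (x + h) - phi x - \sum_i h ord0 i * dphi i x| <= M * `|h| ^+ 2 &
  forall x k, K k -> enorm k <= 1 -> - rho^-1 <= \sum_i k ord0 i * dphi i x].
Proof.
have [_ [g [_ [M HM]]]] := phi_taylor 1.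
have HM' x h : `|phi (x + h) - phi x - \sum_i h ord0 i * g i x| <= `|M| * `|h| ^+ 2.
  by rewrite (le_trans (HM x h))// ler_wpM2r ?sqr_ge0// ler_norm.
exists g, `|M|; split => // x k Kk k1.
(* So small that the quadratic remainder is at most [h * e]. *)
apply/ler_addgt0Pr => e e0; pose h := e / (`|M| + 1).
have h0 : 0 < h by rewrite divr_gt0// ltr_wpDl.
have := HM' x (h *: k); rewrite ler_norml => /andP[_].
rewrite (eq_bigr (fun i => h * (k ord0 i * g i x))); last by move=> i _; rewrite mxE mulrA.
rewrite -mulr_sumr normrZ gtr0_norm//; set S := \sum_i _.
have kn : `|k| <= 1 by exact: le_trans (norm_le_enorm _) k1.
have := phi_mono x Kk k1 (ltW h0).
have : `|M| * (h * `|k|) ^+ 2 <= h * e.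
  rewrite (_ : _ * _ ^+ 2 = h * (`|M| * h * `|k| ^+ 2)); last by ring.
  rewrite ler_pM2l//; apply: (@le_trans _ _ (`|M| * h)).
    by apply: ler_piMr; [apply: mulr_ge0 => //; exact: ltW|exact: exprn_ile1].
  by rewrite /h mulrA ler_pdivrMr ?ltr_wpDl// mulrC ler_pM2l// lerDl.
move=> A1 A2 A3; rewrite -(ler_pM2l h0) mulrN mulrDr; lra.
Qed.

Variables (kappa : R) (sE sL : seq (Rn * Rn)) (T : Rn -> Rn).
Hypothesis kappa0 : 0 <= kappa.
Hypothesis tT : transport kappa sE sL T.
Hypothesis sLK : forall x, closed_boxes sL x -> K x /\ enorm x <= 1.

Let TK x : K (T x). Proof. by have [_ L _ _] := tT; exact: (sLK (L x)).1. Qed.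

Let T1 x : enorm (T x) <= 1.
Proof. by have [_ L _ _] := tT; exact: (sLK (L x)).2. Qed.

Let Ti1 x i : `|T x ord0 i| <= 1.
Proof. exact: le_trans (coord_le_enorm _ _) (T1 x). Qed.

Definition prefield (i : 'I_n) (x : Rn) : R := phi x * T x ord0 i.

(* The cutoff [phi] vanishes off a translate of [D] by a multiple of [q0], an
   interior point of [K], which leaves room for the mollification inside [D]. *)
Definition transport_field (x : Rn) : Rn := \row_i conv (prefield i) sg x.

Lemma measurable_phi : measurable_fun setT (phi : borel_rV R n -> R).
Proof. exact: (continuous_measurable_rV (taylor_continuous (phi_taylor 1))). Qed.

Lemma measurable_prefield i : measurable_fun setT (prefield i : borel_rV R n -> R).
Proof. by apply: measurable_funM; [exact: measurable_phi|have [mT _ _ _] := tT; exact: mT]. Qed.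

Lemma prefield_norm i x : `|prefield i x| <= 1.
Proof.
by rewrite normrM mulr_ile1// ger0_norm ?phi_ge0// phi_le1.
Qed.

Lemma phi_norm_supp x : phi x != 0 -> `|x| <= 2 * rho + eta.
Proof.
move=> /phi_supp[y [ye _ xy]]; rewrite -[x](addrK y).
by rewrite (le_trans (ler_normB _ _))// lerD.
Qed.

Lemma prefield_zero i x : 2 * rho + eta < `|x| -> prefield i x = 0.
Proof.
move=> xr; have [/eqP p0|/phi_norm_supp] := boolP (phi x == 0).
  by rewrite /prefield p0 mul0r.
by rewrite leNgt xr.
Qed.

Let cE i x := conv_sgE (measurable_prefield i) (prefield_norm i) x.

Lemma field_taylor k j : taylor k (fun x => transport_field x ord0 j).
Proof.
apply: (@taylor_ext _ _ _ (conv (prefield j) sg)); first by move=> x; rewrite mxE.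
exact: (conv_taylor (measurable_prefield j) (prefield_norm j) (@prefield_zero j)).
Qed.

(** Jensen's inequality by duality: [enorm X ^+ 2] is the average of the scalar products of [X] with
    [phi *: T], each at most [enorm X]. *)
Lemma field_norm x : enorm (transport_field x) <= 1.
Proof.
set X := transport_field x; have [->|X0] := eqVneq (enorm X) 0; first exact: ler01.
have Xp : 0 < enorm X by rewrite lt0r X0 enorm_ge0.
rewrite -(ler_pM2l Xp) mulr1 -expr2 enorm_sqr.
have ii i : mu.-integrable setT (EFin \o ((fun y => X ord0 i * (prefield i (x + y) * sg y)) : borel_rV R n -> R)).
  exact: (integrableZl measurableT (X ord0 i) (cE i x).2).
have [si sumE] := Rintegral_sum ii.
have -> : \sum_i X ord0 i ^+ 2 = \int[mu]_y (\sum_i X ord0 i * (prefield i (x + y) * sg y)).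
  rewrite sumE; apply: eq_bigr => i _; rewrite RintegralZl//; last exact: (cE i x).2.
  by rewrite expr2 {2}/X mxE (cE i x).1.
rewrite -[leRHS]mulr1 -sg_int -RintegralZl//; last exact: sg_integrable.
apply: le_Rintegral => //; first exact: (integrableZl measurableT _ sg_integrable).
move=> y _; rewrite (eq_bigr (fun i => X ord0 i * prefield i (x + y) * sg y)); last first.
  by move=> i _; rewrite mulrA.
rewrite -mulr_suml ler_wpM2r//.
have := @cauchy_schwarz R n (fun i => X ord0 i * prefield i (x + y)) X (phi (x + y) *: T (x + y)).
have h i : X ord0 i * prefield i (x + y) <= `|X ord0 i| * `|(phi (x + y) *: T (x + y)) ord0 i|.
  by rewrite [(_ *: T _) _ _]mxE -normrM ler_norm.
move=> /(_ h) /le_trans; apply; rewrite ler_piMr ?enorm_ge0//.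
by rewrite enormZ ger0_norm ?phi_ge0// mulr_ile1 ?phi_ge0 ?enorm_ge0 ?phi_le1.
Qed.

Lemma field_supp x : transport_field x != 0 -> shifted (s / 4) x /\ `|x| <= 2 * rho + 1.
Proof.
move=> X0; apply: contrapT => H; move/eqP : X0; apply.
apply/rowP => i; rewrite !mxE.
apply: (conv_sg_eq0 (measurable_prefield i) (prefield_norm i)) => y /sg_norm ye.
have [/eqP p0|/phi_supp] := boolP (phi (x + y) == 0); first by rewrite /prefield p0 mul0r.
move=> [z [ze Az zr]]; exfalso; apply: H.
have xE : x = (x + y + z) + (- (y + z)) by rewrite -[x + y + z]addrA addrK.
(* One [eta] for the mollification of the field, one for that of the cutoff; together at most
   [s / 4]. *)
have yz : `|- (y + z)| <= eta + eta by rewrite normrN (le_trans (ler_normD _ _))// lerD.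
rewrite xE; split.
  apply: (@shifted_add (s / 4) (s / 4)); first by rewrite divr_gt0.
    by rewrite (_ : s / 4 + s / 4 = s / 2)//; field.
  by rewrite (le_trans yz)//; move: eta_s; lra.
by rewrite (le_trans (ler_normD _ _))// lerD// (le_trans yz)//; move: eta1; lra.
Qed.

Lemma field_test : test_field D transport_field.
Proof.
pose S := shifted (s / 4) `&` [set x : Rn | `|x| <= 2 * rho + 1].
have clS : closed S.
  apply: closedI; first exact: shifted_closed.
  apply: (@preimage_closed Rn R (fun x => `|x|) [set t | t <= 2 * rho + 1]); last exact: closed_le.
  by move=> x _; exact: norm_continuous_rV.
have suppS : vector_support transport_field `<=` S.
  rewrite ((closure_id S).1 clS); apply: closureS => x /= X0.
  exact: field_supp.
split.
- by apply: taylor_smooth => j k; exact: field_taylor.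
- apply: (subclosed_compact (@closed_closure _ _) _ suppS).
  apply: bounded_closed_compact => //.
  exists (2 * rho + 1); split; first exact: num_real.
  by move=> t tr x [_ xr]; exact: le_trans xr (ltW tr).
- apply: subset_trans suppS _ => x [Dx _].
  apply/nbhs_ballP; exists (s / 4); first by rewrite /= divr_gt0.
  move=> y; rewrite -ball_normE /= => xy.
  have := @shifted_add 0 (s / 4) x (y - x); rewrite add0r => /(_ _ Dx).
  rewrite /shifted/= scale0r subr0 [x + _]addrC subrK; apply; first by rewrite divr_gt0.
  by rewrite distrC ltW.
- exact: field_norm.
Qed.

(** The part of the backward differences of [phi * T] that stems from the increments of [T], in the
    discrete product rule. *)
Definition gap (h : R) (z : Rn) : R :=
  \sum_i phi (z - h *: e_ R i) * (T z ord0 i - T (z - h *: e_ R i) ord0 i).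

Lemma gap_ge0 h z : 0 <= h -> 0 <= gap h z.
Proof.
move=> h0; apply: sumr_ge0 => i _; rewrite mulr_ge0 ?phi_ge0// subr_ge0.
by have [_ _ mono _] := tT; exact: mono.
Qed.

Lemma measurable_gap h : measurable_fun setT (gap h : borel_rV R n -> R).
Proof.
have [mT _ _ _] := tT.
apply: measurable_sum => i; rewrite (_ : (fun z => _) =
  (fun z : borel_rV R n => phi (- (h *: e_ R i) + (z : Rn)) *
     (T z ord0 i - T (- (h *: e_ R i) + (z : Rn)) ord0 i))).
  apply: measurable_funM.
    exact: (measurable_fun_comp_shift _ measurable_phi).
  apply: measurable_funB; first exact: mT.
  exact: (@measurable_fun_comp_shift R n _ (fun x => T x ord0 i) (mT i)).
by apply/funext => z; rewrite addrC.
Qed.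

Lemma enorm_e i : `|e_ R i : Rn| <= 1.
Proof. by apply: norm_le_coord => // j; rewrite e_E; case: (_ == _); rewrite ?normr1 ?normr0. Qed.

(** The other part of the product rule is, up to order [h ^+ 2], [h] times the derivative of [phi]
    along [T z]. Since [T z] is in [K] and in the unit ball, [phi_deriv] bounds it below. *)
Lemma prefield_diff : exists2 M, 0 <= M & forall h z, 0 <= h ->
  gap h z - h / rho - M * h ^+ 2 <=
  \sum_i (prefield i z - prefield i (z - h *: e_ R i)).
Proof.
have [dphi [M [M0 HM HK]]] := phi_deriv.
exists (n%:R * M); first by rewrite mulr_ge0.
move=> h z h0.
have -> : \sum_i (prefield i z - prefield i (z - h *: e_ R i)) =
    \sum_i T z ord0 i * (phi z - phi (z - h *: e_ R i)) + gap h z.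
  by rewrite /gap -big_split/=; apply: eq_bigr => i _; rewrite /prefield; ring.
have H i : h * (T z ord0 i * dphi i z) - M * h ^+ 2 <= T z ord0 i * (phi z - phi (z - h *: e_ R i)).
  have := HM z (- (h *: e_ R i)).
  rewrite (bigD1 i)//= big1 ?addr0; last first.
    by move=> j ji; rewrite !mxE eqxx (negbTE ji) mulr0 oppr0 mul0r.
  rewrite !mxE !eqxx mulr1 normrN normrZ ger0_norm// => H1.
  have H2 : `|phi (z - h *: e_ R i) - phi z - - h * dphi i z| <= M * h ^+ 2.
    apply: le_trans H1 _; rewrite ler_wpM2l// lerXn2r ?nnegrE ?mulr_ge0//.
    by rewrite ler_piMr// enorm_e.
  rewrite [leRHS](_ : _ = h * (T z ord0 i * dphi i z) -
    T z ord0 i * (phi (z - h *: e_ R i) - phi z - - h * dphi i z)); last by ring.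
  rewrite lerD2l lerN2 (le_trans (ler_norm _))// normrM.
  by rewrite -[leRHS]mul1r ler_pM.
have S : \sum_i (h * (T z ord0 i * dphi i z) - M * h ^+ 2) <=
    \sum_i T z ord0 i * (phi z - phi (z - h *: e_ R i)).
  by apply: ler_sum => i _; exact: H.
move: S; rewrite sumrB -mulr_sumr sumr_const card_ord -mulr_natl.
have := ler_wpM2l h0 (HK z (T z) (TK z) (T1 z)).
rewrite mulrN mulrA; lra.
Qed.

(** [prefield_diff] averaged against [sg]. The discontinuities of [T] only occur under the integral
    of [gap], so dividing by [h] and letting [h] tend to 0 bounds a genuine divergence. *)
Lemma field_divergence : exists2 M, 0 <= M & forall h x, 0 <= h ->
  \int[mu]_y (gap h (x + y) * sg y) - h / rho - M * h ^+ 2 <= h * divergence transport_field x.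
Proof.
have [_ [N HN]] := taylor_divergence (field_taylor 2).
have [M M0 HM] := prefield_diff.
exists (`|N| + M); first exact: addr_ge0.
move=> h x h0.
have H1 : `|h * divergence transport_field x - \sum_i (transport_field x ord0 i - transport_field (x - h *: e_ R i) ord0 i)| <= `|N| * h ^+ 2.
  by rewrite (le_trans (HN x h h0))// ler_wpM2r ?sqr_ge0// ler_norm.
pose q i := fun y => prefield i (x + y) * sg y - prefield i (x - h *: e_ R i + y) * sg y.
have iq i : mu.-integrable setT (EFin \o (q i : borel_rV R n -> R)).
  exact: (integrableB measurableT (cE i x).2 (cE i (x - h *: e_ R i)).2).
have [si sumE] := Rintegral_sum iq.
have E : \sum_i (transport_field x ord0 i - transport_field (x - h *: e_ R i) ord0 i) = \int[mu]_y (\sum_i q i y).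
  rewrite sumE; apply: eq_bigr => i _; rewrite !mxE RintegralB//.
  - by rewrite (cE i x).1 (cE i (x - h *: e_ R i)).1.
  - exact: (cE i x).2.
  - exact: (cE i _).2.
have ig : mu.-integrable setT (EFin \o ((fun y => gap h (x + y) * sg y) : borel_rV R n -> R)).
  have [N' N'0 bN'] := taylor_bounded (sg_taylor 0).
  have [r hr] := sg_bounded_supp.
  apply: (@integrable_bounded_support R n _ (n%:R * 2 * N') r).
  - apply: measurable_funM; first exact: (measurable_fun_comp_shift _ (measurable_gap h)).
    exact: (continuous_measurable_rV (taylor_continuous (sg_taylor 1))).
  - move=> y; rewrite normrM ler_pM// (le_trans (ler_norm_sum _ _ _))//.
    apply: (@le_trans _ _ (\sum_(i < n) (2 : R))); last first.
      by rewrite sumr_const card_ord mulr_natl.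
    apply: ler_sum => i _; rewrite normrM ger0_norm ?phi_ge0//.
    rewrite -[leRHS]mul1r ler_pM ?phi_ge0 ?phi_le1// (le_trans (ler_normB _ _))//.
    by rewrite mulr2n lerD.
  - by move=> y /hr ->; rewrite mulr0.
have : \int[mu]_y (gap h (x + y) * sg y - (h / rho + M * h ^+ 2) * sg y) <= \int[mu]_y (\sum_i q i y).
  apply: le_Rintegral => //.
    exact: (integrableB measurableT ig (integrableZl measurableT _ sg_integrable)).
  move=> y _; rewrite -mulrBl (eq_bigr (fun i => (prefield i (x + y) - prefield i (x + y - h *: e_ R i)) * sg y)); last first.
    by move=> i _; rewrite /q mulrBl addrAC.
  rewrite -mulr_suml ler_wpM2r// opprD addrA; exact: HM.
rewrite RintegralB//; last exact: (integrableZl measurableT _ sg_integrable).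
rewrite RintegralZl//; last exact: sg_integrable.
rewrite sg_int mulr1 -E => H2.
move: H1; rewrite ler_norml => /andP[H1 _].
by move: H1 H2; rewrite mulrDl; lra.
Qed.

Lemma lim_le_bound (a b c : R) : 0 <= c -> (forall h, 0 < h -> a <= b + c * h) -> a <= b.
Proof.
move=> c0 H; apply/ler_addgt0Pr => e e0.
have h0 : 0 < e / (c + 1) by rewrite divr_gt0// ltr_wpDl.
rewrite (le_trans (H _ h0))// lerD2l mulrA ler_pdivrMr ?ltr_wpDl//.
by rewrite mulrC ler_pM2l// lerDl.
Qed.

Lemma field_divergence_ge x : - rho^-1 <= divergence transport_field x.
Proof.
have [M M0 HM] := field_divergence.
apply: (lim_le_bound M0) => h h0; have := HM h x (ltW h0).
have : 0 <= \int[mu]_y (gap h (x + y) * sg y).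
  by apply: Rintegral_ge0 => y _; rewrite mulr_ge0// gap_ge0// ltW.
move=> A1 A2; rewrite -(ler_pM2l h0) mulrN mulrDr [h * (M * h)]mulrCA -expr2; lra.
Qed.

(** Near [x] the cutoff is 1, so [gap] is the sum of the differences of [T], at least
    [n * kappa * h] on the boxes for small [h]. The threshold depends on the point, whence dominated
    convergence. *)
Lemma field_divergence_large x : shifted s x -> `|x| <= rho - 1 ->
  (forall y : Rn, (forall i, - eta < y ord0 i < 0) -> halfopen_boxes sE (x + y)) ->
  n%:R * kappa - rho^-1 <= divergence transport_field x.
Proof.
move=> Dx xr xE; have [M M0 HM] := field_divergence.
have [_ _ _ divT] := tT.
set c := n%:R * kappa; have c0 : 0 <= c by rewrite mulr_ge0.
pose h (m : nat) : R := m.+1%:R^-1.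
have h0 m : 0 < h m by rewrite invr_gt0 ltr0n.
(* Truncating at [c] loses nothing in the limit, supplies the dominating function [G], and makes the
   sequence eventually constant at each [y]. *)
pose F (m : nat) : borel_rV R n -> \bar R := fun y => (Num.min (gap (h m) (x + y) / h m) c * sg y)%:E.
pose G : borel_rV R n -> \bar R := fun y => (c * sg y)%:E.
have phi1 (y : Rn) (t : R) : (forall i, - eta < y ord0 i < 0) -> 0 <= t <= eta -> forall i, phi (x + y - t *: e_ R i) = 1.
  move=> ye /andP[t0 t1] i; apply: phi_eq1 => z ze.
  have ny : `|y| <= eta.
    apply: norm_le_coord; first exact: ltW.
    by move=> j; have /andP[y1 y2] := ye j; rewrite ler_norml (ltW y1)/= (le_trans (ltW y2))// ltW.
  have nt : `|t *: e_ R i : Rn| <= eta.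
    by rewrite normrZ ger0_norm// (le_trans _ t1)// ler_piMr// enorm_e.
  (* Three displacements: the outer mollification, the backward step, the mollification in [phi].
     Their sum is below [s / 2] and below 1. *)
  have nz : `|y - t *: e_ R i + z| <= eta + eta + eta.
    by rewrite (le_trans (ler_normD _ _))// lerD// (le_trans (ler_normB _ _))// lerD.
  rewrite (_ : x + y - _ + z = x + (y - t *: e_ R i + z)); last by rewrite !addrA.
  split.
    apply: (@shifted_add (s / 2) (s / 2)); first by rewrite divr_gt0.
      by rewrite -splitr.
    by rewrite (le_trans nz)//; move: eta_s; lra.
  by rewrite (le_trans (ler_normD _ _))//; move: eta1 nz xr; lra.
have hlt e : 0 < e -> \forall m \near \oo, h m < e.
  move=> e0; exists (Num.truncn e^-1) => // m /= Nm.
  rewrite /h invf_plt ?posrE ?ltr0n//.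
  by rewrite (lt_le_trans (truncnS_gt _))// ler_nat ltnS.
have FG y : F ^~ y @ \oo --> G y.
  apply: cvg_near_cst.
  have [/eqP sg0|/sg_supp ye] := boolP (sg y == 0).
    by apply: nearW => m; rewrite /F /G sg0 !mulr0.
  have [t0 t00 Ht] := divT _ (xE y ye).
  have e0 : 0 < Num.min t0 eta by rewrite lt_min t00.
  apply: filterS (hlt _ e0) => m; rewrite lt_min => /andP[ht he].
  rewrite /F /G; congr ((_ * _)%:E); apply/min_idPr.
  rewrite ler_pdivlMr// (le_trans (Ht (h m) _)) ?h0//; apply: ler_sum => i _.
  by rewrite phi1 ?mul1r// ltW// ltW.
have [N N0 sN] := taylor_bounded (sg_taylor 0).
have [r hr] := sg_bounded_supp.
have mF m : measurable_fun setT ((fun y => Num.min (gap (h m) (x + y) / h m) c * sg y) : borel_rV R n -> R).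
  apply: measurable_funM; last exact: (continuous_measurable_rV (taylor_continuous (sg_taylor 1))).
  apply: measurable_minr; last exact: measurable_cst.
  apply: measurable_funM; last exact: measurable_cst.
  exact: (measurable_fun_comp_shift _ (measurable_gap (h m))).
have Fb m y : 0 <= Num.min (gap (h m) (x + y) / h m) c * sg y <= c * sg y.
  rewrite mulr_ge0//=; first by rewrite ler_wpM2r// ge_min lexx orbT.
  by rewrite le_min c0 divr_ge0 ?gap_ge0 ?(ltW (h0 m)).
have iF m : mu.-integrable setT (F m).
  apply: (@integrable_bounded_support R n _ (c * N) r) => //.
    move=> y; have /andP[f1 f2] := Fb m y; rewrite ger0_norm// (le_trans f2)// ler_wpM2l//.
    by rewrite (le_trans (ler_norm _)).
  by move=> y /hr ->; rewrite mulr0.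
pose u m := \int[mu]_y (Num.min (gap (h m) (x + y) / h m) c * sg y).
have uE m : (\int[mu]_y F m y = (u m)%:E)%E.
  by rewrite /u /Rintegral fineK//; exact: (integrable_fin_num measurableT (iF m)).
have [] := @dominated_convergence _ _ R mu setT measurableT F G G.
- by move=> m; exact: (measurable_int _ (iF m)).
- exact: (measurable_int _ (integrableZl measurableT c sg_integrable)).
- by apply: aeW => y _; exact: FG.
- exact: (integrableZl measurableT c sg_integrable).
- apply: aeW => y m _; rewrite /F /G lee_fin.
  by have /andP[f1 f2] := Fb m y; rewrite ger0_norm.
move=> _ _ lim.
have GE : (\int[mu]_y G y = c%:E)%E.
  rewrite -[c in RHS]mulr1 -sg_int -RintegralZl//; last exact: sg_integrable.
  by rewrite /Rintegral fineK//; exact: (integrable_fin_num measurableT (integrableZl measurableT c sg_integrable)).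
rewrite GE in lim.
have uh m : u m <= divergence transport_field x + rho^-1 + M * h m.
  have := HM (h m) x (ltW (h0 m)).
  have : h m * u m <= \int[mu]_y (gap (h m) (x + y) * sg y).
    rewrite -RintegralZl//; last exact: iF.
    have gb y : 0 <= gap (h m) y <= n%:R * 2.
      rewrite gap_ge0 ?(ltW (h0 m))//=.
      apply: (@le_trans _ _ (\sum_(i < n) (2 : R))); last by rewrite sumr_const card_ord mulr_natl.
      apply: ler_sum => i _; rewrite (le_trans (ler_norm _))// normrM ger0_norm ?phi_ge0//.
      rewrite -[leRHS]mul1r ler_pM ?phi_ge0 ?phi_le1// (le_trans (ler_normB _ _))//.
      by rewrite [leRHS]mulr2n lerD.
    apply: le_Rintegral => //.
    - exact: (integrableZl measurableT (h m) (iF m)).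
    - apply: (@integrable_bounded_support R n _ (n%:R * 2 * N) r).
      + apply: measurable_funM; first exact: (measurable_fun_comp_shift _ (measurable_gap (h m))).
        exact: (continuous_measurable_rV (taylor_continuous (sg_taylor 1))).
      + move=> y; have /andP[g1 g2] := gb (x + y); rewrite normrM ler_pM// ger0_norm//.
      + by move=> y /hr ->; rewrite mulr0.
    - move=> y _; rewrite mulrA ler_wpM2r// mulrC -ler_pdivlMr//.
      by rewrite ge_min lexx.
  move=> A1 A2; rewrite -(ler_pM2l (h0 m)) !mulrDr [h m * (M * h m)]mulrCA -expr2; lra.
rewrite lerBlDr; apply/ler_addgt0Pr => e e0.
rewrite -lee_fin; apply: (@cvge_to_le _ _ _ _ _ _ _ lim).
have e1 : 0 < e / (M + 1) by rewrite divr_gt0// ltr_wpDl.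
apply: filterS (hlt _ e1) => m hm; rewrite /= uE lee_fin (le_trans (uh m))// lerD2l.
apply: (@le_trans _ _ (M * (e / (M + 1)))); first by rewrite ler_wpM2l// ltW.
by rewrite mulrA ler_pdivrMr ?ltr_wpDl// mulrC ler_pM2l// lerDl.
Qed.

End TestField.

(** * From the test field to the lower bound for the perimeter *)

Section LowerBound.
Variables (R : realType) (n : nat).
Local Notation Rn := 'rV[R]_n.
Local Notation mu := (borel_lebesgue R n).
Local Notation vol := (@volume R n).

Lemma measurable_halfopen_boxes s : measurable (halfopen_boxes s : set (borel_rV R n)).
Proof.
elim: s => [|B s IH].
  by rewrite (_ : halfopen_boxes [::] = set0)//; apply/seteqP; split => // x [].
rewrite (_ : halfopen_boxes (B :: s) = halfopen_box B `|` halfopen_boxes s).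
  by apply: measurableU => //; exact: measurable_halfopen_box.
apply/seteqP; split=> x.
  by move=> [C]; rewrite inE => /orP[/eqP ->|Cs] Cx; [left|right; exists C].
move=> [Bx|[C Cs Cx]]; first by exists B => //; rewrite mem_head.
by exists C => //; rewrite inE Cs orbT.
Qed.

(** Only the lower corners move, because the mollifier looks only at points with smaller
    coordinates. *)
Definition shrink (eta : R) (s : seq (Rn * Rn)) :=
  [seq (B.1 + const_mx eta, B.2) | B <- s].

Lemma shrinkP eta s (x y : Rn) : halfopen_boxes (shrink eta s) x ->
  (forall i, - eta < y ord0 i < 0) -> halfopen_boxes s (x + y).
Proof.
move=> [C /mapP[B Bs ->] Cx] ye; exists B => // i.
have := Cx i; have /andP[y1 y2] := ye i; rewrite !mxE/= => -[x1 x2]; split; lra.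
Qed.

Lemma shrink_le (e e' : R) s : e <= e' ->
  halfopen_boxes (shrink e' s) `<=` halfopen_boxes (shrink e s).
Proof.
move=> ee x [C /mapP[B Bs ->] Cx]; exists (B.1 + const_mx e, B.2); first exact: map_f.
move=> i; have := Cx i; rewrite !mxE/= => -[x1 x2]; split => //.
by rewrite (le_lt_trans _ x1)// lerD2l.
Qed.

Lemma shrink_cover s x : halfopen_boxes s x ->
  exists2 e : R, 0 < e & halfopen_boxes (shrink e s) x.
Proof.
move=> [B Bs Bx]; pose e0 : R := \big[Num.min/1]_i (x ord0 i - B.1 ord0 i).
have e00 : 0 < e0 by apply: lt_bigmin => // i _; rewrite subr_gt0 (Bx i).1.
exists (e0 / 2); first by rewrite divr_gt0.
exists (B.1 + const_mx (e0 / 2), B.2); first exact: (map_f (fun B : Rn * Rn => (B.1 + const_mx (e0 / 2), B.2))).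
move=> i; split; last exact: (Bx i).2.
rewrite !mxE; have : e0 <= x ord0 i - B.1 ord0 i by exact: bigmin_le.
lra.
Qed.

Variables (D K : set Rn).
Hypothesis clD : closed D.
Hypothesis cD : convex_set D.
Hypothesis iD : interior D !=set0.
Hypothesis coneK : convex_cone K.
Hypothesis DK : forall x k, D x -> K k -> D (x + k).

(** The sets where the divergence is large increase as the parameters improve. They exhaust the part
    of [E] in the boxes except for boundary points of [D], which form a null set by convexity. *)
Lemma good_part_volume (q0 : Rn) (E : set (lebesgue_rV R n)) (s : seq (Rn * Rn)) (v e c : R) :
  (forall y, `|y| <= 1 -> K (q0 + y)) -> 0 <= c ->
  measurable E -> E `<=` D -> (v%:E <= vol (E `&` halfopen_boxes s))%E -> 0 < e ->
  exists t rho eta, [/\ 0 < t, c < rho /\ 1 <= rho, 0 < eta, eta <= t / 8 /\ eta <= 1 / 8 &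
    exists G : set Rn, [/\ measurable (G : set (borel_rV R n)),
     (forall x, G x -> [/\ shifted D q0 t x, `|x| <= rho - 1 & halfopen_boxes (shrink eta s) x]) &
     ((v - e)%:E < vol (E `&` G))%E]].
Proof.
move=> q0K c0 mE ED vE e0.
pose t (m : nat) : R := m.+1%:R^-1.
pose eta (m : nat) : R := t m / 8.
pose rho (m : nat) : R := m.+1%:R + c + 1.
have t0 m : 0 < t m by rewrite invr_gt0 ltr0n.
have tle m k : (m <= k)%N -> t k <= t m.
  by move=> mk; rewrite lef_pV2 ?posrE ?ltr0n// ler_nat ltnS.
have tlt (a : R) : 0 < a -> exists m, t m < a.
  move=> a0; exists (Num.truncn a^-1); rewrite /t invf_plt ?posrE ?ltr0n//.
  exact: truncnS_gt.
have [_ _ Ks _] := coneK.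
have q0K' : K q0 by rewrite -[q0]addr0; apply: q0K; rewrite normr0.
pose G (m : nat) : set (borel_rV R n) := shifted D q0 (t m) `&` [set x : Rn | `|x| <= rho m - 1]
  `&` halfopen_boxes (shrink (eta m) s).
have mG m : measurable (G m).
  apply: measurableI; last exact: measurable_halfopen_boxes.
  apply: measurableI; apply: closed_measurable_rV; first exact: shifted_closed.
  apply: (@preimage_closed Rn R (fun x => `|x|) [set t | t <= rho m - 1]); last exact: closed_le.
  by move=> x _; exact: norm_continuous_rV.
have mb : measurable ((D `\` interior D) : set (borel_rV R n)).
  by apply: measurableD; [exact: closed_measurable_rV|apply: open_measurable_rV; exact: open_interior].
have Gle : {homo (fun m => E `&` G m) : k l / (k <= l)%N >-> k `<=` l}.
  move=> k l kl x [Ex [[Dx xk] sx]]; split => //; split; [split|].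
  - rewrite /shifted/= (_ : _ - _ = x - t k *: q0 + (t k - t l) *: q0).
      by apply: DK => //; apply: Ks => //; rewrite subr_ge0 tle.
    by rewrite scalerBl addrA subrK.
  - rewrite /= (le_trans xk)// /rho !lerD2r ler_nat ltnS//.
  - by apply: shrink_le sx; rewrite ler_pM2r ?invr_gt0// tle.
have mEG m : measurable (E `&` G m) by apply: measurableI => //; exact: measurable_lebesgue.
have sub : E `&` halfopen_boxes s `<=` (\bigcup_m (E `&` G m)) `|` (D `\` interior D).
  move=> x [Ex sx]; have [iDx|niDx] := pselect (interior D x); last by right; split => //; exact: ED.
  left; have [e1 e10 xe1] := shrink_cover sx.
  have /nbhs_ballP[r /= r0 rD] := iDx.
  have q1 : 0 < `|q0| + 1 by rewrite ltr_wpDl.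
  have [m1 hm1] := tlt (r / (`|q0| + 1)) (divr_gt0 r0 q1).
  have [m2 hm2] := tlt e1 e10.
  pose m := maxn (maxn m1 m2) (Num.truncn `|x|).
  exists m => //; split => //; split; [split|].
  - rewrite /shifted/=; apply: rD; rewrite -ball_normE /= opprB addrCA subrr addr0.
    rewrite normrZ gtr0_norm// (@le_lt_trans _ _ (t m * (`|q0| + 1)))//.
      by rewrite ler_wpM2l ?(ltW (t0 m))// lerDl.
    rewrite -ltr_pdivlMr//; apply: le_lt_trans hm1; apply: tle.
    by rewrite /m -maxnA leq_maxl.
  - rewrite /= /rho -addrA addrC addrAC.
    have : `|x| < (Num.truncn `|x|).+1%:R by exact: truncnS_gt.
    have : (Num.truncn `|x|).+1%:R <= m.+1%:R :> R by rewrite ler_nat ltnS leq_maxr.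
    lra.
  - apply: shrink_le xe1; rewrite /eta ler_pdivrMr//.
    have : t m <= t m2 by apply: tle; rewrite /m maxnAC leq_maxr.
    lra.
have vU : (v%:E <= vol (\bigcup_m (E `&` G m)))%E.
  apply: (le_trans vE).
  apply: (@le_trans _ _ (vol ((\bigcup_m (E `&` G m)) `|` (D `\` interior D)))).
    apply: le_measure; rewrite ?inE//.
      by apply: measurableI => //; apply: measurable_lebesgue; exact: measurable_halfopen_boxes.
    by apply: measurableU; [exact: bigcupT_measurable|exact: measurable_lebesgue].
  have vb : vol (D `\` interior D) = 0%E by rewrite volume_borel// convex_boundary_null.
  apply: (@le_trans _ _ (vol (\bigcup_m (E `&` G m)) + vol (D `\` interior D))%E).
    by apply: measureU2; [exact: bigcupT_measurable|exact: measurable_lebesgue].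
  by rewrite vb adde0.
have [m hm] := measure_bigcup_approx mEG Gle vU e0.
exists (t m), (rho m), (eta m); split => //.
- by rewrite /rho; split; have : 0 < m.+1%:R :> R by []; lra.
- by rewrite divr_gt0.
- split => //; rewrite ler_pM2r ?invr_gt0// /t invf_le1 ?ltr0n//.
  by rewrite ler1n.
- by exists (G m); split => // x [[]].
Qed.

(** On [E] the divergence is at least [b * \1_G - r], whose integral is explicit because [E] has
    finite volume. *)
Lemma field_integral (E : set (lebesgue_rV R n)) (v a b : R) (G : set Rn) (xi : Rn -> Rn) :
  measurable E -> vol E = v%:E -> measurable (G : set (borel_rV R n)) ->
  taylor 1 (divergence xi) -> 0 <= b -> (a%:E <= vol (E `&` G))%E -> forall r : R,
  (forall x, - r <= divergence xi x) -> (forall x, G x -> b - r <= divergence xi x) ->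
  ((b * a - r * v)%:E <= \int[vol]_(x in E) (divergence xi x)%:E)%E.
Proof.
move=> mE vE mG txi b0 aG r h1 h2.
have Eoo : (vol E < +oo)%E by rewrite vE ltry.
have mGL := measurable_lebesgue mG.
have mdiv : measurable_fun E ((fun x => divergence xi x) : lebesgue_rV R n -> R).
  apply: measurable_funTS.
  apply: (@measurableT_comp _ _ _ _ _ _ (divergence xi : borel_rV R n -> R) _ (idfun : lebesgue_rV R n -> borel_rV R n)).
    exact: (continuous_measurable_rV (taylor_continuous txi)).
  exact: measurable_fun_lebesgue_borel.
have idiv : vol.-integrable E (EFin \o ((fun x => divergence xi x) : lebesgue_rV R n -> R)).
  have [M M0 bM] := taylor_bounded txi.
  apply: measurable_bounded_integrable => //.
  exists M; split; first exact: num_real.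
  by move=> t Mt x _ /=; rewrite (le_trans (bM x))// ltW.
have i1 : vol.-integrable E (fun x : lebesgue_rV R n => (b * \1_G x)%:E).
  rewrite (_ : (fun x => _) = (fun x => b%:E * (\1_G x)%:E)%E)//.
  apply: integrableZl => //.
  apply: measurable_bounded_integrable => //.
  exists 1; split; first exact: num_real.
  by move=> t t1 x _ /=; rewrite indicE (le_trans _ (ltW t1))//; case: (_ \in _); rewrite ?normr1 ?normr0.
have i2 : vol.-integrable E (fun x : lebesgue_rV R n => r%:E).
  apply: measurable_bounded_integrable => //.
  exists `|r|; split; first exact: num_real.
  by move=> t rt x _ /=; exact: ltW.
apply: (@le_trans _ _ (\int[vol]_(x in E) ((b * \1_G x)%:E - r%:E))%E).
  have I2 : (\int[vol]_(x in E) r%:E = r%:E * v%:E)%E.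
    by transitivity (r%:E * vol E)%E; [exact: integral_cst|rewrite vE].
  have iG : vol.-integrable E (fun x : lebesgue_rV R n => (\1_G x)%:E).
    apply: measurable_bounded_integrable => //.
    exists 1; split; first exact: num_real.
    by move=> t t1 x _ /=; rewrite indicE (le_trans _ (ltW t1))//; case: (_ \in _); rewrite ?normr1 ?normr0.
  have I1 : (\int[vol]_(x in E) (b * \1_G x)%:E = b%:E * vol (E `&` G))%E.
    transitivity (b%:E * \int[vol]_(x in E) (\1_G x)%:E)%E; first by rewrite -integralZl.
    by rewrite integral_indic// setIC.
  rewrite integralB// I1 I2 EFinB !EFinM.
  by apply: leeB => //; apply: lee_wpmul2l => //; rewrite lee_fin.
apply: le_integral => //; first exact: integrableB.
move=> x _; rewrite -EFinB lee_fin indicE.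
have [xG|xG] := boolP (x \in G); last by rewrite mulr0 sub0r.
by rewrite mulr1; apply: h2; rewrite inE in xG.
Qed.

(** A constant [k'] slightly below [kappa] leaves room for approximating [E] and the part of [K] in
    the unit ball by boxes; then [k'] tends to [kappa]. *)
Lemma perimeter_ge (E : set (lebesgue_rV R n)) (v kappa : R) : (0 < n)%N ->
  measurable E -> E `<=` D -> vol E = v%:E -> 0 < v -> 0 < kappa ->
  ball_vol K 0 1 = kappa ^+ n * v -> ((n%:R * kappa * v)%:E <= perimeter D E)%E.
Proof.
move=> n0 mE ED vE v0 k0 kv.
have clK : closed K by have [] := coneK.
have [q0 q0K] := convex_cone_cube coneK.
have step k' e : 0 < k' -> k' < kappa -> 0 < e ->
   ((n%:R * k' * v)%:E <= perimeter D E + e%:E)%E.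
  move=> k'0 k'k e0.
  have kk : k' ^+ n * v < kappa ^+ n * v.
    by rewrite ltr_pM2r// ltrXn2r ?lt0n_neq0// ?nnegrE ltW.
  pose nk := n%:R * k'.
  have nk0 : 0 <= nk by rewrite mulr_ge0// ltW.
  (* In turn: the source family is nonempty, the volumes allow the transport in spite of an error
     [d] on both sides, and the losses in the final integral stay below [e]. *)
  have [d [d0 dv d1 d2]] : exists d, [/\ 0 < d, d < v, k' ^+ n * (v + d) <= kappa ^+ n * v - d &
      nk * (v - d - d) - d >= nk * v - e].
    pose d := Num.min (v / 2) (Num.min ((kappa ^+ n * v - k' ^+ n * v) / (k' ^+ n + 1)) (e / (nk * 2 + 1))).
    have kn0 : 0 < k' ^+ n + 1 by rewrite addr_gt0// exprn_gt0.
    have nk1 : 0 < nk * 2 + 1 by rewrite ltr_wpDl// mulr_ge0.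
    have dd1 : d <= v / 2 by rewrite ge_min lexx.
    have dd2 : d * (k' ^+ n + 1) <= kappa ^+ n * v - k' ^+ n * v.
      by rewrite -ler_pdivlMr// !ge_min lexx orbT.
    have dd3 : d * (nk * 2 + 1) <= e by rewrite -ler_pdivlMr// !ge_min lexx !orbT.
    exists d; split.
    - by rewrite !lt_min !divr_gt0// subr_gt0.
    - lra.
    - move: dd2; rewrite mulrDr mulrDr; lra.
    - move: dd3; rewrite mulrDr; lra.
  have [sE [r [fE volE EE _]]] := box_approx mE vE d0.
  pose B := K `&` eball 0 1.
  have cB : convex_set B by apply: convex_setI_eball; exact: convex_cone_convex.
  have mB : measurable (B : set (borel_rV R n)) by exact: measurable_ball_sect.
  have iB : interior B !=set0.
    have [U [oU [x Ux] UB]] := cone_ball_open coneK.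
    by exists x; exact: (filterS UB (open_nbhs_nbhs (conj oU Ux))).
  have [||sL [fL volL LB]] := @open_box_approx R n (interior B) (ball_vol K 0 1) 1 d (@open_interior _ _) _ _ d0.
  - by move=> x /interior_subset[_]; rewrite /eball/= subr0; apply: le_trans; exact: norm_le_enorm.
  - rewrite (@convex_interior_measure R n B 1)//; first by rewrite ball_volE.
    by move=> x [_]; rewrite /eball/= subr0; apply: le_trans; exact: norm_le_enorm.
  have LK x : closed_boxes sL x -> K x /\ enorm x <= 1.
    by move=> /LB/interior_subset[Kx]; rewrite /eball/= subr0.
  have szE : (0 < size sE)%N.
    case: sE EE {volE fE} => // EE; move: EE.
    rewrite (_ : halfopen_boxes [::] = set0); last by apply/seteqP; split => // x [].
    by rewrite setI0 measure0 lee_fin leNgt subr_gt0 dv.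
  have szL : (0 < size sL)%N.
    apply: size_gt0_vol; apply: lt_le_trans volL; rewrite kv.
    apply: lt_le_trans d1; rewrite mulr_gt0 ?exprn_gt0// addr_gt0//.
  have [|T tT] := @transport_exists R n k' sE sL (ltW k'0) fE fL szE szL.
    apply: (le_trans _ volL); rewrite kv; apply: le_trans d1.
    by rewrite ler_wpM2l// exprn_ge0// ltW.
  (* The radius is required to exceed [v / d], so that the defect [v / rho] in the integral is less
     than [d]. *)
  have [t [rho [eta [t0 [crho rho1] eta0 [eta_t eta1] [G [mG GP vG]]]]]] :=
    @good_part_volume q0 E sE (v - d) d (v / d) q0K (divr_ge0 (ltW v0) (ltW d0)) mE ED EE d0.
  have [sg [sgt sg0 sgs sgi]] := @mollifier_exists R n eta eta0.
  pose xi := transport_field D q0 t rho sg T.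
  have xi_test : test_field D xi.
    exact: (field_test clD coneK DK q0K t0 rho1 eta0 eta_t eta1 sgt sg0 sgs sgi tT LK).
  have xi_div := (taylor_divergence (field_taylor q0 t clD rho1 eta0 sgt sg0 sgs sgi tT LK 2)).1.
  have h1 := field_divergence_ge q0 t clD coneK DK rho1 eta0 sgt sg0 sgs sgi tT LK.
  have h2 x : G x -> nk - rho^-1 <= divergence xi x.
    move=> /GP[Dx xr sx].
    apply: (field_divergence_large clD coneK DK q0K t0 rho1 eta0 eta_t eta1 sgt sg0 sgs sgi (ltW k'0) tT LK) => //.
    by move=> y ye; exact: shrinkP sx ye.
  have I := field_integral mE vE mG xi_div nk0 (ltW vG) h1 h2.
  rewrite -leeBlDr// -EFinB.
  apply: (@le_trans _ _ (nk * (v - d - d) - rho^-1 * v)%:E).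
    rewrite lee_fin; apply: (le_trans d2); rewrite lerD2l lerN2.
    have rho0 : 0 < rho by exact: lt_le_trans rho1.
    by rewrite ler_pdivrMl// mulrC -ler_pdivrMr// mulrC ler_pdivrMl// -ler_pdivrMr//; exact: ltW.
  apply: (le_trans I); apply: ereal_sup_ubound.
  by exists xi.
have step2 k' : 0 < k' -> k' < kappa -> ((n%:R * k' * v)%:E <= perimeter D E)%E.
  by move=> k'0 k'k; apply/lee_addgt0Pr => e e0; exact: step.
apply/lee_addgt0Pr => e e0.
pose t := Num.min (kappa / 2) (e / (n%:R * v)).
have nv0 : 0 < n%:R * v by rewrite mulr_gt0// ltr0n.
have t0 : 0 < t by rewrite lt_min !divr_gt0.
have tk : t <= kappa / 2 by rewrite ge_min lexx.
have te : t * (n%:R * v) <= e by rewrite -ler_pdivlMr// ge_min lexx orbT.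
have := step2 (kappa - t); rewrite subr_gt0 gtrBl => H.
apply: (@le_trans _ _ ((n%:R * (kappa - t) * v)%:E + e%:E)%E).
  rewrite -EFinD lee_fin; move: te; rewrite mulrBr mulrBl (_ : n%:R * t * v = t * (n%:R * v)); last by ring.
  lra.
by rewrite leeD2r// H//; lra.
Qed.

End LowerBound.

(** * The perimeter of balls *)

Section UpperBound.
Variables (R : realType) (n : nat).
Local Notation Rn := 'rV[R]_n.
Local Notation mu := (borel_lebesgue R n).
Variables (D : set Rn) (xi : Rn -> Rn).
Hypothesis clD : closed D.
Hypothesis txi : test_field D xi.

Definition partial (i : 'I_n) (x : Rn) : R := ('D_(e_ R i) xi x) ord0 i.

Let xi_diff x : differentiable xi x.
Proof. by have [sxi _ _ _] := txi; have [] := sxi 1%N. Qed.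

Let xi_cont : continuous xi.
Proof. by have [sxi _ _ _] := txi; exact: sxi 0%N. Qed.

Lemma xi_coord_continuous i : continuous (fun x => xi x ord0 i).
Proof.
move=> x; apply: (@continuous_comp _ _ _ xi (fun y : Rn => y ord0 i)); first exact: xi_cont.
exact: coord_continuous.
Qed.

Lemma partial_continuous i : continuous (partial i).
Proof.
have [sxi _ _ _] := txi; have [_ /(_ (e_ R i)) /= H] := sxi 1%N.
move=> x; apply: (@continuous_comp _ _ _ (fun x => 'D_(e_ R i) xi x) (fun y : Rn => y ord0 i)); first exact: H.
exact: coord_continuous.
Qed.

Lemma xi_out x : ~ D x -> xi x = 0.
Proof.
move=> nDx; apply/eqP; apply/negPn/negP => x0; apply: nDx.
have [_ _ sD _] := txi; apply: interior_subset; apply: sD.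
exact: subset_closure.
Qed.

Lemma xi_line_derive i (x : Rn) (t : R) :
  is_derive t 1 (fun u : R => xi (x + u *: e_ R i) ord0 i) (partial i (x + t *: e_ R i)).
Proof.
have dv := @diff_derivable _ _ _ _ _ (e_ R i) (xi_diff (x + t *: e_ R i)).
have di : derivable (fun y => xi y ord0 i) (x + t *: e_ R i) (e_ R i).
  by have /derivable_mxP := dv; exact.
have E : (fun h : R => h^-1 *: (((fun u : R => xi (x + u *: e_ R i) ord0 i) \o shift t) (h *: (1 : R))
      - xi (x + t *: e_ R i) ord0 i)) =
   (fun h : R => h^-1 *: (((fun y => xi y ord0 i) \o shift (x + t *: e_ R i)) (h *: e_ R i)
      - (fun y => xi y ord0 i) (x + t *: e_ R i))).
  apply/funext => h /=; congr (_ *: (xi _ ord0 i - _)).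
  have -> : h *: (1 : R) = h by rewrite /GRing.scale/= mulr1.
  by rewrite scalerDl addrCA.
have d1 : derivable (fun u : R => xi (x + u *: e_ R i) ord0 i) t 1.
  by rewrite /derivable E.
apply: DeriveDef => //.
by rewrite /partial derive_mx// mxE /derive E.
Qed.

(** Stated along a sequence of steps for the sake of dominated convergence. *)
Lemma partial_quotient i x : (fun m : nat => m.+1%:R * (xi (x + m.+1%:R^-1 *: e_ R i) ord0 i - xi x ord0 i))
  @ \oo --> partial i x.
Proof.
have [dv dE] := xi_line_derive i x 0.
rewrite scale0r addr0 in dE.
have H : (fun h : R => h^-1 *: (((fun u : R => xi (x + u *: e_ R i) ord0 i) \o shift 0) (h *: (1 : R))
      - xi (x + 0 *: e_ R i) ord0 i)) @ 0^' --> partial i x.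
  by rewrite -dE; exact: dv.
apply/cvgrPdist_lt => e e0.
move/cvgrPdist_lt : H => /(_ e e0) /nbhs_ballP[d /= d0 Hd].
exists (Num.truncn d^-1) => // m /= Nm.
have md : m.+1%:R^-1 < d.
  by rewrite invf_plt ?posrE ?ltr0n// (lt_le_trans (truncnS_gt _))// ler_nat ltnS.
have := Hd m.+1%:R^-1; rewrite /ball/= sub0r normrN gtr0_norm// => /(_ md).
rewrite gt_eqF// => /(_ isT).
rewrite invrK /= addr0 scale0r addr0.
have -> : m.+1%:R^-1 *: (1 : R) = m.+1%:R^-1 by rewrite /GRing.scale/= mulr1.
by [].
Qed.

Lemma divergence_partial x : divergence xi x = \sum_i partial i x.
Proof. exact: divergenceE (xi_diff x). Qed.

Lemma divergence_continuous : continuous (divergence xi).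
Proof.
rewrite (_ : divergence xi = fun x => \sum_i partial i x).
  move=> x; apply: (@cvg_sum_fin R n Rn (nbhs x) _ partial (fun i => partial i x)) => i.
  exact: partial_continuous.
by apply/funext => x; exact: divergence_partial.
Qed.

Lemma divergence_out x : ~ D x -> divergence xi x = 0.
Proof.
move=> nDx; rewrite divergence_partial big1// => i _.
apply/esym; apply: (cvg_unique _ _ (@partial_quotient i x)) => //.
apply: cvg_near_cst.
have /nbhs_ballP[d /= d0 dD] : nbhs x (~` D).
  by apply: open_nbhs_nbhs; split => //; exact: closed_openC.
exists (Num.truncn d^-1) => // m /= Nm.
have m0 : 0 < m.+1%:R^-1 :> R by rewrite invr_gt0 ltr0n.
have md : m.+1%:R^-1 < d.
  by rewrite invf_plt ?posrE ?ltr0n// (lt_le_trans (truncnS_gt _))// ler_nat ltnS.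
rewrite !xi_out ?subrr ?mxE ?subrr ?mulr0//; apply: dD.
rewrite -ball_normE /= opprD addrA subrr sub0r normrN normrZ gtr0_norm//.
by rewrite (le_lt_trans _ md)// ler_piMr ?(ltW m0)// enorm_e.
Qed.

Lemma partial_bounded (rho : R) : exists2 M, 0 <= M &
  forall i x, `|x| <= rho -> `|partial i x| <= M.
Proof.
have cB : compact [set x : Rn | `|x| <= rho].
  apply: bounded_closed_compact.
    exists rho; split; first exact: num_real.
    by move=> t rt x /= xr; exact: le_trans xr (ltW rt).
  apply: (@preimage_closed Rn R (fun x => `|x|) [set t | t <= rho]); last exact: closed_le.
  by move=> x _; exact: norm_continuous_rV.
have H i : exists M, forall x, `|x| <= rho -> `|partial i x| <= M.
  have cp : compact (partial i @` [set x : Rn | `|x| <= rho]).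
    by apply: continuous_compact => //; apply: continuous_subspaceT; exact: partial_continuous.
  have [M [_ HM]] := compact_bounded cp.
  exists (M + 1) => x xr; apply: (HM (M + 1)); first by rewrite ltrDl.
  by exists x.
have [M HM] := choice H.
exists (\sum_i `|M i|); first by rewrite sumr_ge0.
move=> i x xr; rewrite (le_trans (HM i x xr))// (le_trans (ler_norm _))//.
by rewrite (bigD1 i)//= lerDl sumr_ge0.
Qed.

Lemma xi_line_lipschitz (rho M : R) : (forall i x, `|x| <= rho + 1 -> `|partial i x| <= M) ->
  forall i x h, 0 <= h <= 1 -> `|x| <= rho -> `|xi (x + h *: e_ R i) ord0 i - xi x ord0 i| <= M * h.
Proof.
move=> pM i x h /andP[h0 h1] xr.
have [||c] := @MVT_segment R (fun u : R => xi (x + u *: e_ R i) ord0 i) (fun t => partial i (x + t *: e_ R i)) 0 h h0.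
- by move=> t _; exact: xi_line_derive.
- apply: continuous_subspaceT => t; apply: differentiable_continuous.
  by apply/derivable1_diffP; have [] := xi_line_derive i x t.
- rewrite in_itv/= scale0r addr0 => /andP[c0 ch] ->.
  rewrite subr0 normrM (ger0_norm h0) ler_wpM2r// pM//.
  rewrite (le_trans (ler_normD _ _))// lerD// normrZ ger0_norm//.
  by rewrite (le_trans _ (le_trans ch h1))// ler_piMr// enorm_e.
Qed.

Variables (p : Rn) (r delta : R).
Hypotheses (r0 : 0 < r) (delta0 : 0 < delta).

Definition ball_cutoff (x : Rn) : R := clamp 0 1 ((r + delta - enorm (x - p)) / delta).

Lemma ball_cutoff01 x : 0 <= ball_cutoff x <= 1.
Proof. exact: clamp01. Qed.

Lemma ball_cutoff_norm x : `|ball_cutoff x| <= 1.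
Proof. by have /andP[a b] := ball_cutoff01 x; rewrite ger0_norm. Qed.

Lemma ball_cutoff_in x : enorm (x - p) <= r -> ball_cutoff x = 1.
Proof.
by move=> xr; rewrite /ball_cutoff /clamp min_l ?max_r// ler_pdivlMr//; lra.
Qed.

Lemma ball_cutoff_out x : r + delta <= enorm (x - p) -> ball_cutoff x = 0.
Proof.
move=> xr; rewrite /ball_cutoff /clamp max_l// ge_min; apply/orP; right.
by rewrite ler_pdivrMr// mul0r subr_le0.
Qed.

Lemma ball_cutoff_far x : r + delta + `|p| < `|x| -> ball_cutoff x = 0.
Proof.
move=> xr; apply: ball_cutoff_out; rewrite leNgt; apply/negP => /ltW /eball_norm.
by rewrite leNgt xr.
Qed.

Lemma measurable_ball_cutoff : measurable_fun setT (ball_cutoff : borel_rV R n -> R).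
Proof.
apply: measurable_maxr; first exact: measurable_cst.
apply: measurable_minr; last first.
  apply: measurable_funM; last exact: measurable_cst.
  apply: measurable_funB; first exact: measurable_cst.
  exact: (continuous_measurable_rV (@enorm_shift_continuous R n p)).
exact: measurable_cst.
Qed.

Lemma clamp_dist (a b s t : R) : `|clamp a b s - clamp a b t| <= `|s - t|.
Proof.
wlog st : s t / s <= t => [H|].
  have [/H//|/ltW/H] := leP s t; by rewrite distrC [leRHS]distrC.
rewrite distrC [leRHS]distrC !ger0_norm ?subr_ge0 ?clamp_le//.
have ts : 0 <= t - s by rewrite subr_ge0.
have := clamp_lip t ts a b; rewrite subKr; lra.
Qed.

Lemma ball_cutoff_lip x y :
  `|ball_cutoff x - ball_cutoff y| <= `|enorm (x - p) - enorm (y - p)| / delta.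
Proof.
rewrite (le_trans (clamp_dist _ _ _ _))// -mulrBl normrM (gtr0_norm (_ : 0 < delta^-1)) ?invr_gt0//.
by rewrite ler_pM2r ?invr_gt0// distrC opprB addrC addrA subrK.
Qed.

(** The first-order change of the norm is [h * u_i / |u|]. With [A] and [B] the two norms,
    [(A - B) * (A + B) = - 2 h u_i + h ^+ 2] and [A + B >= 2 * B - h]; the condition [r <= 2 * B]
    turns the errors into multiples of [h / r]. *)
Lemma enorm_step (u : Rn) i h : 0 < h -> 2 * h <= r -> r <= 2 * enorm u ->
  `|enorm (u - h *: e_ R i) - enorm u| <=
  h * (`|u ord0 i| / enorm u + h / r) / (1 - h / r).
Proof.
move=> h0 hr ur; set B := enorm u in ur *.
set A := enorm (u - _).
have B0 : 0 < B by rewrite -(@ltr_pM2l _ 2)// mulr0 (lt_le_trans r0).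
have A0 : 0 <= A by exact: enorm_ge0.
have sq : A ^+ 2 - B ^+ 2 = - (2 * h * u ord0 i) + h ^+ 2.
  rewrite !enorm_sqr -sumrB (bigD1 i)//= big1 ?addr0; last first.
    by move=> j ji; rewrite !mxE eqxx (negbTE ji) mulr0 subr0 subrr.
  by rewrite !mxE !eqxx mulr1; ring.
have eh : enorm (h *: e_ R i : Rn) = h.
  rewrite enormZ gtr0_norm// -[RHS]mulr1; congr (_ * _).
  rewrite -[LHS]ger0_norm ?enorm_ge0// -sqrtr_sqr enorm_sqr (bigD1 i)//= big1 ?addr0.
    by rewrite e_E eqxx expr1n sqrtr1.
  by move=> j ji; rewrite e_E (negbTE ji) expr0n.
have AB : B - h <= A.
  rewrite lerBlDr -[in leRHS]eh -[B]/(enorm u) -[in leLHS](subrK (h *: e_ R i) u).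
  exact: ler_enormD.
have hr1 : 0 < 1 - h / r by rewrite subr_gt0 ltr_pdivrMr// mul1r; lra.
rewrite ler_pdivlMr//.
have H1 : `|A - B| * (2 * B - h) <= 2 * h * `|u ord0 i| + h ^+ 2.
  apply: (@le_trans _ _ (`|A - B| * (A + B))).
    by rewrite ler_wpM2l//; lra.
  have AB0 : 0 <= A + B by rewrite addr_ge0// ltW.
  rewrite -[A + B](ger0_norm AB0) -normrM.
  rewrite (_ : (A - B) * (A + B) = A ^+ 2 - B ^+ 2); last by ring.
  rewrite sq (le_trans (ler_normD _ _))// normrN (@ger0_norm _ (h ^+ 2)) ?sqr_ge0// lerD2r.
  by rewrite !normrM (gtr0_norm h0) ger0_norm.
rewrite -(@ler_pM2r _ (2 * B)) ?mulr_gt0//.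
apply: (@le_trans _ _ (`|A - B| * (2 * B - h))).
  rewrite -mulrA ler_wpM2l// mulrBl mul1r lerD2l lerN2 mulrAC ler_pdivlMr// ler_pM2l//.
apply: (le_trans H1).
rewrite (_ : h * _ * _ = 2 * h * `|u ord0 i| + h * h * (2 * B / r)); last first.
  by field; rewrite !gt_eqF.
by rewrite lerD2l expr2 ler_peMr ?mulr_ge0 ?(ltW h0)// ler_pdivlMr// mul1r.
Qed.

(** In [D] but off this set the cutoff has equal values at [x] and at [x - h *: e_ R i]. *)
Definition shell (h : R) : set Rn := (D `&` eball p (r + delta + h)) `\` eball p (r - 2 * h).

(** Collects the relative errors of [enorm_step] over the [n] directions; it tends to 1 with [h]. *)
Definition shell_const (h : R) : R := (1 + n%:R * (h / r)) / (1 - h / r).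

(** The main terms add up to the sum of [|xi_i| * |u_i| / |u|]. Cauchy-Schwarz bounds it by 1, as
    [xi] and [u / |u|] have norm at most 1; bounding each coordinate apart would cost a dimensional
    factor. *)
Lemma cutoff_flux h x : 0 < h -> 4 * h <= r ->
  \sum_i xi x ord0 i * (ball_cutoff (x - h *: e_ R i) - ball_cutoff x) <=
  h / delta * shell_const h * \1_(shell h) x.
Proof.
move=> h0 hr.
have hr1 : 0 < 1 - h / r by rewrite subr_gt0 ltr_pdivrMr// mul1r; lra.
have sc0 : 0 <= shell_const h.
  apply: divr_ge0; last exact: ltW.
  by apply: addr_ge0 => //; apply: mulr_ge0 => //; apply: divr_ge0; exact: ltW.
have rhs0 : 0 <= h / delta * shell_const h * \1_(shell h) x.
  apply: mulr_ge0; last by [].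
  by apply: mulr_ge0 => //; apply: divr_ge0; exact: ltW.
have eh i : enorm (h *: e_ R i : Rn) <= h.
  rewrite enormZ gtr0_norm// ler_piMr ?(ltW h0)//.
  rewrite -[leLHS]ger0_norm ?enorm_ge0// -sqrtr_sqr enorm_sqr (bigD1 i)//= big1 ?addr0.
    by rewrite e_E eqxx expr1n sqrtr1.
  by move=> j ji; rewrite e_E (negbTE ji) expr0n.
have step1 i : enorm (x - h *: e_ R i - p) <= enorm (x - p) + h.
  rewrite addrAC (le_trans (ler_enormD _ _))// lerD2l enormN; exact: eh.
have step2 i : enorm (x - p) - h <= enorm (x - h *: e_ R i - p).
  rewrite lerBlDr -[in leLHS](subrK (h *: e_ R i) x) addrAC (le_trans (ler_enormD _ _))// lerD2l.
  exact: eh.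
have [Dx|nDx] := pselect (D x); last first.
  by rewrite (le_trans _ rhs0)// big1// => i _; rewrite xi_out// mxE mul0r.
have [xin|xin] := leP (enorm (x - p)) (r - 2 * h).
  rewrite (le_trans _ rhs0)// big1// => i _.
  rewrite !ball_cutoff_in ?subrr ?mulr0//; first by lra.
  by rewrite (le_trans (step1 i))//; lra.
have [xout|xout] := leP (enorm (x - p)) (r + delta + h); last first.
  rewrite (le_trans _ rhs0)// big1// => i _.
  rewrite !ball_cutoff_out ?subrr ?mulr0//; first by lra.
  by rewrite (le_trans _ (step2 i))//; lra.
have xS : x \in shell h.
  by rewrite inE; split => //; rewrite /eball/= => /(lt_le_trans xin); rewrite ltxx.
rewrite indicE xS mulr1.
set u := x - p in xin xout *.
have ur : r <= 2 * enorm u by lra.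
have B0 : 0 < enorm u by rewrite -(@ltr_pM2l _ 2)// mulr0 (lt_le_trans r0).
pose k := h / delta / (1 - h / r).
have k0 : 0 <= k by apply: divr_ge0; [apply: divr_ge0; exact: ltW|exact: ltW].
have [_ _ _ /(_ x) xi1] := txi.
have xii i : `|xi x ord0 i| <= 1 by exact: le_trans (coord_le_enorm _ _) xi1.
apply: (@le_trans _ _ (\sum_i k * (`|xi x ord0 i| * (`|u ord0 i| / enorm u) + h / r))).
  apply: ler_sum => i _; rewrite (le_trans (ler_norm _))// normrM.
  apply: (@le_trans _ _ (`|xi x ord0 i| * (k * (`|u ord0 i| / enorm u + h / r)))).
    rewrite ler_wpM2l// (le_trans (ball_cutoff_lip _ _))//.
    rewrite addrAC -/u ler_pdivrMr// (le_trans (enorm_step _ h0 _ ur))//; first by lra.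
    rewrite /k le_eqVlt; apply/orP; left; apply/eqP; field.
    by rewrite !gt_eqF// subr_gt0; lra.
  rewrite mulrCA ler_wpM2l// mulrDr lerD2l ler_piMl// divr_ge0// ltW//.
rewrite -mulr_sumr big_split/= sumr_const card_ord -mulr_natl.
rewrite (_ : h / delta * shell_const h = k * (1 + n%:R * (h / r))); last first.
  by rewrite /k /shell_const; ring.
rewrite ler_wpM2l// lerD2r.
apply: (@le_trans _ _ (enorm (xi x) * enorm ((enorm u)^-1 *: u))).
  apply: cauchy_schwarz => i; rewrite [(_ *: u) _ _]mxE normrM gtr0_norm ?invr_gt0//.
  by rewrite [_^-1 * _]mulrC.
by rewrite enormZ gtr0_norm ?invr_gt0// mulVf ?gt_eqF// mulr1.
Qed.

Let rho := r + delta + `|p|.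

Let rho_ge0 : 0 <= rho.
Proof. by rewrite !addr_ge0// ltW. Qed.

Lemma cutoff_integrable (g : Rn -> R) (M : R) :
  measurable_fun setT (g : borel_rV R n -> R) ->
  (forall x, `|x| <= rho -> `|g x| <= M) -> 0 <= M ->
  mu.-integrable setT (EFin \o ((fun x => ball_cutoff x * g x) : borel_rV R n -> R)).
Proof.
move=> mg gM M0; apply: (@integrable_bounded_support R n _ M rho).
- by apply: measurable_funM => //; exact: measurable_ball_cutoff.
- move=> x; have [xr|xr] := leP `|x| rho.
    by rewrite normrM -[leRHS]mul1r ler_pM ?ball_cutoff_norm ?gM.
  by rewrite ball_cutoff_far// mul0r normr0.
- by move=> x xr; rewrite ball_cutoff_far// mul0r.
Qed.

Let xi_norm1 x i : `|xi x ord0 i| <= 1.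
Proof. by have [_ _ _ xi1] := txi; exact: le_trans (coord_le_enorm _ _) (xi1 x). Qed.

Let mxi i : measurable_fun setT ((fun x => xi x ord0 i) : borel_rV R n -> R).
Proof. exact: (continuous_measurable_rV (@xi_coord_continuous i)). Qed.

Lemma measurable_shell h : measurable (shell h : set (borel_rV R n)).
Proof.
apply: measurableD; first exact: measurable_ball_sect.
by apply: closed_measurable_rV; exact: eball_closed.
Qed.

Lemma shell_measure h : 0 <= h -> (mu (shell h) <= (ball_vol D p (r + delta + h) - ball_vol D p (r - 2 * h))%:E)%E.
Proof.
move=> h0; rewrite EFinB -!ball_volE//.
have sE : shell h = (D `&` eball p (r + delta + h)) `\` (D `&` eball p (r - 2 * h)).
  by apply/seteqP; split=> x [[Dx xr] nx]; split => //; [move=> []|move=> xx; apply: nx].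
have mm := @measurable_ball_sect R n D p.
have fin : (mu (D `&` eball p (r + delta + h)) < +oo)%E by rewrite ball_volE// ltry.
have sI : (D `&` eball p (r + delta + h)) `&` (D `&` eball p (r - 2 * h)) = D `&` eball p (r - 2 * h).
  apply/setIidPr => x [Dx xr]; split => //.
  by rewrite /eball/= (le_trans xr)//; have := ltW delta0; lra.
have E : mu (shell h) = (mu (D `&` eball p (r + delta + h)) - mu ((D `&` eball p (r + delta + h)) `&` (D `&` eball p (r - 2 * h))))%E.
  by rewrite sE; apply: measureD => //; exact: mm.
by rewrite E sI.
Qed.

(* The difference quotient is moved from [xi] to the cutoff, whose slope is at
   most [1 / delta] and supported in a shell. *)
Lemma cutoff_quotient_le h : 0 < h -> 4 * h <= r ->
  \sum_i \int[mu]_x (ball_cutoff x * (h^-1 * (xi (x + h *: e_ R i) ord0 i - xi x ord0 i))) <=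
  delta^-1 * shell_const h * (ball_vol D p (r + delta + h) - ball_vol D p (r - 2 * h)).
Proof.
move=> h0 hr.
have mxih i : measurable_fun setT ((fun x => xi (h *: e_ R i + x) ord0 i) : borel_rV R n -> R).
  exact: (@measurable_fun_comp_shift R n _ (fun x => xi x ord0 i) (mxi i)).
have iA i : mu.-integrable setT (EFin \o ((fun x => ball_cutoff x * xi (h *: e_ R i + x) ord0 i) : borel_rV R n -> R)).
  by apply: (@cutoff_integrable _ 1).
have iB i : mu.-integrable setT (EFin \o ((fun x => ball_cutoff x * xi x ord0 i) : borel_rV R n -> R)).
  by apply: (@cutoff_integrable _ 1).
have mbh i : measurable_fun setT ((fun x => ball_cutoff (- (h *: e_ R i) + x)) : borel_rV R n -> R).
  exact: (measurable_fun_comp_shift _ measurable_ball_cutoff).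
have he i : `|h *: e_ R i : Rn| <= h by rewrite normrZ gtr0_norm// ler_piMr ?(ltW h0)// enorm_e.
have iC i : mu.-integrable setT (EFin \o ((fun x => ball_cutoff (- (h *: e_ R i) + x) * xi x ord0 i) : borel_rV R n -> R)).
  apply: (@integrable_bounded_support R n _ 1 (rho + h)).
  - exact: measurable_funM.
  - by move=> x; rewrite normrM mulr_ile1 ?ball_cutoff_norm.
  - move=> x xr; rewrite ball_cutoff_far ?mul0r// -/rho.
    rewrite -(ltrD2r h); apply: lt_le_trans xr _.
    have := ler_normD (h *: e_ R i) (- (h *: e_ R i) + x).
    by rewrite addNKr addrC => /le_trans; apply; rewrite lerD2l.
(* Discrete integration by parts: translation invariance of the measure replaces the vanishing of
   boundary terms. *)
have E i : \int[mu]_x (ball_cutoff x * (h^-1 * (xi (x + h *: e_ R i) ord0 i - xi x ord0 i))) =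
    h^-1 * \int[mu]_x (xi x ord0 i * (ball_cutoff (x - h *: e_ R i) - ball_cutoff x)).
  transitivity (h^-1 * (\int[mu]_x (ball_cutoff x * xi (h *: e_ R i + x) ord0 i) - \int[mu]_x (ball_cutoff x * xi x ord0 i))).
    rewrite -RintegralB// -RintegralZl//; last exact: (integrableB measurableT (iA i) (iB i)).
    by apply: eq_Rintegral => x _ /=; rewrite [h *: _ + x]addrC; ring.
  congr (_ * _); have S : \int[mu]_x (ball_cutoff x * xi (h *: e_ R i + x) ord0 i) =
     \int[mu]_x (ball_cutoff (- (h *: e_ R i) + x) * xi x ord0 i).
    rewrite -[RHS](@integral_shift R n (h *: e_ R i)).
    + by apply: eq_Rintegral => x _; rewrite addKr.
    + exact: measurable_funM.
    + by move: (iA i); congr (_.-integrable _ _); apply/funext => x /=; rewrite addKr.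
  rewrite S -RintegralB//; apply: eq_Rintegral => x _.
  by rewrite [- _ + x]addrC; ring.
rewrite (eq_bigr _ (fun i _ => E i)) -mulr_sumr.
have iD i : mu.-integrable setT (EFin \o ((fun x => xi x ord0 i * (ball_cutoff (x - h *: e_ R i) - ball_cutoff x)) : borel_rV R n -> R)).
  have := integrableB measurableT (iC i) (iB i); congr (_.-integrable _ _).
  by apply/funext => x /=; rewrite -EFinB [- _ + x]addrC; congr EFin; ring.
have [si <-] := Rintegral_sum iD.
have Sfin : (mu (shell h) < +oo)%E.
  by apply: le_lt_trans (shell_measure (ltW h0)) _; rewrite ltry.
have mS := measurable_shell h.
have sc : h / delta * shell_const h * fine (mu (shell h)) = \int[mu]_x (h / delta * shell_const h * \1_(shell h) x).
  rewrite RintegralZl//; last exact: integrable_indic_finite.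
  by rewrite /Rintegral integral_indic// setIT.
apply: (@le_trans _ _ (h^-1 * (h / delta * shell_const h * fine (mu (shell h))))).
  rewrite ler_pM2l ?invr_gt0// sc; apply: le_Rintegral => //.
    exact: (integrableZl measurableT _ (integrable_indic_finite mS Sfin)).
  by move=> x _; exact: cutoff_flux.
have hr1 : 0 < 1 - h / r by rewrite subr_gt0 ltr_pdivrMr// mul1r; lra.
rewrite (_ : h^-1 * _ = delta^-1 * shell_const h * fine (mu (shell h))); last first.
  by rewrite /shell_const; field; rewrite !gt_eqF// subr_gt0; lra.
apply: ler_wpM2l.
  apply: mulr_ge0; first by rewrite invr_ge0 ltW.
  apply: divr_ge0; last exact: ltW.
  by apply: addr_ge0 => //; apply: mulr_ge0 => //; apply: divr_ge0; exact: ltW.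
rewrite -lee_fin fineK; first exact: shell_measure (ltW h0).
by rewrite ge0_fin_numE.
Qed.

(** The quotients are bounded on the support of the cutoff by a bound for the partial derivatives on
    a ball of radius larger by 1, which contains the segments of length at most 1; this dominates
    the limit. *)
Lemma cutoff_divergence_limit :
  (fun m : nat => \sum_i \int[mu]_x (ball_cutoff x *
     (m.+1%:R * (xi (x + m.+1%:R^-1 *: e_ R i) ord0 i - xi x ord0 i)))) @ \oo -->
  \int[mu]_x (ball_cutoff x * divergence xi x).
Proof.
have [M M0 pM] := partial_bounded (rho + 1).
have mxih i m : measurable_fun setT ((fun x => m.+1%:R * (xi (x + m.+1%:R^-1 *: e_ R i) ord0 i - xi x ord0 i)) : borel_rV R n -> R).
  apply: measurable_funM; first exact: measurable_cst.
  apply: measurable_funB => //.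
  rewrite (_ : (fun x => _) = (fun x : borel_rV R n => xi (m.+1%:R^-1 *: e_ R i + x) ord0 i)).
    exact: (@measurable_fun_comp_shift R n _ (fun x => xi x ord0 i) (mxi i)).
  by apply/funext => x; rewrite addrC.
have bq i m x : `|x| <= rho -> `|m.+1%:R * (xi (x + m.+1%:R^-1 *: e_ R i) ord0 i - xi x ord0 i)| <= M.
  move=> xr; rewrite normrM ger0_norm//.
  rewrite -ler_pdivlMl ?ltr0n// mulrC (xi_line_lipschitz pM)//.
  by rewrite invr_ge0 ler0n/= invf_le1 ?ltr0n// ler1n.
have mpart i : measurable_fun setT (partial i : borel_rV R n -> R).
  exact: (continuous_measurable_rV (@partial_continuous i)).
have bp i x : `|x| <= rho -> `|partial i x| <= M.
  by move=> xr; apply: pM; rewrite (le_trans xr)// lerDl.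
have ip i : mu.-integrable setT (EFin \o ((fun x => ball_cutoff x * partial i x) : borel_rV R n -> R)).
  by apply: (@cutoff_integrable _ M) => //; exact: bp.
have iq i m : mu.-integrable setT (EFin \o ((fun x => ball_cutoff x *
     (m.+1%:R * (xi (x + m.+1%:R^-1 *: e_ R i) ord0 i - xi x ord0 i))) : borel_rV R n -> R)).
  by apply: (@cutoff_integrable _ M) => //; exact: bq.
have [si sE] := Rintegral_sum ip.
have -> : \int[mu]_x (ball_cutoff x * divergence xi x) = \sum_i \int[mu]_x (ball_cutoff x * partial i x).
  rewrite -sE; apply: eq_Rintegral => x _.
  by rewrite divergence_partial mulr_sumr.
apply: (@cvg_sum_fin R n nat \oo _ (fun i m => \int[mu]_x (ball_cutoff x *
     (m.+1%:R * (xi (x + m.+1%:R^-1 *: e_ R i) ord0 i - xi x ord0 i))))) => i.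
have [] := @dominated_convergence _ _ R mu setT measurableT
  (fun m => EFin \o ((fun x => ball_cutoff x *
     (m.+1%:R * (xi (x + m.+1%:R^-1 *: e_ R i) ord0 i - xi x ord0 i))) : borel_rV R n -> R))
  (EFin \o ((fun x => ball_cutoff x * partial i x) : borel_rV R n -> R))
  (EFin \o ((fun x => ball_cutoff x * M) : borel_rV R n -> R)).
- by move=> m; exact: (measurable_int _ (iq i m)).
- exact: (measurable_int _ (ip i)).
- apply: aeW => x _ /=; apply: cvg_EFin; first exact: nearW.
  by apply: cvgMr; exact: partial_quotient.
- apply: (@cutoff_integrable _ M) => //.
  by move=> x _; rewrite ger0_norm.
- apply: aeW => x m _ /=; rewrite lee_fin normrM.
  have [xr|xr] := leP `|x| rho.
    have /andP[b0 _] := ball_cutoff01 x.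
    by rewrite ger0_norm// ler_wpM2l// bq.
  by rewrite ball_cutoff_far// normr0 !mul0r.
move=> _ _ H.
have fin := integrable_fin_num measurableT (ip i).
by apply: fine_cvg; rewrite fineK.
Qed.

End UpperBound.

(** * Limits in the step and in the shell width *)

Section BallPerimeter.
Variables (R : realType) (n : nat).
Local Notation Rn := 'rV[R]_n.
Local Notation mu := (borel_lebesgue R n).
Variables (D : set Rn) (p : Rn).
Hypotheses (clD : closed D) (cD : convex_set D) (Dp : D p).
Local Notation f := (ball_vol D p).

(** The finite form of the differential inequality for the volume of balls in [D]. *)
Lemma ball_vol_increment r s : 0 < r -> r <= s ->
  f s - f r <= n%:R * ((s - r) / r) * ((s / r) ^+ n * f r).
Proof.
move=> r0 rs; have x1 : 1 <= s / r by rewrite ler_pdivlMr// mul1r.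
have f0 := ball_vol_ge0 D p r.
rewrite (_ : (s - r) / r = s / r - 1); last by field; rewrite gt_eqF.
apply: (@le_trans _ _ (((s / r) ^+ n - 1) * f r)).
  by rewrite mulrBl mul1r lerD2r ball_vol_growth.
by rewrite mulrA ler_wpM2r// exprn_growth.
Qed.

Variable xi : Rn -> Rn.
Hypothesis txi : test_field D xi.

Lemma cutoff_divergence_le r delta : 0 < r -> 0 < delta ->
  \int[mu]_x (ball_cutoff p r delta x * divergence xi x) <=
  n%:R * f r / r * (1 + delta / r) ^+ n.
Proof.
move=> r0 d0.
pose h (m : nat) : R := m.+1%:R^-1.
have h0 : h @ \oo --> (0 : R) by exact: cvg_harmonic.
have lin a c : (fun m => a + c * h m) @ \oo --> (a : R).
  rewrite -[X in _ --> X]addr0 -[X in _ + X](mulr0 c).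
  by apply: cvgD; [exact: cvg_cst|apply: cvgM => //; exact: cvg_cst].
(* An explicit majorant of the [m]-th quotient, from [cutoff_quotient_le] and [ball_vol_increment]
   with [f (r - 2 * h m)] replaced by [f r]. Its factors are affine in [h m], so that [lin] yields
   the limit. *)
pose G m := delta^-1 * ((1 + n%:R / r * h m) * (1 + - r^-1 * h m)^-1) *
  (n%:R * ((delta + 3 * h m) * (r + - 2 * h m)^-1) *
    (((r + delta + 1 * h m) * (r + - 2 * h m)^-1) ^+ n * f r)).
have Gc : G @ \oo --> delta^-1 * (1 * 1^-1) * (n%:R * (delta * r^-1) * (((r + delta) * r^-1) ^+ n * f r)).
  have rc : (fun m => (r + - 2 * h m)^-1) @ \oo --> r^-1.
    by apply: cvgV; [rewrite gt_eqF|exact: lin].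
  apply: cvgM.
    apply: cvgM; first exact: cvg_cst.
    apply: cvgM; first exact: lin.
    by apply: cvgV; [rewrite oner_eq0|exact: lin].
  apply: cvgM.
    apply: cvgM; first exact: cvg_cst.
    by apply: cvgM; first exact: lin.
  apply: cvgM; last exact: cvg_cst.
  apply: (@cvg_comp _ _ _ (fun m => (r + delta + 1 * h m) * (r + - 2 * h m)^-1) (fun x => x ^+ n)
     _ (nbhs ((r + delta) * r^-1))); last exact: exprn_continuous.
  by apply: cvgM => //; exact: lin.
rewrite (_ : n%:R * f r / r * _ = delta^-1 * (1 * 1^-1) * (n%:R * (delta * r^-1) * (((r + delta) * r^-1) ^+ n * f r))); last first.
  rewrite (_ : (r + delta) * r^-1 = 1 + delta / r); last by field; rewrite gt_eqF.
  by field; rewrite !gt_eqF.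
apply: (@ler_cvg_to nat \oo _ R _ G _ _ (cutoff_divergence_limit txi d0) Gc).
have [N _ hN] : \forall m \near \oo, h m < r / 4.
  by apply: (cvgr_lt 0 h0); rewrite divr_gt0.
exists N => // m /hN/= hm.
have hm0 : 0 < h m by rewrite invr_gt0 ltr0n.
have hr : 4 * h m <= r by rewrite mulrC -ler_pdivlMr// ltW.
have := cutoff_quotient_le clD txi p r0 d0 hm0 hr.
rewrite {1}/h invrK => /le_trans; apply.
have hr1 : 0 < 1 - h m / r by rewrite subr_gt0 ltr_pdivrMr// mul1r; lra.
have r2 : 0 < r - 2 * h m by lra.
rewrite /G /shell_const.
rewrite (_ : (1 + n%:R * _) / _ = (1 + n%:R / r * h m) * (1 + - r^-1 * h m)^-1); last first.
  by congr (_ * _^-1); ring.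
apply: ler_wpM2l.
  apply: mulr_ge0; first by rewrite invr_ge0 ltW.
  apply: mulr_ge0.
    by apply: addr_ge0 => //; apply: mulr_ge0; [apply: divr_ge0 => //; exact: ltW|exact: ltW].
  by rewrite invr_ge0 mulNr mulrC ltW.
have rs : r - 2 * h m <= r + delta + h m by lra.
apply: (le_trans (ball_vol_increment r2 rs)).
rewrite mulNr mul1r (_ : r + delta + h m - (r - 2 * h m) = delta + 3 * h m); last by ring.
apply: ler_wpM2l.
  by apply: mulr_ge0 => //; apply: divr_ge0; [lra|exact: ltW].
apply: ler_wpM2l.
  by apply: exprn_ge0; apply: divr_ge0; [lra|exact: ltW].
by apply: ball_vol_le => //; lra.
Qed.

Lemma divergence_bounded (rho M : R) x :
  (forall i x, `|x| <= rho -> `|partial xi i x| <= M) ->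
  `|x| <= rho -> `|divergence xi x| <= n%:R * M.
Proof.
move=> pM xr; rewrite (divergence_partial txi) (le_trans (ler_norm_sum _ _ _))//.
rewrite mulr_natl -[X in _ <= M *+ X]card_ord -sumr_const ler_sum// => i _; exact: pM.
Qed.

Lemma divergence_ball_integrable r : 0 <= r ->
  mu.-integrable (D `&` eball p r) (EFin \o (divergence xi : borel_rV R n -> R)).
Proof.
move=> r0; have [M M0 pM] := partial_bounded txi (r + `|p|).
have mE : measurable (D `&` eball p r : set (borel_rV R n)) by exact: measurable_ball_sect.
apply/(integrable_mkcond _ mE).
rewrite restrict_EFin; apply: (@integrable_bounded_support R n _ (n%:R * M) (r + `|p|)).
- apply/(measurable_restrictT _ mE); apply: measurable_funTS.
  exact: continuous_measurable_rV (divergence_continuous txi).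
- move=> x; rewrite patchE; case: ifPn => [|_]; last by rewrite normr0 mulr_ge0.
  rewrite inE => -[_ /eball_norm]; exact: divergence_bounded.
- move=> x xr; rewrite patchE; case: ifPn => //.
  by rewrite inE => -[_ /eball_norm]; rewrite leNgt xr.
Qed.

(** The cutoff differs from the indicator of the ball only in a shell of width [delta]. The
    divergence is bounded there and the volume of the shell in [D] is of order [delta], so the error
    vanishes with [delta]. *)
Lemma ball_divergence_le r : 0 < r ->
  \int[mu]_(x in D `&` eball p r) divergence xi x <= n%:R * f r / r.
Proof.
move=> r0.
have [M M0 pM] := partial_bounded txi (r + 1 + `|p|).
pose c0 := n%:R * f r / r.
have f0 := ball_vol_ge0 D p r.
have mdiv : measurable_fun setT (divergence xi : borel_rV R n -> R).
  exact: continuous_measurable_rV (divergence_continuous txi).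
have bdiv x : `|x| <= r + 1 + `|p| -> `|divergence xi x| <= n%:R * M by exact: divergence_bounded.
have mE : measurable (D `&` eball p r : set (borel_rV R n)) by exact: measurable_ball_sect.
have nM0 : 0 <= n%:R * M by exact: mulr_ge0.
have key delta : 0 < delta -> delta <= 1 ->
    \int[mu]_(x in D `&` eball p r) divergence xi x <= c0 * (1 + n%:R * M * delta) * (1 + delta / r) ^+ n.
  move=> d0 d1.
  (* With step 0 this is the exact set between the radii [r] and [r + delta]. *)
  pose S := shell D p r delta 0.
  have mS : measurable (S : set (borel_rV R n)) by exact: (measurable_shell clD p r delta 0).
  have S_le : (mu S <= (f (r + delta) - f r)%:E)%E.
    have := shell_measure clD p r d0 (lexx 0).
    by rewrite mulr0 subr0 addr0.
  have Sfin : (mu S < +oo)%E by apply: le_lt_trans S_le _; rewrite ltry.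
  have iS := integrable_indic_finite mS Sfin.
  have ic : mu.-integrable setT (EFin \o ((fun x => ball_cutoff p r delta x * divergence xi x) : borel_rV R n -> R)).
    apply: (@cutoff_integrable R n p r delta d0 _ (n%:R * M)) => // x xr.
    by apply: bdiv; apply: le_trans xr _; rewrite lerD2r lerD2l.
  have iMS := integrableZl measurableT (n%:R * M) iS.
  have iE : mu.-integrable setT (EFin \o ((divergence xi \_ (D `&` eball p r)) : borel_rV R n -> R)).
    by rewrite -restrict_EFin; apply/(integrable_mkcond _ mE)/divergence_ball_integrable/ltW.
  rewrite Rintegral_mkcond.
  apply: (@le_trans _ _ (\int[mu]_x (ball_cutoff p r delta x * divergence xi x + n%:R * M * \1_S x))).
    apply: le_Rintegral => //; first exact: (integrableD measurableT ic iMS).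
    move=> x _; rewrite patchE; case: ifPn => [|xE].
      rewrite inE => -[Dx xr]; rewrite ball_cutoff_in// mul1r lerDl.
      by apply: mulr_ge0.
    have [Dx|nDx] := pselect (D x); last first.
      by rewrite (divergence_out clD txi nDx) mulr0 add0r; apply: mulr_ge0.
    have [xo|xi1] := leP (r + delta) (enorm (x - p)).
      by rewrite ball_cutoff_out// mul0r add0r; apply: mulr_ge0.
    have xS : x \in S.
      rewrite inE; split; first by split => //; rewrite /eball/= addr0 ltW.
      by rewrite mulr0 subr0 => xr; move/negP: xE; apply; rewrite inE.
    rewrite indicE xS mulr1.
    have xrho : `|x| <= r + 1 + `|p|.
      by apply: eball_norm; rewrite /eball/= (le_trans (ltW xi1))// lerD2l.
    rewrite -lerBlDl sub0r (le_trans _ (_ : `|ball_cutoff p r delta x * divergence xi x| <= _))//.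
      by rewrite -normrN ler_norm.
    by rewrite normrM -[leRHS]mul1r ler_pM ?ball_cutoff_norm ?bdiv.
  rewrite RintegralD// RintegralZl//.
  have -> : \int[mu]_x \1_S x = fine (mu S) by rewrite /Rintegral integral_indic// setIT.
  have inc : fine (mu S) <= c0 * delta * (1 + delta / r) ^+ n.
    rewrite -lee_fin fineK ?ge0_fin_numE//; apply: le_trans S_le _; rewrite lee_fin.
    have rd : r <= r + delta by rewrite lerDl ltW.
    apply: (le_trans (ball_vol_increment r0 rd)).
    rewrite (_ : (r + delta) / r = 1 + delta / r); last by field; rewrite gt_eqF.
    rewrite le_eqVlt; apply/orP; left; apply/eqP; rewrite /c0; field.
    by rewrite gt_eqF.
  apply: (le_trans (lerD (cutoff_divergence_le r0 d0) (ler_wpM2l nM0 inc))).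
  by rewrite le_eqVlt; apply/orP; left; apply/eqP; rewrite -/c0; ring.
pose h (m : nat) : R := m.+1%:R^-1.
have h0 : h @ \oo --> (0 : R) by exact: cvg_harmonic.
have lin a c : (fun m => a + c * h m) @ \oo --> (a : R).
  rewrite -[X in _ --> X]addr0 -[X in _ + X](mulr0 c).
  by apply: cvgD; [exact: cvg_cst|apply: cvgM => //; exact: cvg_cst].
have Gc : (fun m => c0 * (1 + n%:R * M * h m) * (1 + r^-1 * h m) ^+ n) @ \oo --> c0 * 1 * 1 ^+ n.
  apply: cvgM.
    by apply: cvgM; [exact: cvg_cst|exact: lin].
  apply: (@cvg_comp _ _ _ (fun m => 1 + r^-1 * h m) (fun x => x ^+ n) _ (nbhs (1:R))).
    exact: lin.
  exact: exprn_continuous.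
rewrite -/c0 -[leRHS]mulr1 -[X in _ * X](expr1n R n) -[X in X * _]mulr1.
apply: (cvgr_to_ge Gc); apply: nearW => m.
rewrite [r^-1 * _]mulrC; apply: key; rewrite /h ?invr_gt0 ?ltr0n//.
by rewrite invf_le1 ?ltr0n// ler1n.
Qed.

End BallPerimeter.

Lemma perimeter_ball_le (R : realType) (n : nat) (D : set 'rV[R]_n) (p : 'rV[R]_n) (r : R) :
  closed D -> convex_set D -> D p -> 0 < r ->
  (perimeter D (D `&` eball p r) <= (n%:R * ball_vol D p r / r)%:E)%E.
Proof.
move=> clD cD Dp r0; apply: ge_ereal_sup => _ [xi txi <-].
have mE : measurable (D `&` eball p r : set (borel_rV R n)) by exact: measurable_ball_sect.
have mdiv : measurable_fun setT (divergence xi : borel_rV R n -> R).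
  exact: continuous_measurable_rV (divergence_continuous txi).
have iE := divergence_ball_integrable p clD txi (ltW r0).
rewrite integral_volume// -[leLHS]fineK; last exact: integrable_fin_num.
by rewrite lee_fin; exact: ball_divergence_le.
Qed.

(** * Isoperimetric profiles *)

Section Profiles.
Variables (R : realType) (n : nat).
Local Notation Rn := 'rV[R]_n.
Hypothesis n_gt0 : (0 < n)%N.

(** [perimeter_ge] with [kappa = r^-1], the scale that brings the ball of radius [r] in [K] back to
    the unit ball. *)
Lemma profile_ge (D K : set Rn) (r : R) : closed D -> convex_set D -> interior D !=set0 ->
  convex_cone K -> (forall x k, D x -> K k -> D (x + k)) -> 0 < r ->
  ((n%:R * (ball_vol K 0 r / r))%:E <= isoperimetric_profile D (ball_vol K 0 r))%E.
Proof.
move=> clD cD iD cK DK r0; apply: le_ereal_inf_tmp => _ [E [mE ED vE] <-].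
have K0 := ball_vol_cone_gt0 cK.
rewrite [ball_vol K 0 r / r]mulrC mulrA.
apply: (perimeter_ge clD cD iD cK DK) => //.
- by rewrite ball_vol_cone// mulr_gt0// exprn_gt0.
- by rewrite invr_gt0.
by rewrite [ball_vol K 0 r]ball_vol_cone// mulrA -exprMn mulVf ?gt_eqF// expr1n mul1r.
Qed.

Lemma profile_le (D : set Rn) (p : Rn) (r : R) : closed D -> convex_set D -> D p -> 0 < r ->
  (isoperimetric_profile D (ball_vol D p r) <= (n%:R * (ball_vol D p r / r))%:E)%E.
Proof.
move=> clD cD Dp r0; rewrite mulrA; apply: le_trans (perimeter_ball_le clD cD Dp r0).
apply: ereal_inf_lbound; exists (D `&` eball p r) => //; split.
- by apply: measurable_lebesgue; exact: measurable_ball_sect.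
- by move=> x [].
- by rewrite volume_borel ?ball_volE//; exact: measurable_ball_sect.
Qed.

Lemma profile_cone (K : set Rn) (r : R) : convex_cone K -> 0 < r ->
  isoperimetric_profile K (ball_vol K 0 r) = (n%:R * (ball_vol K 0 r / r))%:E.
Proof.
move=> cK r0; have [clK Kadd _ Kint] := cK; have cvK := convex_cone_convex cK.
apply/eqP; rewrite eq_le profile_le//; last exact: convex_cone0.
exact: profile_ge.
Qed.

Lemma profile_ratio_bounds (C : set Rn) (p : Rn) (v : R) :
  unbounded_convex_body C -> C p -> non_degenerate (asymptotic_cone C p) -> 0 < v ->
  exists2 rK, 0 < rK & exists2 rC, 0 < rC &
    [/\ ball_vol (asymptotic_cone C p) 0 rK = v, ball_vol C p rC = v &
     1 <= fine (isoperimetric_profile C v) /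
          fine (isoperimetric_profile (asymptotic_cone C p) v) <= rK / rC].
Proof.
move=> [clC cC _ iC] Cp nd v0.
have cK : convex_cone (asymptotic_cone C p) by exact: asymptotic_cone_convex_cone.
set K := asymptotic_cone C p in nd cK *.
have [clK _ _ _] := cK; have cvK := convex_cone_convex cK; have K0 := convex_cone0 cK.
have a0 := ball_vol_cone_gt0 cK; set a := ball_vol K 0 1 in a0.
(* As [s >= 1], its power [s ^+ n] is at least [s], hence at least [v / a]: the ball of radius [s]
   in the cone, and so the one in [C], has volume at least [v]. *)
pose s := 1 + v / a.
have s1 : 1 <= s by rewrite lerDl divr_ge0// ltW.
have s0 : 0 < s by exact: lt_le_trans s1.
have vs : v <= s ^+ n * a.
  rewrite -ler_pdivrMr//; apply: (@le_trans _ _ s); first by rewrite lerDr.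
  by rewrite -[leLHS]expr1 ler_weXn2l.
have [|rK rK0 EK] := @ball_vol_surj R n K 0 v n_gt0 clK cvK K0 v0.
  by exists s; rewrite ball_vol_cone.
have [|rC rC0 EC] := @ball_vol_surj R n C p v n_gt0 clC cC Cp v0.
  by exists s; rewrite (le_trans vs)// ball_vol_ge_cone.
exists rK => //; exists rC => //; split => //.
have IK : isoperimetric_profile K v = (n%:R * (v / rK))%:E by rewrite -{1}EK profile_cone// EK.
have lb : ((n%:R * (v / rK))%:E <= isoperimetric_profile C v)%E.
  rewrite -EK; apply: profile_ge => //.
  by move=> x k Cx Kk; exact: asymptotic_cone_add Kk.
have ub : (isoperimetric_profile C v <= (n%:R * (v / rC))%:E)%E.
  by rewrite -EC; exact: profile_le.
have n0 : 0 < n%:R :> R by rewrite ltr0n.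
have b0 : 0 < n%:R * (v / rK) by rewrite mulr_gt0// divr_gt0.
rewrite IK /=; move: lb ub.
(* Both bounds are real numbers, which excludes infinite values of the profile. *)
case: (isoperimetric_profile C v) => [t| |]//=; rewrite !lee_fin => lb ub.
rewrite ler_pdivlMr// mul1r lb/= ler_pdivrMr//.
apply: (le_trans ub); rewrite le_eqVlt; apply/orP; left; apply/eqP; field.
by rewrite !gt_eqF.
Qed.

End Profiles.

Theorem theorem3p4 (R : realType) (n : nat) (n_ge1 : (1 <= n)%N)
    (C : set 'rV[R]_n.+1) (p : 'rV[R]_n.+1)
    (C_body : unbounded_convex_body C) (Cp : C p)
    (C_nondeg : non_degenerate (asymptotic_cone C p)) :
  (forall v : R, 0 < v ->
     1 <= fine (isoperimetric_profile C v)
          / fine (isoperimetric_profile (asymptotic_cone C p) v)) /\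
  (fine (isoperimetric_profile C v)
     / fine (isoperimetric_profile (asymptotic_cone C p) v))
    @[v --> +oo] --> (1 : R).
Proof.
have bounds v := @profile_ratio_bounds R n.+1 isT C p v C_body Cp C_nondeg.
split=> [v /bounds[rK _ [rC _ [_ _ /andP[]]]]//|].
have [clC cC _ _] := C_body.
have cK : convex_cone (asymptotic_cone C p) by exact: asymptotic_cone_convex_cone.
set K := asymptotic_cone C p in C_nondeg bounds cK *.
have a0 := ball_vol_cone_gt0 cK.
apply/cvgrPdist_le => e e0.
(* An error of [e] times the volume of the cone in the unit ball becomes the relative error [e]. *)
have [r1 r10 Hr1] := ball_vol_asymptotic clC cC Cp cK (mulr_gt0 e0 a0).
near=> v.
have v0 : 0 < v by near: v; exact: (nbhs_pinfty_gt (num_real _)).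
(* By monotonicity of the volume this forces [r1 <= rC], where the asymptotic estimate is valid. *)
have vr1 : ball_vol C p r1 < v by near: v; exact: (nbhs_pinfty_gt (num_real _)).
have [rK rK0 [rC rC0 [EK EC /andP[lb ub]]]] := bounds v v0.
rewrite distrC ger0_norm ?subr_ge0// lerBlDr (le_trans ub)//.
have r1C : r1 <= rC.
  rewrite leNgt; apply/negP => /ltW /(ball_vol_le p clC).
  by rewrite EC leNgt vr1.
have x1 : 1 <= rK / rC by exact: le_trans ub.
apply: (@le_trans _ _ ((rK / rC) ^+ n.+1)); first by rewrite -[leLHS]expr1 ler_weXn2l.
rewrite expr_div_n ler_pdivrMr ?exprn_gt0// -(ler_pM2r a0) -ball_vol_cone// EK -EC.
apply: (le_trans (Hr1 _ r1C)).
by rewrite [_ * rC ^+ _]mulrC -mulrA mulrDl mul1r addrC.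
Unshelve. all: by end_near.
Qed.
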